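(* At a Hopf bifurcation point (setting, normal form coefficients and $M=3$ Fourier Galerkin approximation as defined in the context), the Lyapunov coefficients satisfy, as $\varepsilon\to0$, $$\beta_R(\lambda^\star)=-\dot\alpha_R(\lambda^\star)\frac{\lambda_3^F(\varepsilon)-\lambda^\star}{\varepsilon^2}+O(\varepsilon^2),$$ $$\beta_I(\lambda^\star)=\frac{\omega_3^F(\varepsilon)-\omega^\star}{\varepsilon^2}-\dot\alpha_I(\lambda^\star)\frac{\lambda_3^F(\varepsilon)-\lambda^\star}{\varepsilon^2}+O(\varepsilon^2),$$ and the coefficients of the normal form transformation polynomials $\widehat{\boldsymbol h}(\cdot;\lambda^\star)$, $\widetilde{\boldsymbol h}(\cdot;\lambda^\star)$ satisfy $$\widehat{\boldsymbol a}_m(\lambda^\star)=\tfrac1\varepsilon\widehat{\boldsymbol a}_m^F(\varepsilon)+O(\varepsilon^2),\qquad \widetilde{\boldsymbol a}_m(\lambda^\star)=\tfrac1\varepsilon\widetilde{\boldsymbol a}_m^F(\varepsilon)+O(\varepsilon^2)\qquad(m=0,2),$$ $$\widehat{\boldsymbol b}_m(\lambda^\star)=\tfrac1\varepsilon\widehat{\boldsymbol b}_m^F(\varepsilon)+O(\varepsilon^2),\qquad \widetilde{\boldsymbol b}_m(\lambda^\star)=\tfrac1\varepsilon\widetilde{\boldsymbol b}_m^F(\varepsilon)+O(\varepsilon^2)\qquad(m=2),$$ $$\widehat{\boldsymbol a}_m(\lambda^\star)=\tfrac1{\varepsilon^2}\widehat{\boldsymbol a}_m^F(\varepsilon)+O(\varepsilon^2),\qquad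 \widehat{\boldsymbol b}_m(\lambda^\star)=\tfrac1{\varepsilon^2}\widehat{\boldsymbol b}_m^F(\varepsilon)+O(\varepsilon^2)\qquad(m=1,3).$$
   Context: Setting (Hopf bifurcation). $\boldsymbol F:\mathbb R^n\times\mathbb R\to\mathbb R^n$ is smooth, $\mathsf J(\boldsymbol x,\lambda)$ is its Jacobian matrix with respect to $\boldsymbol x$, and $\mathbb S^1=\mathbb R/2\pi\mathbb Z$. Assume: (1) $\boldsymbol F(\boldsymbol x^\star,\lambda^\star)=\boldsymbol 0$. (2) There are $\mathsf E^\star\in\mathbb R^{n\times n}$ and a non-singular $\mathsf P^\star\in\mathbb R^{n\times n}$ with $\mathsf J(\boldsymbol x^\star,\lambda^\star)\mathsf P^\star=\mathsf P^\star\mathsf E^\star$, $\mathsf E^\star=\mathrm{diag}(\widehat{\mathsf E}^\star,\widetilde{\mathsf E}^\star)$ block diagonal, $\widehat{\mathsf E}^\star=\begin{pmatrix}0&-\omega^\star\\ \omega^\star&0\end{pmatrix}$ with $\omega^\star>0$, and $\widetilde{\mathsf E}^\star\in\mathbb R^{(n-2)\times(n-2)}$ with no eigenvalues on the imaginary axis. Consequently, for $\lambda$ near $\lambda^\star$ there is a locally unique smooth curve $\boldsymbol x^\star(\lambda)$ with $\boldsymbol F(\boldsymbol x^\star(\lambda),\lambda)=\boldsymbol 0$, $\boldsymbol x^\star(\lambda^\star)=\boldsymbol x^\star$, and smooth $\mathsf P(\lambda)$ (non-singular), $\mathsf E(\lambda)$ with $\mathsf P(\lambda^\star)=\mathsf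 P^\star$, $\mathsf E(\lambda^\star)=\mathsf E^\star$, $\mathsf J(\boldsymbol x^\star(\lambda),\lambda)\mathsf P(\lambda)=\mathsf P(\lambda)\mathsf E(\lambda)$, $\mathsf E(\lambda)=\mathrm{diag}(\widehat{\mathsf E}(\lambda),\widetilde{\mathsf E}(\lambda))$, $\widehat{\mathsf E}(\lambda)=\begin{pmatrix}\alpha_R(\lambda)&-\alpha_I(\lambda)\\ \alpha_I(\lambda)&\alpha_R(\lambda)\end{pmatrix}$. (3) Transversality: $\dot\alpha_R(\lambda^\star)\ne0$ (dot denotes $d/d\lambda$). Notation. $\boldsymbol a^\star(\theta)=(\cos\theta,\sin\theta,0,\dots,0)^T$, $\dot{\boldsymbol a}^\star(\theta)=(-\sin\theta,\cos\theta,0,\dots,0)^T\in\mathbb R^n$; $\widehat{\boldsymbol e}_1=(1,0)^T$, $\widehat{\boldsymbol e}_2=(0,1)^T$. $\langle\boldsymbol w_1(\theta),\boldsymbol w_2(\theta)\rangle=\frac1{2\pi}\int_0^{2\pi}\boldsymbol w_1\cdot\boldsymbol w_2\,d\theta$. Put $\boldsymbol\gamma(\boldsymbol z)=(\langle\boldsymbol z,\boldsymbol a^\star\rangle,\langle\boldsymbol z,\dot{\boldsymbol a}^\star\rangle)^T$ and $\boldsymbol G(\boldsymbol z,\lambda;\varepsilon)=\frac1\varepsilon\mathsf P(\lambda)^{-1}\boldsymbol F(\boldsymbol x^\star(\lambda)+\varepsilon\mathsf P(\lambda)\boldsymbol z,\lambda)$ (with $\boldsymbol G(\boldsymbol z,\lambda;0)=\mathsf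 E(\lambda)\boldsymbol z$). Write $\boldsymbol z=(\widehat{\boldsymbol z},\widetilde{\boldsymbol z})\in\mathbb R^2\times\mathbb R^{n-2}$ and correspondingly $\boldsymbol G=(\widehat{\boldsymbol G},\widetilde{\boldsymbol G})$. Galerkin approximation. With $\mathsf S_3$ the truncation of Fourier series to modes $0,\dots,3$, for $|\varepsilon|$ small let $\lambda_3^F(\varepsilon),\omega_3^F(\varepsilon)$, $\boldsymbol z_3^F(\theta;\varepsilon)=\boldsymbol a^\star(\theta)+\boldsymbol a_0^F(\varepsilon)+\sum_{m=1}^3\{\boldsymbol a_m^F(\varepsilon)\cos m\theta+\boldsymbol b_m^F(\varepsilon)\sin m\theta\}$ be the locally unique solution near $(\lambda^\star,\omega^\star,\boldsymbol a^\star)$ of $\mathsf S_3\boldsymbol G(\boldsymbol z_3(\theta),\lambda;\varepsilon)-\omega\frac{d}{d\theta}\boldsymbol z_3(\theta)=\boldsymbol 0$, $\boldsymbol\gamma(\boldsymbol z_3)=\widehat{\boldsymbol e}_1$. Write $\boldsymbol a_m^F=(\widehat{\boldsymbol a}_m^F,\widetilde{\boldsymbol a}_m^F)$, $\boldsymbol b_m^F=(\widehat{\boldsymbol b}_m^F,\widetilde{\boldsymbol b}_m^F)$ for the splitting in $\mathbb R^2\times\mathbb R^{n-2}$. Normal form. For $\lambda$ near $\lambda^\star$, consider near-identity transformations $(\widehat{\boldsymbol y},\widetilde{\boldsymbol y})\mapsto(\widehat{\boldsymbol z},\widetilde{\boldsymbol z})$, with $\widehat{\boldsymbol y}=(\hat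 y_1,\hat y_2)$, $$\widehat{\boldsymbol z}=\widehat{\boldsymbol y}+\tfrac1\varepsilon\widehat{\boldsymbol h}(\varepsilon\widehat{\boldsymbol y};\lambda)=\widehat{\boldsymbol y}+\varepsilon\{[\hat y_1^2+\hat y_2^2]\widehat{\boldsymbol a}_0(\lambda)+[\hat y_1^2-\hat y_2^2]\widehat{\boldsymbol a}_2(\lambda)+2\hat y_1\hat y_2\widehat{\boldsymbol b}_2(\lambda)\}$$ $$+\varepsilon^2\{\hat y_1[\hat y_1^2+\hat y_2^2]\widehat{\boldsymbol a}_1(\lambda)+\hat y_2[\hat y_1^2+\hat y_2^2]\widehat{\boldsymbol b}_1(\lambda)+\hat y_1[\hat y_1^2-3\hat y_2^2]\widehat{\boldsymbol a}_3(\lambda)+\hat y_2[3\hat y_1^2-\hat y_2^2]\widehat{\boldsymbol b}_3(\lambda)\},$$ $$\widetilde{\boldsymbol z}=\widetilde{\boldsymbol y}+\tfrac1\varepsilon\widetilde{\boldsymbol h}(\varepsilon\widehat{\boldsymbol y};\lambda)=\widetilde{\boldsymbol y}+\varepsilon\{[\hat y_1^2+\hat y_2^2]\widetilde{\boldsymbol a}_0(\lambda)+[\hat y_1^2-\hat y_2^2]\widetilde{\boldsymbol a}_2(\lambda)+2\hat y_1\hat y_2\widetilde{\boldsymbol b}_2(\lambda)\},$$ subject to $\widehat{\boldsymbol a}_1(\lambda)\cdot\widehat{\boldsymbol e}_1+\widehat{\boldsymbol b}_1(\lambda)\cdot\widehat{\boldsymbol e}_2=0$ and $\widehat{\boldsymbol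 a}_1(\lambda)\cdot\widehat{\boldsymbol e}_2-\widehat{\boldsymbol b}_1(\lambda)\cdot\widehat{\boldsymbol e}_1=0$. They transform the vector field $\boldsymbol G$ into $(\widehat{\boldsymbol G}^\dagger,\widetilde{\boldsymbol G}^\dagger)$, where $\widehat{\boldsymbol G}^\dagger=(\mathsf I+D\widehat{\boldsymbol h}(\varepsilon\widehat{\boldsymbol y};\lambda))^{-1}\widehat{\boldsymbol G}$ and $\widetilde{\boldsymbol G}^\dagger=\widetilde{\boldsymbol G}-D\widetilde{\boldsymbol h}(\varepsilon\widehat{\boldsymbol y};\lambda)\widehat{\boldsymbol G}^\dagger$ ($D$ denotes the derivative in the $\mathbb R^2$ argument), with expansions $\widehat{\boldsymbol G}^\dagger=\widehat{\mathsf E}(\lambda)\widehat{\boldsymbol y}+\sum_{p\ge2}\varepsilon^{p-1}\widehat{\boldsymbol G}_p^\dagger(\widehat{\boldsymbol y},\widetilde{\boldsymbol y};\lambda)$, $\widetilde{\boldsymbol G}^\dagger=\widetilde{\mathsf E}(\lambda)\widetilde{\boldsymbol y}+\sum_{p\ge2}\varepsilon^{p-1}\widetilde{\boldsymbol G}_p^\dagger(\widehat{\boldsymbol y},\widetilde{\boldsymbol y};\lambda)$, the $p$-th terms being homogeneous polynomials of degree $p$. The polynomials $\widehat{\boldsymbol h},\widetilde{\boldsymbol h}$ (with coefficients depending smoothly on $\lambda$) are chosen so that: the quadratic terms in $\widehat{\boldsymbol y}$ of $\widetilde{\boldsymbol G}_2^\dagger$ vanish; the quadratic terms in $\widehat{\boldsymbol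 y}$ of $\widehat{\boldsymbol G}_2^\dagger$ vanish; and the cubic terms in $\widehat{\boldsymbol y}$ of $\widehat{\boldsymbol G}_3^\dagger$ have the form $[\hat y_1^2+\hat y_2^2]\begin{pmatrix}\beta_R(\lambda)&-\beta_I(\lambda)\\ \beta_I(\lambda)&\beta_R(\lambda)\end{pmatrix}\widehat{\boldsymbol y}$. The numbers $\beta_R(\lambda),\beta_I(\lambda)$ are the Lyapunov coefficients. *)

(* Defs.v *)
From HB Require Import structures.
From mathcomp Require Import all_boot all_order all_algebra.
From mathcomp Require Import all_classical all_reals all_analysis.
From mathcomp Require Import complex.

Set Implicit Arguments.
Unset Strict Implicit.
Unset Printing Implicit Defensive.

Import Order.TTheory GRing.Theory Num.Theory.
Import numFieldNormedType.Exports.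

Local Open Scope classical_set_scope.
Local Open Scope ring_scope.

Section Smoothness.
Context {R : realType}.

(* Continuity of all iterated directional derivatives.  This is the usual C^k
   only for finite-dimensional V, which is the only case used below. *)
Fixpoint Ck_on {V W : normedModType R} (k : nat) (U : set V) (f : V -> W)
    : Prop :=
  (forall x, U x -> {for x, continuous f}) /\
  match k with
  | 0%N => True
  | k'.+1 => forall v : V,
      (forall x, U x -> derivable f x v) /\ Ck_on k' U ('D_v f)
  end.

Definition smooth_on {V W : normedModType R} (U : set V) (f : V -> W) : Prop :=
  forall k, Ck_on k U f.

Definition smooth_near {V W : normedModType R} (x : V) (f : V -> W) : Prop :=
  exists U : set V, [/\ open U, U x & smooth_on U f].

(* The library's jacobian is for row vectors acting on the right, i.e. it is
   the transpose of this one. *)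
Definition jac {n p : nat} (f : 'cV[R]_n -> 'cV[R]_p) (x : 'cV[R]_n)
    : 'M[R]_(p, n) :=
  \matrix_(i, j) ('D_(delta_mx j 0) f x) i 0.

End Smoothness.

(* x = g e + O(e^2) as e -> 0, e <> 0. *)
Definition eqO_eps2 {R : realType} {V : normedModType R} (x : V) (g : R -> V)
    : Prop :=
  cst x = g +O_ (0^') (fun e : R => e ^+ 2).

Section Planar.
Context {R : realType}.

Definition vec2 (u v : R) : 'cV[R]_2 := \col_i (if i == 0 then u else v).

(* The matrix ((u, -v), (v, u)). *)
Definition rot2 (u v : R) : 'M[R]_2 :=
  \matrix_(i, j) (if i == j then u else if i == 0 then - v else v).

Definition dot {n : nat} (u v : 'cV[R]_n) : R := \sum_i u i 0 * v i 0.

End Planar.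

Section Fourier.
Context {R : realType}.

Definition mean (f : R -> R) : R :=
  (2 * pi)^-1 * \int[lebesgue_measure]_(t in `[0, 2 * pi]) f t.

Definition vmean {n : nat} (w : R -> 'cV[R]_n) : 'cV[R]_n :=
  \col_i mean (fun t => w t i 0).

Definition inner {n : nat} (w1 w2 : R -> 'cV[R]_n) : R :=
  mean (fun t => dot (w1 t) (w2 t)).

Definition fourier_trunc {n : nat} (M : nat) (w : R -> 'cV[R]_n) (t : R)
    : 'cV[R]_n :=
  vmean w +
  \sum_(1 <= m < M.+1)
    (cos (m%:R * t) *: (2 *: vmean (fun s => cos (m%:R * s) *: w s)) +
     sin (m%:R * t) *: (2 *: vmean (fun s => sin (m%:R * s) *: w s))).

Definition acirc (k : nat) (t : R) : 'cV[R]_(2 + k) :=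
  col_mx (vec2 (cos t) (sin t)) 0.

Definition dacirc (k : nat) (t : R) : 'cV[R]_(2 + k) :=
  col_mx (vec2 (- sin t) (cos t)) 0.

Definition gamma {k : nat} (z : R -> 'cV[R]_(2 + k)) : 'cV[R]_2 :=
  vec2 (inner z (@acirc k)) (inner z (@dacirc k)).

(* a 0 is the constant mode; b 0 is not used. *)
Definition trig_orbit {k : nat} (M : nat) (a b : nat -> 'cV[R]_(2 + k)) (t : R)
    : 'cV[R]_(2 + k) :=
  acirc k t + a 0%N +
  \sum_(1 <= m < M.+1) (cos (m%:R * t) *: a m + sin (m%:R * t) *: b m).

End Fourier.

Section Hopf.
Context {R : realType} {k : nat}.
Local Notation n := (2 + k)%N.

Definition jacobian_x (F : 'cV[R]_n -> R -> 'cV[R]_n) (x : 'cV[R]_n) (l : R)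
    : 'M[R]_n :=
  jac (fun x' => F x' l) x.

Definition no_imaginary_eigenvalue (A : 'M[R]_k) : Prop :=
  forall mu : complex.complex R,
    eigenvalue (map_mx (complex.real_complex R) A) mu -> complex.Re mu != 0.

Definition hopf_point (F : 'cV[R]_n -> R -> 'cV[R]_n) (xstar : 'cV[R]_n)
    (lstar wstar : R) (Pstar : 'M[R]_n) (Etstar : 'M[R]_k) : Prop :=
  [/\ F xstar lstar = 0,
      0 < wstar,
      Pstar \in unitmx,
      jacobian_x F xstar lstar *m Pstar =
        Pstar *m block_mx (rot2 0 wstar) 0 0 Etstar
    & no_imaginary_eigenvalue Etstar].

(* The equilibrium curve x*(lambda), the frame P(lambda) and the blocks of
   E(lambda), continued from the Hopf point. *)
Record continuation := Continuation {
  xcurve : R -> 'cV[R]_n;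
  frame : R -> 'M[R]_n;
  alphaR : R -> R;
  alphaI : R -> R;
  Etilde : R -> 'M[R]_k }.

Definition Ehat (D : continuation) (l : R) : 'M[R]_2 :=
  rot2 (alphaR D l) (alphaI D l).

Definition Emat (D : continuation) (l : R) : 'M[R]_n :=
  block_mx (Ehat D l) 0 0 (Etilde D l).

Definition hopf_continuation (F : 'cV[R]_n -> R -> 'cV[R]_n)
    (xstar : 'cV[R]_n) (lstar wstar : R) (Pstar : 'M[R]_n) (Etstar : 'M[R]_k)
    (D : continuation) : Prop :=
  [/\ [/\ smooth_near lstar (xcurve D), smooth_near lstar (frame D)
        & smooth_near lstar (Emat D)],
      [/\ xcurve D lstar = xstar, frame D lstar = Pstar
        & Emat D lstar = block_mx (rot2 0 wstar) 0 0 Etstar]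
    & \forall l \near lstar,
        [/\ F (xcurve D l) l = 0,
            frame D l \in unitmx
          & jacobian_x F (xcurve D l) l *m frame D l =
              frame D l *m Emat D l]].

Definition Gfield (F : 'cV[R]_n -> R -> 'cV[R]_n) (D : continuation)
    (z : 'cV[R]_n) (l e : R) : 'cV[R]_n :=
  if e == 0 then Emat D l *m z
  else e^-1 *: (invmx (frame D l) *m
                F (xcurve D l + e *: (frame D l *m z)) l).

Definition galerkin_solution (F : 'cV[R]_n -> R -> 'cV[R]_n) (D : continuation)
    (M : nat) (e l w : R) (a b : nat -> 'cV[R]_n) : Prop :=
  (forall t, fourier_trunc M (fun s => Gfield F D (trig_orbit M a b s) l e) t
               - w *: derive1 (trig_orbit M a b) t = 0) /\
  gamma (trig_orbit M a b) = vec2 1 0.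

Definition galerkin_near (M : nat) (lstar wstar d l w : R)
    (a b : nat -> 'cV[R]_n) : Prop :=
  [/\ `|l - lstar| < d,
      `|w - wstar| < d,
      forall m, (m <= M)%N -> `|a m| < d
    & forall m, (1 <= m <= M)%N -> `|b m| < d].

(* (l e, w e, a m e, b m e) is, for small |e|, the unique solution in a fixed
   neighbourhood of (lstar, wstar, acirc), and it lies in any prescribed
   neighbourhood when |e| is small enough. *)
Definition galerkin_branch (F : 'cV[R]_n -> R -> 'cV[R]_n) (D : continuation)
    (M : nat) (lstar wstar : R) (l w : R -> R) (a b : nat -> R -> 'cV[R]_n)
    : Prop :=
  (forall d, 0 < d -> \forall e \near (0 : R),
     galerkin_near M lstar wstar d (l e) (w e) (a ^~ e) (b ^~ e)) /\
  (exists2 d, 0 < d & \forall e \near (0 : R),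
     galerkin_solution F D M e (l e) (w e) (a ^~ e) (b ^~ e) /\
     forall l' w' a' b',
       galerkin_near M lstar wstar d l' w' a' b' ->
       galerkin_solution F D M e l' w' a' b' ->
       [/\ l' = l e,
           w' = w e,
           forall m, (m <= M)%N -> a' m = a m e
         & forall m, (1 <= m <= M)%N -> b' m = b m e]).

(* Coefficients of the near-identity transformation.  The quadratic ones are
   stacked in R^n, their hat and tilde parts being usubmx and dsubmx. *)
Record nf_coefs := NfCoefs {
  nf_a0 : R -> 'cV[R]_n;
  nf_a2 : R -> 'cV[R]_n;
  nf_b2 : R -> 'cV[R]_n;
  nf_a1 : R -> 'cV[R]_2;
  nf_b1 : R -> 'cV[R]_2;
  nf_a3 : R -> 'cV[R]_2;
  nf_b3 : R -> 'cV[R]_2 }.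

Definition nf_quad (c : nf_coefs) (l : R) (y : 'cV[R]_2) : 'cV[R]_n :=
  let y1 := y 0 0 in let y2 := y 1 0 in
  (y1 ^+ 2 + y2 ^+ 2) *: nf_a0 c l + (y1 ^+ 2 - y2 ^+ 2) *: nf_a2 c l
    + (2 * y1 * y2) *: nf_b2 c l.

Definition nf_cubic (c : nf_coefs) (l : R) (y : 'cV[R]_2) : 'cV[R]_2 :=
  let y1 := y 0 0 in let y2 := y 1 0 in
  (y1 * (y1 ^+ 2 + y2 ^+ 2)) *: nf_a1 c l
    + (y2 * (y1 ^+ 2 + y2 ^+ 2)) *: nf_b1 c l
    + (y1 * (y1 ^+ 2 - 3 * y2 ^+ 2)) *: nf_a3 c l
    + (y2 * (3 * y1 ^+ 2 - y2 ^+ 2)) *: nf_b3 c l.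

Definition hhat (c : nf_coefs) (l : R) (y : 'cV[R]_2) : 'cV[R]_2 :=
  usubmx (nf_quad c l y) + nf_cubic c l y.

Definition htilde (c : nf_coefs) (l : R) (y : 'cV[R]_2) : 'cV[R]_k :=
  dsubmx (nf_quad c l y).

Definition nf_transform (c : nf_coefs) (l e : R) (y : 'cV[R]_n) : 'cV[R]_n :=
  col_mx (usubmx y + e *: usubmx (nf_quad c l (usubmx y))
            + e ^+ 2 *: nf_cubic c l (usubmx y))
         (dsubmx y + e *: dsubmx (nf_quad c l (usubmx y))).

Definition Ghat_dag (F : 'cV[R]_n -> R -> 'cV[R]_n) (D : continuation)
    (c : nf_coefs) (y : 'cV[R]_n) (l e : R) : 'cV[R]_2 :=
  invmx (1%:M + jac (hhat c l) (e *: usubmx y))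
    *m usubmx (Gfield F D (nf_transform c l e y) l e).

Definition Gtilde_dag (F : 'cV[R]_n -> R -> 'cV[R]_n) (D : continuation)
    (c : nf_coefs) (y : 'cV[R]_n) (l e : R) : 'cV[R]_k :=
  dsubmx (Gfield F D (nf_transform c l e y) l e)
    - jac (htilde c l) (e *: usubmx y) *m Ghat_dag F D c y l e.

(* Homogeneous polynomial map of degree p, as a sum over (ordered) monomials
   y_(f 0) ... y_(f (p-1)). *)
Definition homogeneous {q : nat} (p : nat) (g : 'cV[R]_n -> 'cV[R]_q) : Prop :=
  exists c : {ffun 'I_p -> 'I_n} -> 'cV[R]_q,
    forall y, g y = \sum_(f : {ffun 'I_p -> 'I_n}) (\prod_i y (f i) 0) *: c f.

(* gfun y e = L y + \sum_(p >= 2) e^(p-1) Gp p y as an asymptotic series in e,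
   with Gp p homogeneous of degree p. *)
Definition eps_expansion {q : nat} (gfun : 'cV[R]_n -> R -> 'cV[R]_q)
    (L : 'cV[R]_n -> 'cV[R]_q) (Gp : nat -> 'cV[R]_n -> 'cV[R]_q) : Prop :=
  (forall p, (2 <= p)%N -> homogeneous p (Gp p)) /\
  (forall (y : 'cV[R]_n) (N : nat), (1 <= N)%N ->
     gfun y = (fun e => L y + \sum_(2 <= p < N.+1) e ^+ p.-1 *: Gp p y)
       +O_ (0^') (fun e : R => e ^+ N)).

(* For a polynomial map g of (yhat, ytilde), setting ytilde = 0 keeps exactly
   the monomials in yhat alone. *)
Definition hat_terms {q : nat} (g : 'cV[R]_n -> 'cV[R]_q) (yh : 'cV[R]_2)
    : 'cV[R]_q :=
  g (col_mx yh 0).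

Definition nf_conditions (F : 'cV[R]_n -> R -> 'cV[R]_n) (D : continuation)
    (c : nf_coefs) (l bR bI : R) : Prop :=
  (nf_a1 c l 0 0 + nf_b1 c l 1 0 = 0 /\ nf_a1 c l 1 0 - nf_b1 c l 0 0 = 0) /\
  exists (Gh : nat -> 'cV[R]_n -> 'cV[R]_2) (Gt : nat -> 'cV[R]_n -> 'cV[R]_k),
    [/\ eps_expansion (fun y e => Ghat_dag F D c y l e)
          (fun y => Ehat D l *m usubmx y) Gh,
        eps_expansion (fun y e => Gtilde_dag F D c y l e)
          (fun y => Etilde D l *m dsubmx y) Gt,
        forall yh, hat_terms (Gt 2%N) yh = 0,
        forall yh, hat_terms (Gh 2%N) yh = 0
      & forall yh, hat_terms (Gh 3%N) yh =
          (yh 0 0 ^+ 2 + yh 1 0 ^+ 2) *: (rot2 bR bI *m yh)].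

Definition lyapunov_normal_form (F : 'cV[R]_n -> R -> 'cV[R]_n)
    (D : continuation) (lstar : R) (c : nf_coefs) (betaR betaI : R -> R)
    : Prop :=
  [/\ [/\ smooth_near lstar (nf_a0 c), smooth_near lstar (nf_a2 c)
        & smooth_near lstar (nf_b2 c)],
      [/\ smooth_near lstar (nf_a1 c), smooth_near lstar (nf_b1 c),
          smooth_near lstar (nf_a3 c) & smooth_near lstar (nf_b3 c)]
    & \forall l \near lstar, nf_conditions F D c l (betaR l) (betaI l)].

End Hopf.

Arguments continuation R k : clear implicits.
Arguments nf_coefs R k : clear implicits.

(* Main.v *)
(* On the unit circle the normal form conditions become the homological equations
   A q + B2(y,y) = w q' and, in the centre directions,
   A k + B2(y,q) + B2(q,y) + B3(y,y,y) = w k' + (Lyapunov terms), where y = acirc,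
   q and k are the quadratic and cubic parts of the transformation, B2 and B3 are
   the Taylor coefficients of the field, and A, w are taken at the Hopf point.
   The Galerkin residual has vanishing Fourier coefficients of order 0..3, and so
   has its half-period shift.  Its linearisation is inverted harmonic by harmonic:
   E^2 + (m w)^2 is invertible off resonance, while at m = 1 in the centre plane
   the phase and amplitude constraints together with the unknown lambda and omega
   replace the kernel.  Hence the Galerkin solution is y + e q + O(e^2), and
   separating harmonics of even and odd order improves this to O(e^3) for the
   even ones and identifies the odd ones with e^2 k up to O(e^4). *)
Require Import Defs.
From HB Require Import structures.
From mathcomp Require Import all_boot all_order all_algebra.
From mathcomp Require Import all_classical all_reals all_analysis.
From mathcomp Require Import complex ring lra.

Set Implicit Arguments.
Unset Strict Implicit.
Unset Printing Implicit Defensive.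

Import Order.TTheory GRing.Theory Num.Theory.
Import numFieldNormedType.Exports.

Local Open Scope classical_set_scope.
Local Open Scope ring_scope.

(** * Taylor expansion along lines *)

(** The branch is only known to converge to the circle, with no rate and no smoothness in [e], so it
    is not expanded in powers of [e]. Instead every step is an explicit inequality in the unknown
    deviation, uniform in time, and the rate comes out of a bootstrap. The half-period shift does
    the work of a symmetry [e -> -e] of the branch: it negates the circle and the odd harmonics and
    fixes the even ones, so half sums and half differences of a single residual separate the
    parities at the same [e]. Harmonics up to 3 suffice because on the unit circle the quadratic and
    cubic parts of the transformation are trigonometric polynomials of degree at most 3; higher
    harmonics of the residual need not vanish, but they are orthogonal to everything compared. The
    field is expanded with error [e^4], since a cubic coefficient to accuracy [e^2] is an odd
    harmonic to accuracy [e^4]. The Lyapunov formulas are the solvability conditions at the resonant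
    harmonic: the forcing there is one rotation matrix, both of whose entries must be [O(e^4)]. *)

Section LineDerivatives.
Context {R : realType} {V : normedModType R}.
Implicit Types (f g : V -> R) (x u v : V).

Lemma is_derive_line f x v (s : R) : derivable f (x + s *: v) v ->
  is_derive s (1 : R) (fun s => f (x + s *: v)) ('D_v f (x + s *: v)).
Proof.
move=> df.
have E : (fun h : R => h^-1 *: (f (x + (h *: (1:R) + s) *: v) - f (x + s *: v)))
   = (fun h => h^-1 *: ((f \o shift (x + s *: v)) (h *: v) - f (x + s *: v))).
  apply/funext => h /=; congr (_ *: (f _ - _)).
  by rewrite scalerDl addrCA [h *: 1]mulr1 addrC.
apply: DeriveDef.
  by rewrite /derivable /= E.
by rewrite /derive /= E.
Qed.

Lemma MVT_line f x v : (forall y, derivable f y v) ->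
  exists2 s : R, 0 <= s <= 1 & f (x + v) - f x = 'D_v f (x + s *: v).
Proof.
move=> df.
have d s := is_derive_line (df (x + s *: v)).
have [|s s01] := @MVT _ (fun s => f (x + s *: v)) (fun s => 'D_v f (x + s *: v)) 0 1 ltr01.
  by apply: derivable_within_continuous => s _; have [] := d s.
rewrite scale1r scale0r addr0 subr0 mulr1 => ->.
by exists s => //; move: s01; rewrite in_itv /= => /andP[/ltW -> /ltW ->].
Qed.

(** The chain rule along [s * c] never divides by [c], so a zero factor needs no separate case. *)
Lemma derive_dirZ f x (c : R) v : (forall y, derivable f y v) ->
  is_derive x (c *: v) f (c * 'D_v f x).
Proof.
move=> df.
have : is_derive (0:R) (1:R) (fun s => f (x + s *: (c *: v))) (c * 'D_v f x).
  have -> : (fun s : R => f (x + s *: (c *: v))) = (fun s => f (x + s *: v)) \o (fun s => s * c).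
    by apply/funext => s /=; rewrite scalerA.
  have d0 : is_derive (0 * c) (1:R) (fun s => f (x + s *: v)) ('D_v f x).
    have := is_derive_line (df (x + (0 * c) *: v)).
    by rewrite !mul0r scale0r addr0.
  have dc : is_derive (0:R) (1:R) (fun s : R => s * c) c.
    by apply: is_derive_eq; rewrite scaler0 add0r -[LHS]/(c * 1) mulr1.
  have := @is_derive1_comp _ (fun s : R => f (x + s *: v)) (fun s : R => s * c) 0 _ _ d0 dc.
  by move=> /is_derive_eq; apply; rewrite mulrC.
move=> [dd dE].
have E : (fun h : R => h^-1 *: (f (x + (h *: (1:R) + 0) *: (c *: v)) - f (x + 0 *: (c *: v))))
   = (fun h => h^-1 *: ((f \o shift x) (h *: (c *: v)) - f x)).
  apply/funext => k /=; congr (_ *: (f _ - f _)); last by rewrite scale0r addr0.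
  by rewrite addr0 [k *: 1]mulr1 addrC.
apply: DeriveDef; first by rewrite /derivable -E.
by rewrite -dE /derive -E.
Qed.

(** Directional derivatives are not additive in general; continuity of ['D_v f] at [x] is what makes
    them so. The quotient along [u + v] splits into one along [u] at [x] and one along [v] at the
    moving point [h *: u + x]. The mean value theorem turns the latter into ['D_v f] at a point
    within [|h| (|u| + |v|)] of [x]. *)
Lemma derive_dirD f x u v :
  (forall y, derivable f y u) -> (forall y, derivable f y v) ->
  {for x, continuous ('D_v f)} ->
  is_derive x (u + v) f ('D_u f x + 'D_v f x).
Proof.
move=> du dv cv.
suff H : (fun h : R => h^-1 *: (f (h *: (u + v) + x) - f x)) @ 0^' --> 'D_u f x + 'D_v f x.
  by apply: DeriveDef; [apply/cvg_ex; eexists; exact: H | exact: cvg_lim H].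
have E : (fun h : R => h^-1 *: (f (h *: (u + v) + x) - f x)) =
  (fun h : R => h^-1 *: (f (h *: u + x) - f x) +
                h^-1 *: (f (h *: u + x + h *: v) - f (h *: u + x))).
  apply/funext => h; rewrite -scalerDr; congr (_ *: _).
  by rewrite [RHS]addrC subrKA scalerDr addrAC.
rewrite E; apply: cvgD; first exact: (du x).
apply/cvgrPdist_lt => /= eps eps0.
have /cvgrPdist_lt /(_ eps eps0) := cv.
move=> /nbhs_ballP[d /= d0 bd].
have M0 : 0 < `|u| + `|v| + 1 by rewrite ltr_wpDl // addr_ge0.
near=> h.
have h0 : h != 0 by near: h; exact: nbhs_dnbhs_neq.
have [s s01 ->] := @MVT_line f (h *: u + x) (h *: v) (fun y => @ex_derive _ _ _ _ _ _ _ (derive_dirZ y h dv)).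
have [_ ->] := derive_dirZ (h *: u + x + s *: (h *: v)) h dv.
rewrite [_ *: _]mulrA mulVf // mul1r.
apply: bd; rewrite -ball_normE /=.
have -> : x - (h *: u + x + s *: (h *: v)) = - (h *: u + s *: (h *: v)).
  by rewrite addrAC opprD addrCA subrr addr0.
rewrite normrN.
apply: (@le_lt_trans _ _ (`|h| * (`|u| + `|v| + 1))).
  apply: (le_trans (ler_normD _ _)); rewrite !normrZ !mulrDr mulr1 -addrA lerD2l.
  move: s01 => /andP[s0 s1]; rewrite ger0_norm //.
  by rewrite ler_wpDr // ler_piMl // mulr_ge0.
rewrite -ltr_pdivlMr //.
near: h; apply: dnbhs0_lt; exact: divr_gt0.
Unshelve. all: by end_near.
Qed.

End LineDerivatives.

Section Smooth.
Context {R : realType} {V : normedModType R}.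
Implicit Types (f g : V -> R) (x u v : V).
Local Notation smooth := (smooth_on [set: V]).

Lemma smooth_derivable f x v : smooth f -> derivable f x v.
Proof. by move=> /(_ 1%N)[_ /(_ v)[+ _]] => /(_ x I). Qed.

Lemma smooth_continuous f : smooth f -> continuous f.
Proof. by move=> /(_ 0%N)[+ _] x => /(_ x I). Qed.

Lemma smooth_derive f v : smooth f -> smooth ('D_v f).
Proof. by move=> sf n; have [_ /(_ v)[_]] := sf n.+1. Qed.

Lemma smoothD f g : smooth f -> smooth g -> smooth (f + g).
Proof.
move=> sf sg n; elim: n f g sf sg => [|n IH] f g sf sg.
  by split=> // x _; apply: continuousD; exact: smooth_continuous.
split=> [x _|v].
  by apply: continuousD; exact: smooth_continuous.
have E : 'D_v (f + g) = 'D_v f + 'D_v g.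
  by apply/funext => x; rewrite deriveD //; exact: smooth_derivable.
split=> [x _|]; first by apply: derivableD; exact: smooth_derivable.
by rewrite E; apply: IH; exact: smooth_derive.
Qed.

Lemma smoothZ f (c : R) : smooth f -> smooth (c *: f).
Proof.
move=> sf n.
have cZ g : smooth g -> continuous (c *: g).
  by move=> sg y; apply: cvgZl_tmp; exact: (@smooth_continuous _ sg y).
elim: n f sf => [|n IH] f sf; first by split; [move=> x _; exact: cZ|].
split=> [x _|v]; first exact: cZ.
have E : 'D_v (c *: f) = c *: 'D_v f.
  by apply/funext => x; rewrite deriveZ //; exact: smooth_derivable.
split=> [x _|]; first by apply: derivableZ; exact: smooth_derivable.
by rewrite E; apply: IH; exact: smooth_derive.
Qed.

Lemma smooth0 : smooth (0 : V -> R).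
Proof.
move=> n; elim: n => [|n IH]; first by split=> // x _; exact: cst_continuous.
split=> [x _|v]; first exact: cst_continuous.
split=> [x _|]; first exact: derivable_cst.
by have -> : 'D_v (0 : V -> R) = 0 by apply/funext => x; rewrite derive_cst.
Qed.

Lemma smooth_sum (I : Type) (r : seq I) (h : I -> V -> R) :
  (forall i, smooth (h i)) -> smooth (\sum_(i <- r) h i).
Proof.
by move=> sh; elim/big_rec: _ => [|i g _ sg]; [exact: smooth0 | exact: smoothD].
Qed.

Definition derivn (n : nat) (v : V) f : V -> R := iter n (fun g => 'D_v g) f.

Lemma derivnSr n v f : derivn n.+1 v f = derivn n v ('D_v f).
Proof. exact: iterSr. Qed.

Lemma smooth_derivn n v f : smooth f -> smooth (derivn n v f).
Proof. by move=> sf; elim: n => //= n IH; exact: smooth_derive. Qed.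

Lemma derive_lin (I : Type) (r : seq I) (c : I -> R) (h : I -> V -> R) v :
  (forall i, smooth (h i)) ->
  'D_v (\sum_(i <- r) c i *: h i) = \sum_(i <- r) c i *: 'D_v (h i).
Proof.
move=> sh; elim: r => [|i r IH].
  by rewrite !big_nil; apply/funext => x; rewrite derive_cst.
rewrite !big_cons -IH; apply/funext => x.
have sr : smooth (\sum_(j <- r) c j *: h j).
  by apply: smooth_sum => j; exact: smoothZ.
rewrite deriveD; [|exact: smooth_derivable (smoothZ _ (sh i))|exact: smooth_derivable].
by rewrite deriveZ //; exact: smooth_derivable.
Qed.

Lemma derivn_lin (I : Type) (r : seq I) (c : I -> R) (h : I -> V -> R) n v :
  (forall i, smooth (h i)) ->
  derivn n v (\sum_(i <- r) c i *: h i) = \sum_(i <- r) c i *: derivn n v (h i).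
Proof.
move=> sh; elim: n => //= n IH; rewrite IH derive_lin //.
by move=> i; exact: smooth_derivn.
Qed.

Lemma derive_dir_sum (I : Type) (r : seq I) (c : I -> R) (b : I -> V) f :
  smooth f ->
  'D_(\sum_(i <- r) c i *: b i) f = \sum_(i <- r) c i *: 'D_(b i) f.
Proof.
move=> sf; elim: r => [|i r IH].
  by rewrite !big_nil; apply/funext => x; rewrite derive0.
rewrite !big_cons -IH; apply/funext => x.
have d u y := @smooth_derivable f y u sf.
have [_ ->] := @derive_dirD _ _ f x (c i *: b i) (\sum_(j <- r) c j *: b j)
  (d _) (d _) (@smooth_continuous _ (smooth_derive _ sf) x).
by have [_ ->] := derive_dirZ x (c i) (d (b i)).
Qed.

(* Lagrange bound with the crude constant 1 instead of 1/n!, obtained by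
   integrating the same bound for 'D_v f. *)
Lemma taylor_line n f x v (M : R) : smooth f ->
  (forall s : R, 0 <= s <= 1 -> `|derivn n v f (x + s *: v)| <= M) ->
  forall s : R, 0 <= s <= 1 ->
  `|f (x + s *: v) - \sum_(p < n) (p`!%:R)^-1 * s ^+ p * derivn p v f x| <= M.
Proof.
elim: n f => [|n IH] f sf bM s s01.
  by rewrite big_ord0 subr0; exact: bM.
have {}IH := IH _ (smooth_derive v sf).
have bM' (t : R) : 0 <= t <= 1 -> `|derivn n v ('D_v f) (x + t *: v)| <= M.
  by move=> t01; rewrite -derivnSr; exact: bM.
have {}IH := IH bM'.
have M0 : 0 <= M by apply: le_trans (bM s s01).
pose psi (s : R) := f (x + s *: v) - \sum_(p < n.+1) (p`!%:R)^-1 * s ^+ p * derivn p v f x.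
pose dpsi (s : R) := 'D_v f (x + s *: v) -
  \sum_(p < n) (p`!%:R)^-1 * s ^+ p * derivn p v ('D_v f) x.
have dP t : is_derive t (1:R) psi (dpsi t).
  apply: is_deriveB; first by apply: is_derive_line; exact: smooth_derivable.
  have -> : (fun s : R => \sum_(p < n.+1) (p`!%:R)^-1 * s ^+ p * derivn p v f x) =
     \sum_(p < n.+1) (fun s : R => (p`!%:R)^-1 * s ^+ p * derivn p v f x).
    by apply/funext => y; rewrite fct_sumE.
  have dt (p : 'I_n.+1) : is_derive t (1:R)
      (fun s : R => (p`!%:R)^-1 * s ^+ p * derivn p v f x)
      ((p`!%:R)^-1 * (p%:R * t ^+ p.-1) * derivn p v f x).
    have -> : (fun s : R => (p`!%:R)^-1 * s ^+ p * derivn p v f x) =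
       ((p`!%:R)^-1 * derivn p v f x) *: (fun s : R => s ^+ p).
      by apply/funext => y; rewrite mulrAC.
    have d := @exprn_derivable R p t 1.
    apply: DeriveDef; first exact: derivableZ.
    by rewrite deriveZ // exp_derive -[LHS]/(_ * (_ * _)) mulr1 [RHS]mulrAC.
  have dS := @is_derive_sum _ _ _ n.+1 _ t 1 _ dt; apply: (is_derive_eq dS).
  rewrite big_ord_recl /= !mul0r mulr0 mul0r add0r; apply: eq_bigr => i _.
  rewrite -derivnSr /= factS natrM invfM.
  rewrite /bump /= add1n; set a := i.+1%:R; congr (_ * _).
  have a0 : a != 0 by rewrite pnatr_eq0.
  by rewrite add0n mulrACA mulVf // mul1r.
have psi0 : psi 0 = 0.
  rewrite /psi scale0r addr0 big_ord_recl /= expr0 fact0 invr1 !mul1r.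
  rewrite big1 ?addr0 ?subrr // => i _.
  by rewrite /= expr0n /= mulr0 mul0r.
rewrite -/(psi s) -[psi s]subr0 -psi0.
move: s01 => /andP[s0 s1].
have [|t /= ts ->] := @MVT_segment _ psi dpsi 0 s s0.
  apply: derivable_within_continuous => t _; have [] := dP t; by [].
rewrite subr0 normrM (ger0_norm s0).
have t01 : 0 <= t <= 1.
  by move: ts; rewrite in_itv /= => /andP[-> /le_trans ->].
by rewrite (le_trans _ (ler_piMr M0 s1)) // ler_wpM2r //; exact: IH.
Qed.

End Smooth.

Section Frames.
Context {R : realType} {V : normedModType R} {I : finType}.
Variables (b : I -> V) (k : V -> I -> R).
Hypothesis kE : forall v, v = \sum_i k v i *: b i.
Hypothesis k_le : forall v i, `|k v i| <= `|v|.
Local Notation smooth := (smooth_on [set: V]).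

Lemma derive_frame (f : V -> R) v : smooth f -> 'D_v f = \sum_i k v i *: 'D_(b i) f.
Proof. by move=> sf; rewrite {1}(kE v) derive_dir_sum. Qed.

(** The point is uniformity in [v]. The derivative taken first is expanded in the frame, which
    leaves finitely many functions ['D_(b i) f] independent of [v], to which the induction applies;
    each step costs one coordinate of [v], hence one factor [|v|]. *)
Lemma derivn_bounded n (f : V -> R) (x0 : V) : smooth f ->
  exists2 C, 0 <= C & \forall x \near x0, forall v, `|derivn n v f x| <= C * `|v| ^+ n.
Proof.
elim: n f => [|n IH] f sf.
  have /cvgrPdist_lt /(_ 1 ltr01) H := @smooth_continuous _ _ f sf x0.
  exists (`|f x0| + 1); first by rewrite addr_ge0.
  near=> x => v; rewrite expr0 mulr1 /=.
  rewrite -[f x](subrK (f x0)) addrC (le_trans (ler_normD _ _)) // lerD2l distrC ltW //.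
  by near: x.
have /choice[C CP] : forall i, exists C, 0 <= C /\
    \forall x \near x0, forall v, `|derivn n v ('D_(b i) f) x| <= C * `|v| ^+ n.
  by move=> i; have [C C0 H] := IH _ (smooth_derive (b i) sf); exists C.
exists (\sum_i C i); first by apply: sumr_ge0 => i _; have [] := CP i.
have H : \forall x \near x0, forall i, forall v, `|derivn n v ('D_(b i) f) x| <= C i * `|v| ^+ n.
  by apply: filter_forall => i; have [] := CP i.
near=> x => v.
rewrite derivnSr derive_frame // derivn_lin; last by move=> i; exact: smooth_derive.
rewrite fct_sumE (le_trans (ler_norm_sum _ _ _)) // mulr_suml.
apply: ler_sum => i _; rewrite [X in `|X|]/(_ *: _) /= normrM exprS mulrCA ler_pM //.
by move: v i; near: x; apply: filterS H => y Hy v i; exact: Hy.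
Unshelve. all: by end_near.
Qed.

Lemma smooth_lipschitz (f : V -> R) (x0 : V) : smooth f ->
  exists2 C, 0 <= C & \forall x \near x0, `|f x - f x0| <= C * `|x - x0|.
Proof.
move=> sf; have [C C0 H] := derivn_bounded 1 x0 sf.
exists C => //; move: H => /nbhs_ballP[d /= d0 bd].
apply/nbhs_ballP; exists d => //= x xd.
have [s s01] := @MVT_line _ _ f x0 (x - x0) (fun y => @smooth_derivable _ _ _ y (x - x0) sf).
rewrite [x0 + _]addrC subrK => ->; rewrite -[X in C * X]expr1; apply: bd.
move: xd s01; rewrite -!ball_normE /= => xd /andP[s0 s1].
rewrite opprD addrA subrr sub0r normrN normrZ (ger0_norm s0) distrC.
by rewrite (le_lt_trans _ xd) // ler_piMl.
Qed.

End Frames.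

Section Scalar.
Context {R : realType}.

(** Balls replace intervals so that the order of [a] and [b] is immaterial and the intermediate
    point stays in any ball around [a] that contains [b]. *)
Lemma MVT_ball (g : R -> R) (a b : R) :
  (forall t, `|t - a| <= `|b - a| -> derivable g t 1) ->
  exists2 t, `|t - a| <= `|b - a| & g b - g a = 'D_1 g t * (b - a).
Proof.
move=> dg; have [ab|/ltW ba] := leP a b.
- have dd t : t \in `[a, b] -> `|t - a| <= `|b - a|.
    by rewrite in_itv /= => /andP[ta tb]; rewrite !ger0_norm ?subr_ge0 // lerD2r.
  have [||t tI E] := @MVT_segment _ g ('D_1 g) a b ab _.
  + by move=> t /subset_itv_oo_cc /dd /dg /derivableP.
  + by apply: derivable_within_continuous => t /dd /dg.
  by exists t => //; exact: dd.
- have dd t : t \in `[b, a] -> `|t - a| <= `|b - a|.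
    by rewrite in_itv /= => /andP[ta tb]; rewrite !ler0_norm ?subr_le0 // !opprB lerD2l lerN2.
  have [||t tI E] := @MVT_segment _ g ('D_1 g) b a ba _.
  + by move=> t /subset_itv_oo_cc /dd /dg /derivableP.
  + by apply: derivable_within_continuous => t /dd /dg.
  exists t; first exact: dd.
  by rewrite -opprB E -mulrN opprB.
Qed.

Lemma taylor1 (f : R -> R) (l0 : R) : smooth_near l0 f ->
  exists2 C, 0 <= C & \forall l \near l0,
   `|f l - f l0 - (l - l0) * derive1 f l0| <= C * (l - l0) ^+ 2.
Proof.
move=> [U [oU Ul0 sU]].
have dU l : U l -> derivable f l 1 by have [_ /(_ 1)[+ _]] := sU 1%N; apply.
have ddU l : U l -> derivable ('D_1 f) l 1.
  by have [_ /(_ 1)[_ [_ /(_ 1) []+ _]]] := sU 2%N; apply.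
have cU : {for l0, continuous ('D_1 ('D_1 f))}.
  by have [_ /(_ 1)[_ [_ /(_ 1) []]]] := sU 2%N => _ [+ _]; apply.
have Un : nbhs l0 U by exact: open_nbhs_nbhs.
have /cvgrPdist_lt /(_ 1 ltr01) cU1 := cU.
set M := `|'D_1 ('D_1 f) l0| + 1.
exists M; first by rewrite addr_ge0.
have : \forall l \near l0, U l /\ `|'D_1 ('D_1 f) l| <= M.
  near=> l; split; first by near: l.
  rewrite -['D_1 ('D_1 f) l](subrK ('D_1 ('D_1 f) l0)) addrC.
  rewrite (le_trans (ler_normD _ _)) // lerD2l distrC ltW //.
  by near: l.
move=> /nbhs_ballP[d /= d0 bd]; apply/nbhs_ballP; exists d => //= l ld.
have bd' t : `|t - l0| <= `|l - l0| -> U t /\ `|'D_1 ('D_1 f) t| <= M.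
  move=> tl; apply: bd; move: ld; rewrite -!ball_normE /= ![`|l0 - _|]distrC.
  exact: le_lt_trans.
have [t tl ->] := MVT_ball (fun t h => dU t (proj1 (bd' t h))).
(* A second mean value step, now for the derivative between [l0] and [t]. Since [t] is no farther
   from [l0] than [l], the product of the two increments is quadratic, with a bound of the second
   derivative as its constant. *)
have [t' tl' E] := @MVT_ball ('D_1 f) l0 t (fun t' h => ddU t' (proj1 (bd' t' (le_trans h tl)))).
rewrite derive1E [(l - l0) * _]mulrC -mulrBl E !normrM -(real_normK (num_real (l - l0))) expr2.
rewrite mulrA ler_wpM2r // ler_pM //.
by have [] := bd' _ (le_trans tl' tl).
Unshelve. all: by end_near.
Qed.

End Scalar.

(** * Means and Fourier coefficients *)

Section Mean.
Context {R : realType}.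
Implicit Types (f g : R -> R).
Local Notation mu := (@lebesgue_measure R).

Lemma continuous_integrable f : continuous f -> forall a b : R,
  mu.-integrable `[a, b] (EFin \o f).
Proof.
move=> cf a b; apply: continuous_compact_integrable; first exact: segment_compact.
exact: continuous_subspaceT.
Qed.

Lemma primitive_exists f (L : R) : continuous f ->
  exists F : R -> R, forall x, - L < x < L -> is_derive x 1 F (f x).
Proof.
move=> cf; exists (fun x => \int[mu]_(t in `[- L, x]) f t) => x /andP[Lx xL].
have [dF dE] := continuous_FTC1_closed xL (continuous_integrable cf (- L) L) Lx (cf x).
by apply: DeriveDef; [exact: dF|rewrite -derive1E; exact: dE].
Qed.

Lemma Rintegral_primitive f F (a b : R) : a < b -> continuous f ->
  (forall x, a <= x <= b -> is_derive x (1 : R) F (f x)) ->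
  \int[mu]_(t in `[a, b]) f t = F b - F a.
Proof.
move=> ab cf dF.
have cF x : a <= x <= b -> {for x, continuous F}.
  by move=> /dF[dx _]; apply: differentiable_continuous; apply/derivable1_diffP.
rewrite /Rintegral (@continuous_FTC2 _ f F a b) //.
- exact: continuous_subspaceT.
- split.
  + by move=> x; rewrite in_itv /= => /andP[/ltW ax /ltW xb]; have [] := dF x; rewrite ?ax.
  + by apply: cvg_at_right_filter; apply: cF; rewrite lexx ltW.
  + by apply: cvg_at_left_filter; apply: cF; rewrite lexx ltW.
- move=> x; rewrite in_itv /= => /andP[/ltW ax /ltW xb].
  by rewrite derive1E; have [|_ <-] := dF x; rewrite ?ax.
Qed.

(** For a primitive [F], periodicity gives [F (t + 2 * pi) - F t] the derivative zero, so this
    difference is the same at [c] and at 0; these two values are the two integrals. *)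
Lemma mean_shift f (c : R) : continuous f -> (forall t, f (t + 2 * pi) = f t) ->
  mean (fun t => f (t + c)) = mean f.
Proof.
move=> cf pf; rewrite /mean; congr (_ * _).
have P0 : (0 : R) < 2 * pi by rewrite mulr_gt0 // pi_gt0.
(* The radius leaves room for every [x], [x + c] and [x + 2 * pi] met below. *)
have [F dF] := primitive_exists (`|c| + 2 * pi + 1) cf.
have := ler_norm c; have := ler_norm (- c); rewrite normrN => c1 c2.
have d1 x : 0 <= x <= 2 * pi -> is_derive x (1 : R) (fun t => F (t + c)) (f (x + c)).
  move=> /andP[x0 x1].
  have d : is_derive (x + c) (1 : R) F (f (x + c)) by apply: dF; lra.
  have ds : is_derive x (1 : R) (fun t : R => t + c) 1 by exact: is_derive_shift.
  have := @is_derive1_comp _ F (fun t : R => t + c) x _ _ d ds.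
  by rewrite mulr1.
have cfc : continuous (fun t => f (t + c)).
  move=> x; apply: (continuous_comp (f := fun t : R => t + c)); last exact: cf.
  by apply: cvgD; [exact: cvg_id|exact: cvg_cst].
have d2 x : 0 <= x <= 2 * pi -> is_derive x (1 : R) F (f x).
  by move=> x0; apply: dF; lra.
rewrite (Rintegral_primitive P0 cfc d1) (Rintegral_primitive P0 cf d2).
rewrite add0r.
have dH x : - (`|c| + 1) < x < `|c| + 1 -> is_derive x (1 : R) (fun t => F (t + 2 * pi) - F t) 0.
  move=> xc.
  have d : is_derive (x + 2 * pi) (1 : R) F (f (x + 2 * pi)) by apply: dF; lra.
  have ds : is_derive x (1 : R) (fun t : R => t + 2 * pi) 1 by exact: is_derive_shift.
  have d3 := @is_derive1_comp _ F (fun t : R => t + 2 * pi) x _ _ d ds.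
  have d4 : is_derive x (1 : R) F (f x) by apply: dF; lra.
  by have := is_deriveB d3 d4; rewrite mulr1 pf subrr.
suff : F (c + 2 * pi) - F c = F (0 + 2 * pi) - F 0 by rewrite add0r [2 * pi + c]addrC.
have [c0|/ltW c0] := leP 0 c.
- have [||z _] := @MVT_segment _ (fun t => F (t + 2 * pi) - F t) (fun=> 0) 0 c c0.
  + by move=> x; rewrite in_itv /= => xc; apply: dH; lra.
  + apply: derivable_within_continuous => x; rewrite in_itv /= => xc.
    by have [] : is_derive x (1 : R) (fun t => F (t + 2 * pi) - F t) 0 by apply: dH; lra.
  + by rewrite mul0r => /eqP; rewrite subr_eq0 => /eqP.
- have [||z _] := @MVT_segment _ (fun t => F (t + 2 * pi) - F t) (fun=> 0) c 0 c0.
  + by move=> x; rewrite in_itv /= => xc; apply: dH; lra.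
  + apply: derivable_within_continuous => x; rewrite in_itv /= => xc.
    by have [] : is_derive x (1 : R) (fun t => F (t + 2 * pi) - F t) 0 by apply: dH; lra.
  + by rewrite mul0r => /eqP; rewrite subr_eq0 => /eqP.
Qed.

Lemma meanD f g : continuous f -> continuous g ->
  mean (fun t => f t + g t) = mean f + mean g.
Proof.
by move=> cf cg; rewrite /mean RintegralD ?mulrDr //; exact: continuous_integrable.
Qed.

Lemma meanZ (c : R) f : continuous f -> mean (fun t => c * f t) = c * mean f.
Proof.
move=> cf; rewrite /mean RintegralZl 1?mulrCA //; exact: continuous_integrable.
Qed.

Lemma meanN f : continuous f -> mean (fun t => - f t) = - mean f.
Proof.
move=> cf; rewrite -mulN1r -meanZ //.
by congr mean; apply/funext => t; rewrite mulN1r.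
Qed.

Lemma meanB f g : continuous f -> continuous g ->
  mean (fun t => f t - g t) = mean f - mean g.
Proof.
move=> cf cg; rewrite meanD ?meanN // => x.
by apply: continuousN; exact: cg.
Qed.

Lemma Rintegral_const (c a b : R) : a < b -> \int[mu]_(t in `[a, b]) c = c * (b - a).
Proof.
move=> ab; have d x : a <= x <= b -> is_derive x (1 : R) (fun x => c * x) c.
  by move=> _; apply: is_derive_eq; rewrite -[LHS]/(c * 1) mulr1.
by rewrite (Rintegral_primitive ab (@cst_continuous _ _ c) d) mulrBr.
Qed.

Lemma mean_cst (c : R) : mean (fun=> c) = c.
Proof.
have P0 : (0 : R) < 2 * pi by rewrite mulr_gt0 // pi_gt0.
by rewrite /mean Rintegral_const // subr0 mulrC mulfK // gt_eqF.
Qed.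

Lemma continuous_sum_fct (I : Type) (r : seq I) (h : I -> R -> R) :
  (forall i, continuous (h i)) -> continuous (fun t => \sum_(i <- r) h i t).
Proof.
move=> ch; elim: r => [|i r IH] x.
  by under eq_fun do rewrite big_nil; exact: cvg_cst.
under eq_fun do rewrite big_cons.
by apply: cvgD; [exact: ch | exact: IH].
Qed.

Lemma mean_sum (I : Type) (r : seq I) (h : I -> R -> R) :
  (forall i, continuous (h i)) ->
  mean (fun t => \sum_(i <- r) h i t) = \sum_(i <- r) mean (h i).
Proof.
move=> ch; elim: r => [|i r IH].
  rewrite big_nil; under eq_fun do rewrite big_nil.
  by rewrite mean_cst.
rewrite big_cons -IH -meanD //; first by congr mean; apply/funext => t; rewrite big_cons.
exact: continuous_sum_fct.
Qed.

Lemma mean_le f (M : R) : continuous f -> (forall t, `|f t| <= M) -> `|mean f| <= M.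
Proof.
move=> cf fM.
have P0 : (0 : R) < 2 * pi by rewrite mulr_gt0 // pi_gt0.
rewrite /mean normrM gtr0_norm ?invr_gt0 // ler_pdivrMl //.
rewrite (le_trans (le_normr_Rintegral _ (continuous_integrable cf _ _))) //.
have -> : 2 * pi * M = \int[mu]_(t in `[0, (2 * pi)]) M.
  by rewrite Rintegral_const // subr0 mulrC.
apply: le_Rintegral => //; last first.
  by apply: continuous_integrable; exact: (@cst_continuous _ _ M).
apply: continuous_integrable => x.
by apply: (continuous_comp (cf x)); exact: norm_continuous.
Qed.

(** Shift invariance makes the mean equal to its own negative. With the shift [pi / m] this computes
    all means of harmonics without integrating any. *)
Lemma mean_antiperiodic f (c : R) : continuous f -> (forall t, f (t + 2 * pi) = f t) ->
  (forall t, f (t + c) = - f t) -> mean f = 0.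
Proof.
move=> cf pf af; have := mean_shift c cf pf.
under eq_fun do rewrite af.
rewrite meanN // => /eqP; rewrite eq_sym -subr_eq0 opprK -mulr2n mulrn_eq0 /=.
by move/eqP.
Qed.

Lemma continuous_cosM (a : R) : continuous (fun t => cos (a * t)).
Proof.
move=> x; apply: (continuous_comp (f := fun t => a * t)); last exact: continuous_cos.
exact: cvgMl_tmp.
Qed.

Lemma continuous_sinM (a : R) : continuous (fun t => sin (a * t)).
Proof.
move=> x; apply: (continuous_comp (f := fun t => a * t)); last exact: continuous_sin.
exact: cvgMl_tmp.
Qed.

Lemma cos_2pi : cos (2 * pi) = 1 :> R. Proof. by rewrite mulr_natl cos2pi. Qed.
Lemma sin_2pi : sin (2 * pi) = 0 :> R. Proof. by rewrite mulr_natl sin2pi. Qed.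

Lemma cos_period (m : nat) (t : R) : cos (t + m%:R * (2 * pi)) = cos t.
Proof.
elim: m => [|m IH]; first by rewrite mul0r addr0.
have -> : t + m.+1%:R * (2 * pi) = (t + m%:R * (2 * pi)) + 2 * pi.
  by rewrite -natr1; ring.
rewrite cosD cos_2pi sin_2pi IH.
by rewrite mulr1 mulr0 subr0.
Qed.

Lemma sin_period (m : nat) (t : R) : sin (t + m%:R * (2 * pi)) = sin t.
Proof.
elim: m => [|m IH]; first by rewrite mul0r addr0.
have -> : t + m.+1%:R * (2 * pi) = (t + m%:R * (2 * pi)) + 2 * pi.
  by rewrite -natr1; ring.
rewrite sinD cos_2pi sin_2pi IH.
by rewrite mulr1 mulr0 addr0.
Qed.

Lemma mean_cosM (m : nat) : mean (fun t : R => cos (m%:R * t)) = (m == 0)%:R.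
Proof.
have [->|m0] := eqVneq m 0%N.
  by under eq_fun do rewrite mul0r cos0; rewrite mean_cst.
apply: (@mean_antiperiodic _ (pi / m%:R)); first exact: continuous_cosM.
  by move=> t; rewrite mulrDr cos_period.
by move=> t; rewrite mulrDr mulrC [_ * (pi / _)]mulrC divfK ?pnatr_eq0 // cosDpi mulrC.
Qed.

Lemma mean_sinM (m : nat) : mean (fun t : R => sin (m%:R * t)) = 0.
Proof.
have [->|m0] := eqVneq m 0%N.
  by under eq_fun do rewrite mul0r sin0; rewrite mean_cst.
apply: (@mean_antiperiodic _ (pi / m%:R)); first exact: continuous_sinM.
  by move=> t; rewrite mulrDr sin_period.
by move=> t; rewrite mulrDr mulrC [_ * (pi / _)]mulrC divfK ?pnatr_eq0 // sinDpi mulrC.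
Qed.

Lemma continuousMf f g : continuous f -> continuous g -> continuous (fun t => f t * g t).
Proof. by move=> cf cg x; apply: cvgM; [exact: cf|exact: cg]. Qed.

Lemma continuousDf f g : continuous f -> continuous g -> continuous (fun t => f t + g t).
Proof. by move=> cf cg x; apply: cvgD; [exact: cf|exact: cg]. Qed.

(** Writing the larger index as [d + j] keeps the product-to-sum formula within natural frequencies
    [d] and [d + j + j]. The first cosine has nonzero mean only for [d = 0], the second only for
    [d = j = 0], which yields the three values. *)
Lemma mean_coscos (m j : nat) : mean (fun t : R => cos (m%:R * t) * cos (j%:R * t)) =
  if m == j then (if m == 0 then 1 else 2^-1) else 0.
Proof.
wlog jm : m j / (j <= m)%N.
  move=> H; have [/H//|/ltnW/H E] := leqP j m.
  under eq_fun do rewrite mulrC.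
  by rewrite E [j == m]eq_sym; case: eqP => // ->.
rewrite -(subnK jm); set d := (m - j)%N.
have -> : (fun t : R => cos ((d + j)%:R * t) * cos (j%:R * t)) =
   (fun t => 2^-1 * (cos (d%:R * t) + cos ((d + j + j)%:R * t))).
  apply/funext => t; rewrite !natrD !mulrDl !cosD !sinD.
  have := cos2Dsin2 (j%:R * t); set c := cos (j%:R * t); set s := sin _ => E.
  by move/(congr1 ( *%R (cos (d%:R * t)))): E; rewrite mulr1 => E; lra.
rewrite meanZ; last by apply: continuousDf; exact: continuous_cosM.
rewrite meanD ?mean_cosM; [|exact: continuous_cosM..].
rewrite -[X in (d + j)%N == X]add0n eqn_add2r; have [->|d0] := eqVneq d 0%N; last first.
  by rewrite -addnA addn_eq0 (negbTE d0) /= addr0 mulr0.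
rewrite add0n addn_eq0 andbb.
by have [_|_] := eqVneq j 0%N; rewrite ?addr0 ?mulr1 // mulVf.
Qed.

Lemma mean_sinsin (m j : nat) : mean (fun t : R => sin (m%:R * t) * sin (j%:R * t)) =
  if (m == j) && (m != 0) then 2^-1 else 0.
Proof.
wlog jm : m j / (j <= m)%N.
  move=> H; have [/H//|/ltnW/H E] := leqP j m.
  under eq_fun do rewrite mulrC.
  by rewrite E [j == m]eq_sym; case: eqP => // ->.
rewrite -(subnK jm); set d := (m - j)%N.
have -> : (fun t : R => sin ((d + j)%:R * t) * sin (j%:R * t)) =
   (fun t => 2^-1 * (cos (d%:R * t) - cos ((d + j + j)%:R * t))).
  apply/funext => t; rewrite !natrD !mulrDl !cosD !sinD.
  have := cos2Dsin2 (j%:R * t); set c := cos (j%:R * t); set s := sin _ => E.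
  by move/(congr1 ( *%R (cos (d%:R * t)))): E; rewrite mulr1 => E; lra.
rewrite meanZ; last first.
  by move=> x; apply: cvgB; exact: continuous_cosM.
rewrite meanB ?mean_cosM; [|exact: continuous_cosM..].
rewrite -[X in (d + j)%N == X]add0n eqn_add2r; have [->|d0] := eqVneq d 0%N; last first.
  by rewrite -addnA addn_eq0 (negbTE d0) /= subr0 mulr0.
rewrite add0n addn_eq0 andbb.
by have [_|_] := eqVneq j 0%N; rewrite ?subrr ?mulr0 // subr0 mulr1.
Qed.

Lemma mean_sincos (m j : nat) : mean (fun t : R => sin (m%:R * t) * cos (j%:R * t)) = 0.
Proof.
have [jm|/ltnW mj] := leqP j m.
- rewrite -(subnK jm); set d := (m - j)%N.
  have -> : (fun t : R => sin ((d + j)%:R * t) * cos (j%:R * t)) =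
     (fun t => 2^-1 * (sin (d%:R * t) + sin ((d + j + j)%:R * t))).
    apply/funext => t; rewrite !natrD !mulrDl !sinD ?cosD ?sinD.
    have := cos2Dsin2 (j%:R * t); set c := cos (j%:R * t); set s := sin (j%:R * t) => E.
    by move/(congr1 ( *%R (sin (d%:R * t)))): E; rewrite mulr1 => E; lra.
  rewrite meanZ; last by apply: continuousDf; exact: continuous_sinM.
  by rewrite meanD ?mean_sinM ?addr0 ?mulr0 //; exact: continuous_sinM.
- rewrite -(subnK mj); set d := (j - m)%N.
  have -> : (fun t : R => sin (m%:R * t) * cos ((d + m)%:R * t)) =
     (fun t => 2^-1 * (sin ((d + m + m)%:R * t) - sin (d%:R * t))).
    apply/funext => t; rewrite !natrD !mulrDl !sinD ?cosD ?sinD.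
    have := cos2Dsin2 (m%:R * t); set c := cos (m%:R * t); set s := sin (m%:R * t) => E.
    by move/(congr1 ( *%R (sin (d%:R * t)))): E; rewrite mulr1 => E; lra.
  rewrite meanZ; last by move=> x; apply: cvgB; exact: continuous_sinM.
  by rewrite meanB ?mean_sinM ?subrr ?mulr0 //; exact: continuous_sinM.
Qed.

Definition trigpoly (N : nat) (a b : nat -> R) (t : R) : R :=
  \sum_(j < N) (a j * cos (j%:R * t) + b j * sin (j%:R * t)).

Lemma continuous_trigpoly N a b : continuous (trigpoly N a b).
Proof.
apply: continuous_sum_fct => j; apply: continuousDf; apply: continuousMf;
  by [exact: cst_continuous|exact: continuous_cosM|exact: continuous_sinM].
Qed.

Lemma mean_cos_trigpoly N a b (m : nat) : (m < N)%N ->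
  mean (fun t => cos (m%:R * t) * trigpoly N a b t) = (if m == 0 then 1 else 2^-1) * a m.
Proof.
move=> mN; under eq_fun do rewrite mulr_sumr.
have cc (x : R) := @cst_continuous R R x.
rewrite mean_sum; last first.
  move=> i; apply: continuousMf; first exact: continuous_cosM.
  apply: continuousDf; apply: continuousMf;
  by [exact: cst_continuous|exact: continuous_cosM|exact: continuous_sinM].
have E (j : 'I_N) : mean (fun t => cos (m%:R * t) * (a j * cos (j%:R * t) + b j * sin (j%:R * t))) =
    (if m == j then (if m == 0 then 1 else 2^-1) else 0) * a j.
  have -> : (fun t => cos (m%:R * t) * (a j * cos (j%:R * t) + b j * sin (j%:R * t))) =
    (fun t => a j * (cos (m%:R * t) * cos (j%:R * t)) + b j * (sin (j%:R * t) * cos (m%:R * t))).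
    by apply/funext => t; ring.
  have h1 := continuousMf (@continuous_cosM m%:R) (@continuous_cosM j%:R).
  have h2 := continuousMf (@continuous_sinM j%:R) (@continuous_cosM m%:R).
  rewrite meanD ?meanZ //; [|exact: continuousMf..].
  by rewrite mean_coscos mean_sincos mulr0 addr0 mulrC.
under eq_bigr do rewrite E.
rewrite (bigD1 (Ordinal mN)) //= eqxx big1 ?addr0 // => i iN.
by case: eqP => [E'|_]; [move: iN; rewrite -val_eqE /= E' eqxx|rewrite mul0r].
Qed.

Lemma mean_sin_trigpoly N a b (m : nat) : (m < N)%N ->
  mean (fun t => sin (m%:R * t) * trigpoly N a b t) = (if m == 0 then 0 else 2^-1) * b m.
Proof.
move=> mN; under eq_fun do rewrite mulr_sumr.
rewrite mean_sum; last first.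
  move=> i; apply: continuousMf; first exact: continuous_sinM.
  apply: continuousDf; apply: continuousMf;
  by [exact: cst_continuous|exact: continuous_cosM|exact: continuous_sinM].
have E (j : 'I_N) : mean (fun t => sin (m%:R * t) * (a j * cos (j%:R * t) + b j * sin (j%:R * t))) =
    (if (m == j) && (m != 0) then 2^-1 else 0) * b j.
  have -> : (fun t => sin (m%:R * t) * (a j * cos (j%:R * t) + b j * sin (j%:R * t))) =
    (fun t => a j * (sin (m%:R * t) * cos (j%:R * t)) + b j * (sin (m%:R * t) * sin (j%:R * t))).
    by apply/funext => t; ring.
  have cc (x : R) := @cst_continuous R R x.
  have h1 := continuousMf (@continuous_sinM m%:R) (@continuous_cosM j%:R).
  have h2 := continuousMf (@continuous_sinM m%:R) (@continuous_sinM j%:R).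
  rewrite meanD ?meanZ //; [|exact: continuousMf..].
  by rewrite mean_sinsin mean_sincos mulr0 add0r mulrC.
under eq_bigr do rewrite E.
rewrite (bigD1 (Ordinal mN)) //= eqxx big1 ?addr0 => [|i iN]; first by case: eqP.
by case: eqP => [E'|_]; [move: iN; rewrite -val_eqE /= E' eqxx|rewrite mul0r].
Qed.

(** Turns the pointwise Galerkin equation into orthogonality relations: [g] is the trigonometric
    polynomial built from the coefficients of [f], so both have the same modes up to [M], while the
    higher modes of [f] stay unconstrained. *)
Lemma fourier_trunc_coefs n (M : nat) (f g : R -> 'cV[R]_n) :
  (forall i, continuous (fun t => f t i 0)) -> (forall i, continuous (fun t => g t i 0)) ->
  (forall t, fourier_trunc M f t = g t) ->
  forall i m, (m <= M)%N ->
    mean (fun t => cos (m%:R * t) * (f t i 0 - g t i 0)) = 0 /\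
    mean (fun t => sin (m%:R * t) * (f t i 0 - g t i 0)) = 0.
Proof.
move=> cf cg fg i m mM.
(* The coefficient is the mean itself at mode 0 and twice the mean at the others; [B 0] is harmless,
   as it multiplies [sin 0]. *)
pose A (j : nat) := if j == 0 then mean (fun t => f t i 0) else 2 * mean (fun s => cos (j%:R * s) * f s i 0).
pose B (j : nat) := 2 * mean (fun s => sin (j%:R * s) * f s i 0).
have gE t : g t i 0 = trigpoly M.+1 A B t.
  rewrite -fg /fourier_trunc mxE summxE /trigpoly big_ord_recl /= !mul0r cos0 sin0 mulr1 mulr0 addr0.
  congr (_ + _); first by rewrite mxE.
  rewrite big_add1 big_mkord; apply: eq_bigr => j _.
  rewrite !mxE /A /B /= /bump /= add1n; congr (_ + _); rewrite mulrC; congr (2 * _ * _);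
  by congr mean; apply/funext => s; rewrite mxE.
have cc := continuousMf (@continuous_cosM m%:R) (cf i).
have cs := continuousMf (@continuous_sinM m%:R) (cf i).
have cc' := continuousMf (@continuous_cosM m%:R) (cg i).
have cs' := continuousMf (@continuous_sinM m%:R) (cg i).
split.
- under eq_fun do rewrite mulrBr.
  rewrite meanB //; under [X in _ - mean X]eq_fun do rewrite gE.
  rewrite mean_cos_trigpoly // /A; have [->|m0] := eqVneq m 0%N.
    rewrite mul1r; under eq_fun do rewrite mul0r cos0 mul1r.
    by rewrite subrr.
  by rewrite mulrA mulVf // mul1r subrr.
- under eq_fun do rewrite mulrBr.
  rewrite meanB //; under [X in _ - mean X]eq_fun do rewrite gE.
  rewrite mean_sin_trigpoly // /B; have [->|m0] := eqVneq m 0%N.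
    rewrite mul0r subr0; under eq_fun do rewrite mul0r sin0 mul0r.
    by rewrite mean_cst.
  by rewrite mulrA mulVf // mul1r subrr.
Qed.

End Mean.

(** * Expansion of the rescaled field *)

Section MatrixNorm.
Context {R : realType}.

Lemma mx_entry_le m n (A : 'M[R]_(m, n)) i j : `|A i j| <= `|A|.
Proof. by rewrite [leRHS]/Num.Def.normr/= mx_normrE (le_bigmax _ (fun ij => `|A ij.1 ij.2|) (i, j)). Qed.

Lemma mx_norm_le m n (A : 'M[R]_(m, n)) (C : R) : 0 <= C ->
  (forall i j, `|A i j| <= C) -> `|A| <= C.
Proof.
move=> C0 AC; rewrite [leLHS]/Num.Def.normr/= mx_normrE.
by apply: bigmax_le => // -[i j] _; exact: AC.
Qed.

(** The norm is the largest entry; the factor [n] counts the summands in an entry of the product. *)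
Lemma mulmx_norm_le m n p (A : 'M[R]_(m, n)) (B : 'M[R]_(n, p)) :
  `|A *m B| <= n%:R * `|A| * `|B|.
Proof.
apply: mx_norm_le => [|i j]; first by rewrite !mulr_ge0.
rewrite mxE (le_trans (ler_norm_sum _ _ _)) //.
apply: (@le_trans _ _ (\sum_(k < n) `|A| * `|B|)).
  by apply: ler_sum => k _; rewrite normrM ler_pM // mx_entry_le.
by rewrite sumr_const card_ord -[X in X <= _]mulr_natl mulrA.
Qed.

End MatrixNorm.

Lemma near_dist {R : realType} (l0 e : R) : 0 < e -> \forall l \near l0, `|l - l0| < e.
Proof.
by move=> e0; apply/nbhs_ballP; exists e => //= l; rewrite -ball_normE /= distrC.
Qed.

(** * Lipschitz dependence on the parameter at one point *)

Section LipschitzAt.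
Context {R : realType} (l0 : R).
Implicit Types (f g : R -> R).

(** Values are compared with the one at [l0] only, never with each other. This suffices because the
    Taylor coefficients are later frozen at the Hopf parameter, and it passes easily through sums,
    products and matrix inversion. *)
Definition lip_at f := exists2 C, 0 <= C & \forall l \near l0, `|f l - f l0| <= C * `|l - l0|.

Lemma lip_cst (c : R) : lip_at (fun=> c).
Proof. by exists 0 => //; near=> l; rewrite subrr normr0 mul0r. Unshelve. all: by end_near. Qed.

Lemma lipD f g : lip_at f -> lip_at g -> lip_at (fun l => f l + g l).
Proof.
move=> [C C0 fC] [K K0 gK]; exists (C + K); first exact: addr_ge0.
near=> l; rewrite opprD addrACA mulrDl (le_trans (ler_normD _ _)) // lerD //.
  by near: l.
by near: l.
Unshelve. all: by end_near. Qed.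

Lemma lip_bounded f : lip_at f -> exists2 C, 0 <= C & \forall l \near l0, `|f l| <= C.
Proof.
move=> [C C0 fC]; exists (`|f l0| + C); first exact: addr_ge0.
near=> l; rewrite -[f l](subrK (f l0)) addrC (le_trans (ler_normD _ _)) // lerD2l.
apply: (@le_trans _ _ (C * `|l - l0|)); first by near: l.
rewrite ler_piMr //; apply/ltW; near: l; exact: near_dist.
Unshelve. all: by end_near. Qed.

Lemma lipM f g : lip_at f -> lip_at g -> lip_at (fun l => f l * g l).
Proof.
move=> lf lg; have [K K0 gK] := lip_bounded lg.
move: lf lg => [C C0 fC] [C' C'0 gC].
exists (C * K + `|f l0| * C'); first by rewrite addr_ge0 // mulr_ge0.
near=> l.
have -> : f l * g l - f l0 * g l0 = (f l - f l0) * g l + f l0 * (g l - g l0) by ring.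
rewrite (le_trans (ler_normD _ _)) // [leRHS]mulrDl !normrM lerD //.
  by rewrite mulrAC; apply: ler_pM => //; near: l.
by rewrite -mulrA ler_wpM2l //; near: l.
Unshelve. all: by end_near. Qed.

Lemma lip_sum (I : Type) (r : seq I) (h : I -> R -> R) :
  (forall i, lip_at (h i)) -> lip_at (fun l => \sum_(i <- r) h i l).
Proof.
move=> lh; elim: r => [|i r IH].
  by under eq_fun do rewrite big_nil; exact: lip_cst.
by under eq_fun do rewrite big_cons; apply: lipD.
Qed.

Lemma smooth_near_lip f : smooth_near l0 f -> lip_at f.
Proof.
move=> /taylor1[C C0 fC]; exists (C + `|derive1 f l0|); first exact: addr_ge0.
near=> l.
have -> : f l - f l0 = (f l - f l0 - (l - l0) * derive1 f l0) + (l - l0) * derive1 f l0 by ring.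
rewrite (le_trans (ler_normD _ _)) // [leRHS]mulrDl normrM [`|l - l0| * `|derive1 f l0|]mulrC lerD2r.
apply: (@le_trans _ _ (C * (l - l0) ^+ 2)); first by near: l.
rewrite ler_wpM2l // -(real_normK (num_real _)) expr2 ler_piMr //; apply/ltW; near: l; exact: near_dist.
Unshelve. all: by end_near. Qed.

End LipschitzAt.

Section Coordinates.
Context {R : realType}.

Lemma Ck_on_eq (V W : normedModType R) k (U : set V) (f g : V -> W) : open U ->
  (forall x, U x -> f x = g x) -> Ck_on k U f -> Ck_on k U g.
Proof.
move=> oU; elim: k f g => [|k IH] f g fg [cf df].
  split=> // x Ux.
  rewrite /prop_for /continuous_at -fg //; apply: cvg_trans (cf x Ux); apply: near_eq_cvg.
  by near=> y; apply: fg; near: y; exact: open_nbhs_nbhs.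
have fgn x : U x -> \forall y \near x, f y = g y.
  by move=> Ux; near=> y; apply: fg; near: y; exact: open_nbhs_nbhs.
split=> [x Ux|v].
  by rewrite /prop_for /continuous_at -fg //; apply: cvg_trans (cf x Ux); apply: near_eq_cvg; exact: fgn.
have [dv ck] := df v; split=> [x Ux|]; first by apply: near_eq_derivable (dv x Ux); exact: fgn.
by apply: IH ck => x Ux; apply: near_eq_derive; exact: fgn.
Unshelve. all: by end_near. Qed.

Lemma smooth_on_entry (V : normedModType R) m n (U : set V) (f : V -> 'M[R]_(m, n)) i j :
  open U -> smooth_on U f -> smooth_on U (fun x => f x i j).
Proof.
move=> oU sf q; elim: q f sf => [|q IH] f sf.
  have [cf _] := sf 0%N; split=> // x Ux.
  exact: (continuous_comp (cf x Ux) (@coord_continuous _ _ _ i j _)).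
have [cf df] := sf q.+1; split=> [x Ux|v].
  exact: (continuous_comp (cf x Ux) (@coord_continuous _ _ _ i j _)).
have [dv _] := df v; split=> [x Ux|]; first by move/derivable_mxP: (dv x Ux); exact.
apply: (@Ck_on_eq _ _ _ _ (fun x => 'D_v f x i j)) => // [x Ux|].
  by rewrite derive_mx ?mxE //; exact: dv.
by apply: IH => p; have [_ /(_ v)[]] := sf p.+1.
Qed.

Lemma smooth_near_entry (V : normedModType R) m n (x : V) (f : V -> 'M[R]_(m, n)) i j :
  smooth_near x f -> smooth_near x (fun y => f y i j).
Proof. by move=> [U [oU Ux sU]]; exists U; split=> //; exact: smooth_on_entry. Qed.

End Coordinates.

Section InverseLipschitz.
Context {R : realType} {n : nat} (l0 : R).

Lemma lip_mx_norm m p (A : R -> 'M[R]_(m, p)) :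
  (forall i j, lip_at l0 (fun l => A l i j)) ->
  exists2 C, 0 <= C & \forall l \near l0, `|A l - A l0| <= C * `|l - l0|.
Proof.
move=> lA; have /choice[C CP] : forall ij : 'I_m * 'I_p, exists C, 0 <= C /\
    \forall l \near l0, `|A l ij.1 ij.2 - A l0 ij.1 ij.2| <= C * `|l - l0|.
  by move=> [i j]; have [C] := lA i j; exists C.
exists (\sum_ij C ij); first by apply: sumr_ge0 => ij _; have [] := CP ij.
have H : \forall l \near l0, forall ij : 'I_m * 'I_p, `|A l ij.1 ij.2 - A l0 ij.1 ij.2| <= C ij * `|l - l0|.
  exact: (@filter_forall R _ (fun (ij : 'I_m * 'I_p) l => `|A l ij.1 ij.2 - A l0 ij.1 ij.2| <= C ij * `|l - l0|) (nbhs l0) _ (fun ij => proj2 (CP ij))).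
have S0 : 0 <= \sum_ij C ij by apply: sumr_ge0 => ij _; have [] := CP ij.
near=> l; apply: mx_norm_le => [|i j]; first exact: mulr_ge0.
rewrite !mxE (@le_trans _ _ (C (i, j) * `|l - l0|)) //.
  by move: i j; near: l; apply: filterS H => l Hl i j; exact: (Hl (i, j)).
rewrite ler_wpM2r // (bigD1 (i, j)) //= lerDl; apply: sumr_ge0 => ij _.
by have [] := CP ij.
Unshelve. all: by end_near. Qed.

(** From [P^-1 - P0^-1 = - P^-1 (P - P0) P0^-1]. The unknown [P^-1] on the right is bounded first,
    by the same identity: once [K |P - P0|] is at most 1/2, the term is absorbed and [|P^-1|] is at
    most twice [|P0^-1|]. *)
Lemma lip_invmx (P : R -> 'M[R]_n) :
  (\forall l \near l0, P l \in unitmx) ->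
  (forall i j, lip_at l0 (fun l => P l i j)) ->
  forall i j, lip_at l0 (fun l => invmx (P l) i j).
Proof.
move=> uP /lip_mx_norm[C C0 PC] i j.
have uP0 : P l0 \in unitmx by exact: nbhs_singleton uP.
pose K := n%:R * (n%:R * `|invmx (P l0)|) : R.
have K0 : 0 <= K by rewrite !mulr_ge0.
exists (2 * `|invmx (P l0)| * K * C); first by rewrite !mulr_ge0.
have K1 : 0 < K * C + 1 by rewrite ltr_wpDl // mulr_ge0.
have K2 : 0 < (K * C + 1)^-1 * 2^-1 by rewrite mulr_gt0 // invr_gt0.
near=> l.
have Ul : P l \in unitmx by near: l.
have CL : `|P l - P l0| <= C * `|l - l0| by near: l.
have E : invmx (P l) - invmx (P l0) = - (invmx (P l) *m (P l - P l0) *m invmx (P l0)).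
  rewrite mulmxBr mulmxBl mulVmx // mul1mx -mulmxA mulmxV // mulmx1.
  by rewrite opprB.
have D : `|invmx (P l) - invmx (P l0)| <= `|invmx (P l)| * K * `|P l - P l0|.
  rewrite E normrN (le_trans (mulmx_norm_le _ _)) //.
  rewrite (@le_trans _ _ (n%:R * (n%:R * `|invmx (P l)| * `|P l - P l0|) * `|invmx (P l0)|)) //.
    by rewrite ler_wpM2r // ler_wpM2l // mulmx_norm_le.
  by rewrite le_eqVlt; apply/orP; left; apply/eqP; rewrite /K; ring.
have small : K * `|P l - P l0| <= 2^-1.
  rewrite (@le_trans _ _ (K * (C * `|l - l0|))) ?ler_wpM2l // mulrA.
  rewrite (@le_trans _ _ ((K * C + 1) * `|l - l0|)) //.
    by rewrite ler_wpM2r // lerDl.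
  by rewrite -ler_pdivlMl //; apply/ltW; near: l; exact: near_dist.
have inv_le : `|invmx (P l)| <= 2 * `|invmx (P l0)|.
  have := ler_normD (invmx (P l) - invmx (P l0)) (invmx (P l0)).
  rewrite subrK => /le_trans /(_ (lerD D (lexx _))).
  have : `|invmx (P l)| * K * `|P l - P l0| <= `|invmx (P l)| * 2^-1.
    by rewrite -mulrA ler_wpM2l.
  lra.
have := mx_entry_le (invmx (P l) - invmx (P l0)) i j; rewrite !mxE => /le_trans; apply.
rewrite (le_trans D) // -[leRHS]mulrA ler_pM // ?mulr_ge0 //.
by rewrite ler_pM // mulr_ge0.
Unshelve. all: by end_near. Qed.

End InverseLipschitz.

Section Multilinear.
Context {R : realType} {n : nat}.
Implicit Types (us : seq 'cV[R]_n) (beta : seq 'I_n -> R).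

(* In the expansion of the field, beta holds the partial derivatives of order
   [size us] divided by the factorial, taken along the columns of the frame. *)
Fixpoint ml us beta : R :=
  if us is u :: us' then \sum_i u i 0 * ml us' (fun r => beta (i :: r)) else beta [::].

Lemma mlD us1 u v us2 beta :
  ml (us1 ++ (u + v) :: us2) beta = ml (us1 ++ u :: us2) beta + ml (us1 ++ v :: us2) beta.
Proof.
elim: us1 beta => [|w us1 IH] beta /=; rewrite -big_split; apply: eq_bigr => i _ /=.
  by rewrite mxE mulrDl.
by rewrite IH mulrDr.
Qed.

Lemma mlZ us1 (c : R) u us2 beta :
  ml (us1 ++ (c *: u) :: us2) beta = c * ml (us1 ++ u :: us2) beta.
Proof.
elim: us1 beta => [|w us1 IH] beta /=; rewrite mulr_sumr; apply: eq_bigr => i _ /=.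
  by rewrite mxE mulrA.
by rewrite IH mulrCA.
Qed.

Lemma mlB us beta beta' : ml us (fun r => beta r - beta' r) = ml us beta - ml us beta'.
Proof.
elim: us beta beta' => //= u us IH beta beta'.
by rewrite -sumrB; apply: eq_bigr => i _; rewrite IH mulrBr.
Qed.

Lemma ml_suml (I : Type) (s : seq I) (c : I -> R) us (beta : I -> seq 'I_n -> R) :
  ml us (fun r => \sum_(j <- s) c j * beta j r) = \sum_(j <- s) c j * ml us (beta j).
Proof.
elim: us beta => //= u us IH beta.
under eq_bigr do rewrite IH mulr_sumr.
rewrite exchange_big /=; apply: eq_bigr => j _; rewrite mulr_sumr.
by apply: eq_bigr => i _; rewrite mulrCA.
Qed.

Lemma ml_scale (c : R) us beta : ml us (fun r => c * beta r) = c * ml us beta.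
Proof.
elim: us beta => //= u us IH beta.
by rewrite mulr_sumr; apply: eq_bigr => i _; rewrite IH mulrCA.
Qed.

Lemma ml_ext us beta beta' : (forall r, size r = size us -> beta r = beta' r) ->
  ml us beta = ml us beta'.
Proof.
elim: us beta beta' => [|u us IH] beta beta' E /=; first exact: E.
by apply: eq_bigr => i _; congr (_ * _); apply: IH => r sr; rewrite E //= sr.
Qed.

End Multilinear.
Arguments ml : simpl never.
Arguments derivn : simpl never.

Section JointExpansion.
Context {R : realType} {n : nat}.
Local Notation V := ('cV[R]_n * R)%type.
Local Notation smooth := (smooth_on [set: V]).

(** State and parameter form one variable, so that derivative bounds stay uniform while the
    equilibrium and the parameter move together. The left summand of the index set is the parameter
    direction. *)
Definition frame_vec (o : 'I_1 + 'I_n) : V :=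
  if o is inr i then (delta_mx i 0, 0) else (0, 1).

Definition frame_coord (v : V) (o : 'I_1 + 'I_n) : R :=
  if o is inr i then v.1 i 0 else v.2.

Lemma cV_sum_delta (u : 'cV[R]_n) : u = \sum_i u i 0 *: delta_mx i 0.
Proof.
by rewrite [LHS]matrix_sum_delta; apply: eq_bigr => i _; rewrite big_ord1.
Qed.

Lemma pair_sum_fst (I : Type) (s : seq I) (h : I -> 'cV[R]_n) :
  (\sum_(i <- s) h i, 0) = \sum_(i <- s) (h i, 0) :> V.
Proof.
elim: s => [|i s IH]; first by rewrite !big_nil.
by rewrite !big_cons -IH; congr (_, _); rewrite /= addr0.
Qed.

Lemma frame_sum (v : V) : v = \sum_o frame_coord v o *: frame_vec o.
Proof.
rewrite big_sumType /= big_ord1; case: v => u s /=.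
have -> : \sum_(i < n) u i 0 *: ((delta_mx i 0, 0) : V) = (u, 0).
  rewrite [in RHS](cV_sum_delta u) pair_sum_fst; apply: eq_bigr => i _.
  by congr (_, _); rewrite scaler0.
by congr (_, _) => /=; rewrite ?scaler0 ?add0r // addr0 [_ *: _]mulr1.
Qed.

Lemma frame_coord_le (v : V) o : `|frame_coord v o| <= `|v|.
Proof.
case: o => [_|i] /=; rewrite [leRHS]prod_normE le_max ?lexx ?orbT //.
by rewrite mx_entry_le.
Qed.

Fixpoint derivs (ws : seq V) (f : V -> R) : V -> R :=
  if ws is w :: ws' then derivs ws' ('D_w f) else f.

Lemma derivs_lin (I : Type) (r : seq I) (c : I -> R) (h : I -> V -> R) ws :
  (forall i, smooth (h i)) ->
  derivs ws (\sum_(i <- r) c i *: h i) = \sum_(i <- r) c i *: derivs ws (h i).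
Proof.
elim: ws h => //= w ws IH h sh; rewrite derive_lin // IH //.
by move=> i; exact: smooth_derive.
Qed.

Definition col_dir (P : 'M[R]_n) (r : 'I_n) : V := (col r P, 0).

(** Each differentiation along [P *m z] is expanded over the columns of [P], with the entries of [z]
    as weights. The head of the index list is the derivative taken first, which matches both
    [derivnSr] and the recursion of [ml]. *)
Lemma derivn_ml p (P : 'M[R]_n) (z : 'cV[R]_n) f X : smooth f ->
  derivn p (P *m z, 0) f X = ml (nseq p z) (fun r => derivs (map (col_dir P) r) f X).
Proof.
move=> sf; elim: p f sf => [//|p IH] f sf; rewrite derivnSr.
have Ez : (P *m z, 0) = \sum_r z r 0 *: col_dir P r :> V.
  have -> : P *m z = \sum_r z r 0 *: col r P.
    apply/colP => i; rewrite mxE summxE; apply: eq_bigr => r _.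
    by rewrite !mxE mulrC.
  rewrite pair_sum_fst; apply: eq_bigr => r _.
  by congr (_, _); rewrite scaler0.
have E : 'D_(P *m z, 0) f = \sum_r z r 0 *: 'D_(col_dir P r) f.
  by rewrite Ez derive_dir_sum.
rewrite E derivn_lin; last by move=> r; exact: smooth_derive.
rewrite fct_sumE /=; apply: eq_bigr => r _.
by rewrite -[LHS]/(_ * _) IH //; exact: smooth_derive.
Qed.

Lemma derivnZ p (c : R) v f : smooth f -> derivn p (c *: v) f = c ^+ p *: derivn p v f.
Proof.
move=> sf; elim: p => [|p IH]; first by rewrite expr0 scale1r.
have S u : derivn p.+1 u f = 'D_u (derivn p u f) by [].
apply/funext => x; rewrite !S IH.
have sg : smooth (derivn p v f) by exact: smooth_derivn.
have [_ ->] := derive_dirZ x c (fun y => @smooth_derivable _ _ (c ^+ p *: derivn p v f) y v (smoothZ _ sg)).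
rewrite deriveZ; last exact: smooth_derivable.
by rewrite -[RHS]/(_ * _) exprS -[_ *: _]/(_ * _) mulrA.
Qed.

(** The directions depend on the parameter. Expanding each column of [P l] in the fixed basis moves
    this dependence into scalar factors [P l a r], leaving derivatives of [f] along fixed vectors
    for the induction. *)
Lemma lip_derivs (l0 : R) (x : R -> 'cV[R]_n) (P : R -> 'M[R]_n) (r : seq 'I_n) f :
  smooth f -> (forall i, lip_at l0 (fun l => x l i 0)) ->
  (forall i j, lip_at l0 (fun l => P l i j)) ->
  lip_at l0 (fun l => derivs (map (col_dir (P l)) r) f (x l, l)).
Proof.
move=> + lx lP; elim: r f => [|r rs IH] f sf /=.
  have [C C0 fC] := smooth_lipschitz frame_sum frame_coord_le (x l0, l0) sf.
  have [|K K0 xK] := @lip_mx_norm R l0 n 1 x; first by move=> i j; rewrite ord1.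
  move: fC => /nbhs_ballP[d /= d0 fC].
  have e0 : 0 < d / (K + 1) by rewrite divr_gt0 // ltr_wpDl.
  exists (C * (K + 1)); first by rewrite mulr_ge0 // addr_ge0.
  near=> l.
  have xl : `|(x l, l) - (x l0, l0)| <= (K + 1) * `|l - l0|.
    rewrite prod_normE /= ge_max mulrDl mul1r lerDr mulr_ge0 // andbT.
    by rewrite ler_wpDr //; near: l.
  apply: (@le_trans _ _ (C * `|(x l, l) - (x l0, l0)|)).
    apply: fC; rewrite -ball_normE /= distrC (le_lt_trans xl) //.
    by rewrite mulrC -ltr_pdivlMr ?ltr_wpDl //; near: l; exact: near_dist.
  by rewrite -mulrA ler_wpM2l.
have Er l : col_dir (P l) r = \sum_a P l a r *: (delta_mx a 0, 0) :> V.
  rewrite /col_dir [col r _]cV_sum_delta pair_sum_fst; apply: eq_bigr => i _.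
  by congr (_, _); rewrite ?scaler0 // mxE.
have E l : 'D_(col_dir (P l) r) f = \sum_a P l a r *: 'D_(delta_mx a 0, 0) f.
  by rewrite Er derive_dir_sum.
have EE l : derivs (map (col_dir (P l)) rs) ('D_(col_dir (P l) r) f) (x l, l) =
    \sum_a P l a r * derivs (map (col_dir (P l)) rs) ('D_(delta_mx a 0, 0) f) (x l, l).
  by rewrite E derivs_lin ?fct_sumE // => a; exact: smooth_derive.
under eq_fun do rewrite EE.
apply: lip_sum => a; apply: lipM => //; apply: IH; exact: smooth_derive.
Unshelve. all: by end_near. Qed.

Lemma lip_mx_bounded (l0 : R) m p (A : R -> 'M[R]_(m, p)) :
  (forall i j, lip_at l0 (fun l => A l i j)) ->
  exists2 M, 0 <= M & \forall l \near l0, `|A l| <= M.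
Proof.
move=> lA; have [C C0 AC] := lip_mx_norm lA.
have [M M0 HM] := @lip_bounded R l0 (fun l => `|A l|) (ex_intro2 _ _ C C0 (filterS (fun l h => le_trans (ler_dist_dist _ _) h) AC)).
by exists M => //; apply: filterS HM => l; rewrite normr_id.
Qed.

Lemma is_derive_fst (g : V -> R) (u y : 'cV[R]_n) (l : R) : derivable g (y, l) (u, 0) ->
  is_derive y u (fun y => g (y, l)) ('D_(u, 0) g (y, l)).
Proof.
move=> dg.
have E : (fun h : R => h^-1 *: (g (h *: u + y, l) - g (y, l))) =
    (fun h => h^-1 *: ((g \o shift (y, l)) (h *: (u, 0)) - g (y, l))).
  apply/funext => h /=; congr (_ *: (g _ - _)).
  by congr (_, _); rewrite /= scaler0 add0r.
by apply: DeriveDef; [rewrite /derivable /= E|rewrite /derive /= E].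
Qed.

(** Bridge between [jac], which differentiates in the state at a frozen parameter, and directional
    derivatives of the joint map. *)
Lemma jac_mul_derive (F : 'cV[R]_n -> R -> 'cV[R]_n) (y u : 'cV[R]_n) (l : R) j :
  (forall j, smooth (fun p => F p.1 p.2 j 0)) ->
  (jac (fun y => F y l) y *m u) j 0 = 'D_(u, 0) (fun p : V => F p.1 p.2 j 0) (y, l).
Proof.
move=> sF.
have Eu : (u, 0) = \sum_a u a 0 *: (delta_mx a 0, 0) :> V.
  rewrite {1}(cV_sum_delta u) pair_sum_fst; apply: eq_bigr => i _.
  by congr (_, _); rewrite scaler0.
pose f : V -> R := fun p => F p.1 p.2 j 0.
have sf : smooth f := sF j.
transitivity ((\sum_a u a 0 *: 'D_(delta_mx a 0, 0) f) (y, l)); last first.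
  by rewrite -derive_dir_sum // -Eu.
rewrite fct_sumE mxE; apply: eq_bigr => a _.
rewrite mxE [RHS]mulrC; congr (_ * _).
have dF i : is_derive y (delta_mx a 0) (fun y => F y l i 0) ('D_(delta_mx a 0, 0) (fun p : V => F p.1 p.2 i 0) (y, l)).
  exact: is_derive_fst (@smooth_derivable _ _ (fun p : V => F p.1 p.2 i 0) _ _ (sF i)).
rewrite derive_mx ?mxE; first by have [_ ->] := dF j.
by apply/derivable_mxP => i i'; rewrite ord1; have [] := dF i.
Qed.

(** Taylor expansion of [F] at the equilibrium, with terms of degree 0 to 4 and a fifth-order
    remainder; the division by [e] leaves the error [e^4]. The constants do not depend on [z] or
    [l], and the bound 3 on [z] leaves room for the circle plus small corrections. *)
Lemma rescaled_field_expansion (F : 'cV[R]_n -> R -> 'cV[R]_n) (l0 : R)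
    (x : R -> 'cV[R]_n) (P E : R -> 'M[R]_n) :
  smooth_on [set: V] (fun p => F p.1 p.2) ->
  (forall i, lip_at l0 (fun l => x l i 0)) ->
  (forall i j, lip_at l0 (fun l => P l i j)) ->
  (\forall l \near l0, [/\ F (x l) l = 0, P l \in unitmx &
      jac (fun y => F y l) (x l) *m P l = P l *m E l]) ->
  exists2 beta : 'I_n -> R -> seq 'I_n -> R,
    forall c r, lip_at l0 (fun l => beta c l r) &
    exists C d, [/\ 0 <= C, 0 < d & forall z l e c, `|z| <= 3 -> `|l - l0| < d -> 0 < `|e| < d ->
      `|(e^-1 *: (invmx (P l) *m F (x l + e *: (P l *m z)) l)) c 0 -
        ((E l *m z) c 0 + e * ml [:: z; z] (beta c l) + e ^+ 2 * ml [:: z; z; z] (beta c l) +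
         e ^+ 3 * ml [:: z; z; z; z] (beta c l))| <= C * `|e| ^+ 4].
Proof.
move=> sF lx lP H.
pose f j (p : V) := F p.1 p.2 j 0.
have sf j : smooth (f j) by apply: (@smooth_on_entry _ _ _ _ _ _ j 0 openT sF).
have uP : \forall l \near l0, P l \in unitmx by apply: filterS H => l [].
have lQ := lip_invmx uP lP.
pose beta c l (r : seq 'I_n) := ((size r)`!%:R)^-1 *
  \sum_j invmx (P l) c j * derivs (map (col_dir (P l)) r) (f j) (x l, l).
exists beta => [c r|].
  apply: lipM; first exact: lip_cst.
  by apply: lip_sum => j; apply: lipM; [exact: lQ|exact: lip_derivs].
have [M M0 PM] := lip_mx_bounded lP.
have [N N0 QN] := lip_mx_bounded lQ.
have /choice[C CP] : forall j, exists C, 0 <= C /\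
    \forall X \near ((x l0, l0) : V), forall v, `|derivn 5 v (f j) X| <= C * `|v| ^+ 5.
  move=> j; have [C C0 fC] := derivn_bounded frame_sum frame_coord_le 5 (x l0, l0) (sf j).
  by exists C.
have HC : \forall X \near ((x l0, l0) : V), forall j v, `|derivn 5 v (f j) X| <= C j * `|v| ^+ 5.
  exact: (@filter_forall V _ (fun j X => forall v, `|derivn 5 v (f j) X| <= C j * `|v| ^+ 5)
     (nbhs ((x l0, l0) : V)) _ (fun j => proj2 (CP j))).
move: HC => /nbhs_ballP[rho /= rho0 HC].
(* One half of the radius is for the drift of the base point [(x l, l)], the other half for the
   displacement [w]. *)
have r2 : 0 < rho / 2 by rewrite divr_gt0.
have [|K K0 xK] := @lip_mx_norm R l0 n 1 x; first by move=> i j; rewrite ord1.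
have xl : \forall l \near l0, `|x l - x l0| < rho / 2.
  have K1 : 0 < rho / 2 / (K + 1) by rewrite divr_gt0 // ltr_wpDl.
  near=> l; apply: (@le_lt_trans _ _ ((K + 1) * `|l - l0|)).
    by rewrite mulrDl mul1r ler_wpDr //; near: l.
  by rewrite mulrC -ltr_pdivlMr ?ltr_wpDl //; near: l; exact: near_dist.
have G : \forall l \near l0, [/\ F (x l) l = 0, P l \in unitmx &
      jac (fun y => F y l) (x l) *m P l = P l *m E l] /\
    [/\ `|P l| <= M, `|invmx (P l)| <= N, `|x l - x l0| < rho / 2 & `|l - l0| < rho / 2].
  near=> l; split; first by near: l.
  split; [by near: l|by near: l|by near: l|].
  by near: l; exact: near_dist.
move: G => /nbhs_ballP[d1 /= d10 G].
(* Bounds [P l *m z] for [z] of norm at most 3. *)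
pose B := n%:R * M * 3.
have B0 : 0 <= B by rewrite !mulr_ge0.
have d20 : 0 < rho / 2 / (B + 1) by rewrite divr_gt0 // ltr_wpDl.
exists (\sum_(j < n) N * (C j * B ^+ 5)), (Num.min d1 (rho / 2 / (B + 1))).
split; [|by rewrite lt_min d10|].
  by apply: sumr_ge0 => j _; rewrite !mulr_ge0 ?exprn_ge0 //; have [] := CP j.
move=> z l e c z3; rewrite !lt_min => /andP[ld1 _] /andP[e0 /andP[_ ed]].
have [|[F0 uPl JP] [PlM QlN xl1 ll1]] := G l; first by rewrite -ball_normE /= distrC.
have en0 : e != 0 by rewrite -normr_gt0.
set X : V := (x l, l).
set w : V := e *: (P l *m z, 0).
have wle : `|w| <= `|e| * B.
  rewrite normrZ ler_wpM2l // prod_normE /= normr0 ge_max B0 andbT.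
  rewrite (le_trans (mulmx_norm_le _ _)) // ler_pM // ?mulr_ge0 //.
  by rewrite ler_wpM2l.
have w2 : `|w| < rho / 2.
  rewrite (le_lt_trans wle) // (@le_lt_trans _ _ (`|e| * (B + 1))) //.
    by rewrite ler_wpM2l // lerDl.
  by rewrite -ltr_pdivlMr // ltr_wpDl.
have T j : `|f j (X + w) - \sum_(p < 5) (p`!%:R)^-1 * derivn p w (f j) X| <= C j * `|w| ^+ 5.
  have := @taylor_line _ _ 5 (f j) X w (C j * `|w| ^+ 5) (sf j) _ 1 _.
  rewrite scale1r ler01 lexx => /(_ _ isT).
  under eq_bigr do rewrite expr1n mulr1.
  apply=> s /andP[s0 s1]; apply: HC; rewrite -ball_normE /= opprD addrA.
  rewrite (le_lt_trans (ler_normB _ _)) // [rho]splitr ltr_leD //.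
    rewrite -[_ - _]/(x l0 - x l, l0 - l) prod_normE /= gt_max.
    by rewrite distrC xl1 distrC ll1.
  by rewrite normrZ (ger0_norm s0) (le_trans _ (ltW w2)) // ler_piMl.
have Fw j : F (x l + e *: (P l *m z)) l j 0 = f j (X + w).
  by rewrite /f /X /w /= scaler0 addr0.
have Dp j p : derivn p w (f j) X = e ^+ p * ml (nseq p z) (fun r => derivs (map (col_dir (P l)) r) (f j) X).
  by rewrite derivnZ // -derivn_ml.
have mlb (p : nat) : ml (nseq p z) (beta c l) = (p`!%:R)^-1 * \sum_j invmx (P l) c j * ml (nseq p z) (fun r => derivs (map (col_dir (P l)) r) (f j) X).
  rewrite -ml_suml -ml_scale; apply: ml_ext => r.
  by rewrite size_nseq /beta => ->.
(* The term of degree 0 vanishes because [x l] is an equilibrium. The term of degree 1 is [E l *m z]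
   because the frame intertwines the Jacobian with [E l]. *)
have L0 : ml (nseq 0 z) (beta c l) = 0.
  rewrite mlb /= big1 ?mulr0 // => j _.
  by rewrite /ml /= /f /= F0 mxE mulr0.
have L1 : ml (nseq 1 z) (beta c l) = (E l *m z) c 0.
  rewrite mlb invr1 mul1r.
  have -> : E l *m z = invmx (P l) *m (jac (fun y => F y l) (x l) *m (P l *m z)).
    by rewrite [_ *m (P l *m z)]mulmxA JP !mulmxA mulVmx // mul1mx.
  rewrite [RHS]mxE; apply: eq_bigr => j _; congr (_ * _).
  by rewrite jac_mul_derive // -derivn_ml.
have -> : (E l *m z) c 0 + e * ml [:: z; z] (beta c l) + e ^+ 2 * ml [:: z; z; z] (beta c l) +
         e ^+ 3 * ml [:: z; z; z; z] (beta c l) = e^-1 * \sum_(p < 5) e ^+ p * ml (nseq p z) (beta c l).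
  rewrite !big_ord_recl big_ord0 /=; rewrite /nseq /ncons /= in L0, L1; rewrite L0 L1.
  by rewrite /bump /=; field.
have -> : \sum_(p < 5) e ^+ p * ml (nseq p z) (beta c l) =
   \sum_j invmx (P l) c j * \sum_(p < 5) (p`!%:R)^-1 * derivn p w (f j) X.
  under [RHS]eq_bigr do rewrite mulr_sumr.
  rewrite exchange_big /=; apply: eq_bigr => p _.
  rewrite mlb mulrCA mulr_sumr mulr_sumr; apply: eq_bigr => j _.
  by rewrite Dp; ring.
rewrite !mxE -mulrBr -sumrB normrM normfV.
rewrite ler_pdivrMl // mulrCA -exprS (le_trans (ler_norm_sum _ _ _)) // mulr_suml.
apply: ler_sum => j _; rewrite Fw -mulrBr normrM -mulrA ler_pM //.
  exact: le_trans (mx_entry_le _ _ _) QlN.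
rewrite (le_trans (T j)) // -mulrA ler_wpM2l //; first by have [] := CP j.
by rewrite -exprMn [B * _]mulrC ler_pXn2r // nnegrE ?mulr_ge0.
Unshelve. all: by end_near. Qed.

End JointExpansion.

(** * Even and odd parts of the expansion *)

Section BigO.
Context {R : realType} {I : Type} (P : I -> Prop) (rho : I -> R).
Hypothesis rho01 : forall i, P i -> 0 <= rho i <= 1.

(** A uniform bound on a fixed set of indices rather than a limit statement. An index may carry both
    [e] and a time, and the scale [rho] may contain the unknown deviation itself, as it must before
    any rate is known. *)
Definition bigO (p : nat) {W : normedZmodType R} (f : I -> W) :=
  exists2 C, 0 <= C & forall i, P i -> `|f i| <= C * rho i ^+ p.

Lemma bigO_ext p (W : normedZmodType R) (f g : I -> W) :
  (forall i, P i -> f i = g i) -> bigO p f -> bigO p g.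
Proof. by move=> fg [C C0 fC]; exists C => // i Pi; rewrite -fg //; exact: fC. Qed.

Lemma bigO_le p q (W : normedZmodType R) (f : I -> W) :
  (q <= p)%N -> bigO p f -> bigO q f.
Proof.
move=> qp [C C0 fC]; exists C => // i Pi; apply: (le_trans (fC i Pi)).
by have /andP[r0 r1] := rho01 Pi; rewrite ler_wpM2l // ler_wiXn2l.
Qed.

Lemma bigOD p (W : normedZmodType R) (f g : I -> W) :
  bigO p f -> bigO p g -> bigO p (fun i => f i + g i).
Proof.
move=> [C C0 fC] [K K0 gK]; exists (C + K); first exact: addr_ge0.
by move=> i Pi; rewrite mulrDl (le_trans (ler_normD _ _)) // lerD ?fC ?gK.
Qed.

Lemma bigON p (W : normedZmodType R) (f : I -> W) : bigO p f -> bigO p (fun i => - f i).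
Proof. by move=> [C C0 fC]; exists C => // i Pi; rewrite normrN fC. Qed.

Lemma bigOB p (W : normedZmodType R) (f g : I -> W) :
  bigO p f -> bigO p g -> bigO p (fun i => f i - g i).
Proof. by move=> Of Og; apply: bigOD => //; exact: bigON. Qed.

Lemma bigOM p q (f g : I -> R) : bigO p f -> bigO q g -> bigO (p + q) (fun i => f i * g i).
Proof.
move=> [C C0 fC] [K K0 gK]; exists (C * K); first exact: mulr_ge0.
by move=> i Pi; rewrite normrM exprD mulrACA ler_pM ?fC ?gK.
Qed.

Lemma bigOX p m (f : I -> R) : bigO p f -> bigO (m * p) (fun i => f i ^+ m).
Proof.
move=> Of; elim: m => [|m IH].
  by exists 1 => // i Pi; rewrite expr0 normr1 mul1r.
by rewrite mulSn; apply: bigO_ext (bigOM Of IH) => i _; rewrite exprS.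
Qed.

Lemma bigO_bounded (W : normedZmodType R) (f : I -> W) (C : R) :
  (forall i, P i -> `|f i| <= C) -> bigO 0 f.
Proof.
move=> fC; exists (Num.max C 0); first by rewrite le_max lexx orbT.
by move=> i Pi; rewrite expr0 mulr1 le_max fC.
Qed.

Lemma bigOZ p q (V : normedModType R) (c : I -> R) (f : I -> V) :
  bigO p c -> bigO q f -> bigO (p + q) (fun i => c i *: f i).
Proof.
move=> [C C0 fC] [K K0 gK]; exists (C * K); first exact: mulr_ge0.
by move=> i Pi; rewrite normrZ exprD mulrACA ler_pM ?fC ?gK.
Qed.

(** Each argument is paired with its order. The order of the contraction is the sum of these plus
    the order [q] of the coefficients, so estimates of products reduce to counting. *)
Lemma bigO_ml {n} (us : seq (nat * (I -> 'cV[R]_n))) q (beta : I -> seq 'I_n -> R) :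
  foldr (fun x Q => bigO x.1 x.2 /\ Q) True us ->
  (exists2 C, 0 <= C & forall i, P i -> forall r, size r = size us -> `|beta i r| <= C * rho i ^+ q) ->
  bigO (foldr (fun x s => (x.1 + s)%N) q us) (fun i => ml (map (fun x => x.2 i) us) (beta i)).
Proof.
elim: us q beta => [|[p u] us IH] q beta /=.
  by move=> _ [C C0 bC]; exists C => // i Pi; exact: bC.
move=> [[K K0 uK] Ous] [C C0 bC].
have /choice[Q QP] : forall a : 'I_n, exists Q, 0 <= Q /\ forall i, P i ->
    `|ml (map (fun x => x.2 i) us) (fun r => beta i (a :: r))| <= Q * rho i ^+ foldr (fun x s => (x.1 + s)%N) q us.
  move=> a; have [|Q Q0 H] := IH q (fun i r => beta i (a :: r)) Ous; last by exists Q.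
  by exists C => // i Pi r sr; apply: bC => //=; rewrite sr.
exists (\sum_a K * Q a); first by apply: sumr_ge0 => a _; rewrite mulr_ge0 //; have [] := QP a.
move=> i Pi; rewrite /ml -/(@ml _ _) (le_trans (ler_norm_sum _ _ _)) // mulr_suml.
apply: ler_sum => a _; rewrite normrM exprD mulrACA; have [Q0 QB] := QP a.
by rewrite ler_pM ?QB // (le_trans _ (uK i Pi)) // mx_entry_le.
Qed.

End BigO.

Lemma lip_uniform {R : realType} {n} (l0 : R) (beta : R -> seq 'I_n -> R) p :
  (forall r, lip_at l0 (fun l => beta l r)) ->
  exists2 C, 0 <= C & \forall l \near l0, forall r, size r = p ->
    `|beta l r| <= C /\ `|beta l r - beta l0 r| <= C * `|l - l0|.
Proof.
move=> lb; have /choice[C CP] : forall r : p.-tuple 'I_n, exists C, 0 <= C /\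
    \forall l \near l0, `|beta l r| <= C /\ `|beta l r - beta l0 r| <= C * `|l - l0|.
  move=> r; have [C C0 H] := lb r; have [K K0 H'] := lip_bounded (lb r).
  exists (C + K); split; first exact: addr_ge0.
  near=> l; split; first by rewrite ler_wpDl //; near: l.
  by rewrite mulrDl ler_wpDr ?mulr_ge0 //; near: l.
exists (\sum_r C r); first by apply: sumr_ge0 => r _; have [] := CP r.
have H : \forall l \near l0, forall r : p.-tuple 'I_n,
   `|beta l r| <= C r /\ `|beta l r - beta l0 r| <= C r * `|l - l0|.
  exact: (@filter_forall R _ (fun (r : p.-tuple 'I_n) l =>
   `|beta l r| <= C r /\ `|beta l r - beta l0 r| <= C r * `|l - l0|) (nbhs l0) _ (fun r => proj2 (CP r))).
apply: filterS H => l Hl r /eqP sr.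
have [h1 h2] := Hl (Tuple sr).
have CS : C (Tuple sr) <= \sum_r C r.
  by rewrite (bigD1 (Tuple sr)) //= lerDl; apply: sumr_ge0 => r' _; have [] := CP r'.
by split; [exact: le_trans h1 CS | rewrite (le_trans h2) // ler_wpM2r].
Unshelve. all: by end_near. Qed.

Section LinearCoefficients.
Context {R : realType} {n : nat}.
Implicit Types (u v w : 'cV[R]_n) (beta : seq 'I_n -> R).

Lemma mlN us1 u us2 beta : ml (us1 ++ (- u) :: us2) beta = - ml (us1 ++ u :: us2) beta.
Proof. by rewrite -scaleN1r mlZ mulN1r. Qed.

Lemma mlD1 u v l beta : ml [:: u + v & l] beta = ml [:: u & l] beta + ml [:: v & l] beta.
Proof. exact: (mlD [::]). Qed.
Lemma mlD2 w u v l beta :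
  ml [:: w, u + v & l] beta = ml [:: w, u & l] beta + ml [:: w, v & l] beta.
Proof. exact: (mlD [:: w]). Qed.
Lemma mlD3 w w' u v l beta :
  ml [:: w, w', u + v & l] beta = ml [:: w, w', u & l] beta + ml [:: w, w', v & l] beta.
Proof. exact: (mlD [:: w; w']). Qed.
Lemma mlD4 w w' w'' u v l beta : ml [:: w, w', w'', u + v & l] beta =
  ml [:: w, w', w'', u & l] beta + ml [:: w, w', w'', v & l] beta.
Proof. exact: (mlD [:: w; w'; w'']). Qed.
Lemma mlN1 u l beta : ml [:: - u & l] beta = - ml [:: u & l] beta.
Proof. exact: (mlN [::]). Qed.
Lemma mlN2 w u l beta : ml [:: w, - u & l] beta = - ml [:: w, u & l] beta.
Proof. exact: (mlN [:: w]). Qed.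
Lemma mlN3 w w' u l beta : ml [:: w, w', - u & l] beta = - ml [:: w, w', u & l] beta.
Proof. exact: (mlN [:: w; w']). Qed.
Lemma mlN4 w w' w'' u l beta :
  ml [:: w, w', w'', - u & l] beta = - ml [:: w, w', w'', u & l] beta.
Proof. exact: (mlN [:: w; w'; w'']). Qed.
Lemma mlZ1 (a : R) u l beta : ml [:: a *: u & l] beta = a * ml [:: u & l] beta.
Proof. exact: (mlZ [::]). Qed.
Lemma mlZ2 (a : R) w u l beta : ml [:: w, a *: u & l] beta = a * ml [:: w, u & l] beta.
Proof. exact: (mlZ [:: w]). Qed.

(** No symmetry of [beta] is assumed, so mixed terms are kept in every order of the arguments. The
    full expansions serve where a sum or difference over [u] and [- u] is to cancel by parity. *)
Lemma ml2_add u v beta : ml [:: u + v; u + v] beta = ml [:: u; u] beta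
  + ml [:: u; v] beta + ml [:: v; u] beta + ml [:: v; v] beta.
Proof. by rewrite mlD1 !mlD2; ring. Qed.

Lemma ml2_sub u v beta : ml [:: - u + v; - u + v] beta = ml [:: u; u] beta
  - ml [:: u; v] beta - ml [:: v; u] beta + ml [:: v; v] beta.
Proof. by rewrite mlD1 !mlD2 !mlN1 !mlN2; ring. Qed.

Lemma ml3_add u v beta : ml [:: u + v; u + v; u + v] beta =
  ml [:: u; u; u] beta + ml [:: u; u; v] beta + ml [:: u; v; u] beta + ml [:: u; v; v] beta
  + ml [:: v; u; u] beta + ml [:: v; u; v] beta + ml [:: v; v; u] beta + ml [:: v; v; v] beta.
Proof. by rewrite mlD1 !mlD2 !mlD3; ring. Qed.

Lemma ml3_sub u v beta : ml [:: - u + v; - u + v; - u + v] beta =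
  - ml [:: u; u; u] beta + ml [:: u; u; v] beta + ml [:: u; v; u] beta - ml [:: u; v; v] beta
  + ml [:: v; u; u] beta - ml [:: v; u; v] beta - ml [:: v; v; u] beta + ml [:: v; v; v] beta.
Proof. by rewrite mlD1 !mlD2 !mlD3 !mlN1 !mlN2 !mlN3; ring. Qed.

(** Replacing one slot at a time puts a factor [v] in every correction, which is all that an order
    count needs. *)
Lemma ml3_telescope u v beta : ml [:: u + v; u + v; u + v] beta =
  ml [:: u; u; u] beta + (ml [:: v; u + v; u + v] beta + ml [:: u; v; u + v] beta + ml [:: u; u; v] beta).
Proof. by rewrite [LHS]mlD1 [in LHS]mlD2 [ml [:: u; u; u + v] beta]mlD3; ring. Qed.

Lemma ml4_telescope u v beta : ml [:: u + v; u + v; u + v; u + v] beta =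
  ml [:: u; u; u; u] beta + (ml [:: v; u + v; u + v; u + v] beta + ml [:: u; v; u + v; u + v] beta
    + ml [:: u; u; v; u + v] beta + ml [:: u; u; u; v] beta).
Proof. by rewrite [LHS]mlD1 [in LHS]mlD2 [ml [:: u; u; u + v; u + v] beta]mlD3 mlD4; ring. Qed.

End LinearCoefficients.

Section FieldAsymptotics.
Context {R : realType} {n : nat} {I : Type} (P : I -> Prop) (rho : I -> R).
Hypothesis rho01 : forall i, P i -> 0 <= rho i <= 1.
Variables (c : 'I_n) (l0 : R) (E : R -> 'M[R]_n) (A' : 'M[R]_n) (beta : R -> seq 'I_n -> R).
Variables (G : 'cV[R]_n -> R -> R -> R) (e l : I -> R).
Variables (CE Cb : R) (Cb0 : 0 <= Cb) (CE0 : 0 <= CE).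
Hypothesis E_taylor : forall i, P i -> `|E (l i) - E l0 - (l i - l0) *: A'| <= CE * (l i - l0) ^+ 2.
Hypothesis beta_le : forall i, P i -> forall p r, (p <= 4)%N -> size r = p ->
  `|beta (l i) r| <= Cb /\ `|beta (l i) r - beta l0 r| <= Cb * `|l i - l0|.
Hypothesis G_exp : forall z : I -> 'cV[R]_n, (forall i, P i -> `|z i| <= 3) ->
  bigO P rho 4 (fun i => G (z i) (l i) (e i) - ((E (l i) *m z i) c 0
    + e i * ml [:: z i; z i] (beta (l i)) + e i ^+ 2 * ml [:: z i; z i; z i] (beta (l i))
    + e i ^+ 3 * ml [:: z i; z i; z i; z i] (beta (l i)))).
Hypothesis e_O : bigO P rho 1 e.
Local Notation A := (E l0).
Local Notation O := (bigO P rho).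

Lemma beta_bounded us : (size us <= 4)%N -> foldr (fun x Q => O x.1 x.2 /\ Q) True us ->
  O (foldr (fun x s => (x.1 + s)%N) 0 us) (fun i => ml (map (fun x => x.2 i) us) (beta (l i))).
Proof.
move=> s4 Ous; apply: bigO_ml => //; exists Cb => // i Pi r sr.
by rewrite expr0 mulr1; have [] := beta_le Pi s4 sr.
Qed.

Lemma beta_bounded0 us : (exists i, P i) -> (size us <= 4)%N -> foldr (fun x Q => O x.1 x.2 /\ Q) True us ->
  O (foldr (fun x s => (x.1 + s)%N) 0 us) (fun i => ml (map (fun x => x.2 i) us) (beta l0)).
Proof.
move=> exP s4 Ous; apply: bigO_ml => //.
(* The coefficients are bounded along the family only. Their size at [l0] is reached from one member
   of the family through the Lipschitz bound. *)
exists (Cb + Cb * `|l (projT1 (cid exP)) - l0|); first by rewrite addr_ge0 // mulr_ge0.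
move=> i Pi r sr; rewrite expr0 mulr1; case: (cid exP) => j Pj /=.
have [h1 h2] := beta_le Pj s4 sr.
rewrite -[beta l0 r](subKr (beta (l j) r)) (le_trans (ler_normB _ _)) // lerD //.
Qed.

Lemma beta_lip us q : (size us <= 4)%N -> O q (fun i => l i - l0) ->
  foldr (fun x Q => O x.1 x.2 /\ Q) True us ->
  O (foldr (fun x s => (x.1 + s)%N) q us)
    (fun i => ml (map (fun x => x.2 i) us) (beta (l i)) - ml (map (fun x => x.2 i) us) (beta l0)).
Proof.
move=> s4 [K K0 lK] Ous.
apply: (bigO_ext (f := fun i => ml (map (fun x => x.2 i) us) (fun r => beta (l i) r - beta l0 r))).
  by move=> i _; rewrite mlB.
apply: bigO_ml => //; exists (Cb * K); first exact: mulr_ge0.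
move=> i Pi r sr; have [_ h] := beta_le Pi s4 sr.
by rewrite (le_trans h) // -mulrA ler_wpM2l ?lK.
Qed.

Lemma mulmx_O p q (M : I -> 'M[R]_n) (z : I -> 'cV[R]_n) : O p M -> O q z ->
  O (p + q) (fun i => (M i *m z i) c 0).
Proof.
move=> [C C0 MC] [K K0 zK]; exists (n%:R * C * K); first by rewrite !mulr_ge0.
move=> i Pi; rewrite (le_trans (mx_entry_le _ _ _)) // (le_trans (mulmx_norm_le _ _)) //.
have /andP[r0 _] := rho01 Pi.
have -> : n%:R * C * K * rho i ^+ (p + q) = n%:R * ((C * rho i ^+ p) * (K * rho i ^+ q)).
  by rewrite exprD; ring.
by rewrite -mulrA ler_wpM2l // ler_pM ?MC ?zK.
Qed.

Lemma E_rem_O q : O q (fun i => l i - l0) ->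
  O (2 * q) (fun i => E (l i) - A - (l i - l0) *: A').
Proof.
move=> /bigOX -/(_ 2%N) [K K0 lK]; exists (CE * K); first exact: mulr_ge0.
move=> i Pi; rewrite (le_trans (E_taylor Pi)) // -mulrA ler_wpM2l //.
by rewrite (le_trans (ler_norm _)) // lK.
Qed.

Lemma shift_lin_O p q (z : I -> 'cV[R]_n) : O p (fun i => l i - l0) -> O q z ->
  O (p + q) (fun i => (l i - l0) * (A' *m z i) c 0).
Proof.
move=> lO zO; rewrite -[q]add0n; apply: bigOM => //; apply: mulmx_O => //.
by apply: (@bigO_bounded _ _ _ _ _ _ `|A'|).
Qed.

Lemma E_shift_O p q (z : I -> 'cV[R]_n) : O p (fun i => l i - l0) -> O q z ->
  O (p + q) (fun i => (E (l i) *m z i) c 0 - (A *m z i) c 0).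
Proof.
move=> lO zO.
have O1 := mulmx_O (E_rem_O lO) zO; have O2 := shift_lin_O lO zO.
have O1' : O (p + q) (fun i => ((E (l i) - A - (l i - l0) *: A') *m z i) c 0).
  by apply: bigO_le O1; rewrite // leq_add2r mul2n -addnn leq_addr.
apply: bigO_ext (bigOD O1' O2) => i _.
by rewrite !mulmxBl -scalemxAl !mxE; ring.
Qed.

(** Everything beyond the linear terms in [w], [l - l0] and [e] is a product of two small factors.
    The bounds [T1] to [T7] are, in turn, the Taylor remainder of [E], the parameter shift acting on
    [w], the freezing of [beta], the replacement of [z] by [y] in the quadratic term (two bounds),
    and the cubic and quartic terms. *)
Lemma expansion_first (y w : I -> 'cV[R]_n) : (exists i, P i) ->
  O 0 y -> O 1 w -> O 1 (fun i => l i - l0) -> (forall i, P i -> `|y i + w i| <= 3) ->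
  O 2 (fun i => G (y i + w i) (l i) (e i) - ((A *m y i) c 0 + (A *m w i) c 0
     + (l i - l0) * (A' *m y i) c 0 + e i * ml [:: y i; y i] (beta l0))).
Proof.
move=> exP yO wO lO z3; pose z i := y i + w i.
have zO : O 0 z by exact: bigO_bounded z3.
have T0 : O 2 (fun i => G (z i) (l i) (e i) - ((E (l i) *m z i) c 0
    + e i * ml [:: z i; z i] (beta (l i)) + e i ^+ 2 * ml [:: z i; z i; z i] (beta (l i))
    + e i ^+ 3 * ml [:: z i; z i; z i; z i] (beta (l i)))).
  by apply: bigO_le (G_exp z3).
have T1 : O 2 (fun i => ((E (l i) - A - (l i - l0) *: A') *m z i) c 0).
  exact: mulmx_O (E_rem_O lO) zO.
have T2 := shift_lin_O lO wO.
have T3 := bigOM e_O (beta_lip (us := [:: (0%N, z); (0%N, z)]) isT lO (conj zO (conj zO Logic.I))).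
have T4 := bigOM e_O (beta_bounded0 (us := [:: (0%N, y); (1%N, w)]) exP isT (conj yO (conj wO Logic.I))).
have T5 := bigOM e_O (beta_bounded0 (us := [:: (1%N, w); (0%N, z)]) exP isT (conj wO (conj zO Logic.I))).
have T6 := bigOM (bigOX 2 e_O) (beta_bounded (us := [:: (0%N, z); (0%N, z); (0%N, z)]) isT
  (conj zO (conj zO (conj zO Logic.I)))).
have T7 : O 2 (fun i => e i ^+ 3 * ml [:: z i; z i; z i; z i] (beta (l i))).
  apply: (bigO_le rho01 (isT : (2 <= 3)%N)).
  exact: bigOM (bigOX 3 e_O) (beta_bounded (us := [:: (0%N, z); (0%N, z); (0%N, z); (0%N, z)]) isT
    (conj zO (conj zO (conj zO (conj zO Logic.I))))).
apply: bigO_ext (bigOD T0 (bigOD T1 (bigOD T2 (bigOD T3 (bigOD T4 (bigOD T5 (bigOD T6 T7))))))) => i _ /=.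
have Ez : (A *m z i) c 0 = (A *m y i) c 0 + (A *m w i) c 0 by rewrite mulmxDr mxE.
have A'z : (A' *m z i) c 0 = (A' *m y i) c 0 + (A' *m w i) c 0 by rewrite mulmxDr mxE.
have zz : ml [:: z i; z i] (beta l0) = ml [:: y i; y i] (beta l0) + ml [:: y i; w i] (beta l0) + ml [:: w i; z i] (beta l0).
  by rewrite {1}/z mlD1 {1}/z mlD2.
have Er : ((E (l i) - A - (l i - l0) *: A') *m z i) c 0 =
  (E (l i) *m z i) c 0 - (A *m z i) c 0 - (l i - l0) * (A' *m z i) c 0.
  by rewrite !mulmxBl -scalemxAl !mxE.
by rewrite Er A'z zz Ez -/(z i); ring.
Qed.

(* zo and ze are the parts of the orbit that are odd and even under the
   half-period shift, so that the shifted orbit is - zo + ze. *)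
Variables (y wo ze : I -> 'cV[R]_n).
Hypotheses (exP : exists i, P i) (yO : O 0 y) (woO : O 2 wo) (zeO : O 1 ze).
Hypothesis lO : O 2 (fun i => l i - l0).
Let zo i := y i + wo i.
Hypotheses (zp3 : forall i, P i -> `|zo i + ze i| <= 3) (zm3 : forall i, P i -> `|- zo i + ze i| <= 3).

Let zoO : O 0 zo.
Proof. by apply: bigOD => //; apply: bigO_le woO. Qed.
Let zpO : O 0 (fun i => zo i + ze i).
Proof. exact: bigO_bounded zp3. Qed.
Let zmO : O 0 (fun i => - zo i + ze i).
Proof. exact: bigO_bounded zm3. Qed.
Let nzoO : O 0 (fun i => - zo i).
Proof. exact: bigON zoO. Qed.

Let tele3O (s : I -> 'cV[R]_n) : O 0 s -> O 0 (fun i => s i + ze i) ->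
  O 1 (fun i => ml [:: ze i; s i + ze i; s i + ze i] (beta (l i)) + ml [:: s i; ze i; s i + ze i] (beta (l i))
    + ml [:: s i; s i; ze i] (beta (l i))).
Proof.
move=> sO szO.
have T1 := beta_bounded (us := [:: (1%N, ze); (0%N, fun i => s i + ze i); (0%N, fun i => s i + ze i)])
  isT (conj zeO (conj szO (conj szO Logic.I))).
have T2 := beta_bounded (us := [:: (0%N, s); (1%N, ze); (0%N, fun i => s i + ze i)])
  isT (conj sO (conj zeO (conj szO Logic.I))).
have T3 := beta_bounded (us := [:: (0%N, s); (0%N, s); (1%N, ze)])
  isT (conj sO (conj sO (conj zeO Logic.I))).
exact: bigOD (bigOD T1 T2) T3.
Qed.

Let tele4O (s : I -> 'cV[R]_n) : O 0 s -> O 0 (fun i => s i + ze i) ->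
  O 1 (fun i => ml [:: ze i; s i + ze i; s i + ze i; s i + ze i] (beta (l i))
    + ml [:: s i; ze i; s i + ze i; s i + ze i] (beta (l i))
    + ml [:: s i; s i; ze i; s i + ze i] (beta (l i)) + ml [:: s i; s i; s i; ze i] (beta (l i))).
Proof.
move=> sO szO; pose sz i := s i + ze i.
have T1 := beta_bounded (us := [:: (1%N, ze); (0%N, sz); (0%N, sz); (0%N, sz)])
  isT (conj zeO (conj szO (conj szO (conj szO Logic.I)))).
have T2 := beta_bounded (us := [:: (0%N, s); (1%N, ze); (0%N, sz); (0%N, sz)])
  isT (conj sO (conj zeO (conj szO (conj szO Logic.I)))).
have T3 := beta_bounded (us := [:: (0%N, s); (0%N, s); (1%N, ze); (0%N, sz)])
  isT (conj sO (conj sO (conj zeO (conj szO Logic.I)))).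
have T4 := beta_bounded (us := [:: (0%N, s); (0%N, s); (0%N, s); (1%N, ze)])
  isT (conj sO (conj sO (conj sO (conj zeO Logic.I)))).
exact: bigOD (bigOD (bigOD T1 T2) T3) T4.
Qed.

(** In the half sum everything odd in [zo] cancels: the linear term with its parameter shift, the
    mixed quadratic terms, and the cubic term in [zo] alone. What survives besides the displayed
    terms is of order 3, even though [wo] is known only to order 2. *)
Lemma expansion_even : O 3 (fun i =>
  2^-1 * (G (zo i + ze i) (l i) (e i) + G (- zo i + ze i) (l i) (e i))
  - ((A *m ze i) c 0 + e i * ml [:: y i; y i] (beta l0))).
Proof.
have hO : O 0 (fun=> 2^-1 : R) by apply: (@bigO_bounded _ _ _ _ _ _ `|2^-1|).
have T1 := bigOM hO (bigO_le rho01 (isT : (3 <= 4)%N) (G_exp zp3)).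
have T2 := bigOM hO (bigO_le rho01 (isT : (3 <= 4)%N) (G_exp zm3)).
have T3 := E_shift_O lO zeO.
have T4 := bigOM e_O (beta_lip (us := [:: (0%N, zo); (0%N, zo)]) isT lO (conj zoO (conj zoO Logic.I))).
have T5 := bigOM e_O (beta_bounded0 (us := [:: (0%N, y); (2%N, wo)]) exP isT (conj yO (conj woO Logic.I))).
have T6 := bigOM e_O (beta_bounded0 (us := [:: (2%N, wo); (0%N, zo)]) exP isT (conj woO (conj zoO Logic.I))).
have T7 := bigOM e_O (beta_bounded (us := [:: (1%N, ze); (1%N, ze)]) isT (conj zeO (conj zeO Logic.I))).
have T8 := bigOM hO (bigOM (bigOX 2 e_O) (bigOD (tele3O zoO zpO) (tele3O nzoO zmO))).
have T9 := bigOM hO (bigOM (bigOX 3 e_O) (bigOD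
  (beta_bounded (us := [:: (0%N, fun i => zo i + ze i); (0%N, fun i => zo i + ze i); (0%N, fun i => zo i + ze i); (0%N, fun i => zo i + ze i)]) isT
    (conj zpO (conj zpO (conj zpO (conj zpO Logic.I)))))
  (beta_bounded (us := [:: (0%N, fun i => - zo i + ze i); (0%N, fun i => - zo i + ze i); (0%N, fun i => - zo i + ze i); (0%N, fun i => - zo i + ze i)]) isT
    (conj zmO (conj zmO (conj zmO (conj zmO Logic.I))))))).
apply: bigO_ext (bigOD T1 (bigOD T2 (bigOD T3 (bigOD T4 (bigOD T5 (bigOD T6 (bigOD T7 (bigOD T8 T9)))))))) => i _ /=.
have Ep : (E (l i) *m (zo i + ze i)) c 0 = (E (l i) *m zo i) c 0 + (E (l i) *m ze i) c 0 by rewrite mulmxDr mxE.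
have Em : (E (l i) *m (- zo i + ze i)) c 0 = - (E (l i) *m zo i) c 0 + (E (l i) *m ze i) c 0.
  by rewrite mulmxDr mulmxN !mxE.
have Q0 : ml [:: zo i; zo i] (beta l0) = ml [:: y i; y i] (beta l0) + ml [:: y i; wo i] (beta l0) + ml [:: wo i; zo i] (beta l0).
  by rewrite {1}/zo mlD1 {1}/zo mlD2.
have Qp := ml2_add (zo i) (ze i) (beta (l i)).
have Qm := ml2_sub (zo i) (ze i) (beta (l i)).
have Cp := ml3_telescope (zo i) (ze i) (beta (l i)).
have Cm := ml3_telescope (- zo i) (ze i) (beta (l i)).
have Cmm : ml [:: - zo i; - zo i; - zo i] (beta (l i)) = - ml [:: zo i; zo i; zo i] (beta (l i)).
  by rewrite mlN1 mlN2 mlN3 !opprK.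
by rewrite Ep Em Q0 Qp Qm Cp Cm Cmm; field.
Qed.

Variables (q we : I -> 'cV[R]_n).
Hypotheses (weO : O 3 we) (zeE : forall i, ze i = e i *: q i + we i).

(** In the half difference the pure quadratic terms and the quartic term in [zo] alone cancel. The
    mixed quadratic terms carry a factor [e], so [ze] has to be [e *: q] up to order 3; this is why
    the even modes are estimated before the odd ones. *)
Lemma expansion_odd : O 4 (fun i =>
  2^-1 * (G (zo i + ze i) (l i) (e i) - G (- zo i + ze i) (l i) (e i))
  - ((A *m zo i) c 0 + (l i - l0) * (A' *m y i) c 0
     + e i ^+ 2 * (ml [:: y i; q i] (beta l0) + ml [:: q i; y i] (beta l0) + ml [:: y i; y i; y i] (beta l0)))).
Proof.
have hO : O 0 (fun=> 2^-1 : R) by apply: (@bigO_bounded _ _ _ _ _ _ `|2^-1|).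
have nhO : O 0 (fun=> - 2^-1 : R) by apply: (@bigO_bounded _ _ _ _ _ _ `|- 2^-1|).
have T1 := bigOM hO (G_exp zp3).
have T2 := bigOM nhO (G_exp zm3).
have T3 : O 4 (fun i => ((E (l i) - A - (l i - l0) *: A') *m zo i) c 0).
  exact: mulmx_O (E_rem_O lO) zoO.
have T4 := shift_lin_O lO woO.
have T5 := bigOM e_O (beta_lip (us := [:: (0%N, zo); (1%N, ze)]) isT lO (conj zoO (conj zeO Logic.I))).
have T6 := bigOM e_O (beta_lip (us := [:: (1%N, ze); (0%N, zo)]) isT lO (conj zeO (conj zoO Logic.I))).
have T7 := bigOM e_O (beta_bounded0 (us := [:: (2%N, wo); (1%N, ze)]) exP isT (conj woO (conj zeO Logic.I))).
have T8 := bigOM e_O (beta_bounded0 (us := [:: (1%N, ze); (2%N, wo)]) exP isT (conj zeO (conj woO Logic.I))).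
have T9 := bigOM e_O (beta_bounded0 (us := [:: (0%N, y); (3%N, we)]) exP isT (conj yO (conj weO Logic.I))).
have T10 := bigOM e_O (beta_bounded0 (us := [:: (3%N, we); (0%N, y)]) exP isT (conj weO (conj yO Logic.I))).
have T11 := bigOM (bigOX 2 e_O) (beta_lip (us := [:: (0%N, zo); (0%N, zo); (0%N, zo)]) isT lO
   (conj zoO (conj zoO (conj zoO Logic.I)))).
have T12 := bigOM (bigOX 2 e_O) (bigOD (bigOD
  (beta_bounded0 (us := [:: (2%N, wo); (0%N, zo); (0%N, zo)]) exP isT (conj woO (conj zoO (conj zoO Logic.I))))
  (beta_bounded0 (us := [:: (0%N, y); (2%N, wo); (0%N, zo)]) exP isT (conj yO (conj woO (conj zoO Logic.I)))))
  (beta_bounded0 (us := [:: (0%N, y); (0%N, y); (2%N, wo)]) exP isT (conj yO (conj yO (conj woO Logic.I))))).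
have T13 := bigOM (bigOX 2 e_O) (bigOD (bigOD
  (beta_bounded (us := [:: (0%N, zo); (1%N, ze); (1%N, ze)]) isT (conj zoO (conj zeO (conj zeO Logic.I))))
  (beta_bounded (us := [:: (1%N, ze); (0%N, zo); (1%N, ze)]) isT (conj zeO (conj zoO (conj zeO Logic.I)))))
  (beta_bounded (us := [:: (1%N, ze); (1%N, ze); (0%N, zo)]) isT (conj zeO (conj zeO (conj zoO Logic.I))))).
have T14 := bigOM hO (bigOM (bigOX 3 e_O) (bigOB (tele4O zoO zpO) (tele4O nzoO zmO))).
apply: bigO_ext (bigOD T1 (bigOD T2 (bigOD T3 (bigOD T4 (bigOD T5 (bigOD T6 (bigOD T7 (bigOD T8
  (bigOD T9 (bigOD T10 (bigOD T11 (bigOD T12 (bigOD T13 T14))))))))))))) => i _ /=.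
have Ep : (E (l i) *m (zo i + ze i)) c 0 = (E (l i) *m zo i) c 0 + (E (l i) *m ze i) c 0 by rewrite mulmxDr mxE.
have Em : (E (l i) *m (- zo i + ze i)) c 0 = - (E (l i) *m zo i) c 0 + (E (l i) *m ze i) c 0.
  by rewrite mulmxDr mulmxN !mxE.
have Er : ((E (l i) - A - (l i - l0) *: A') *m zo i) c 0 =
  (E (l i) *m zo i) c 0 - (A *m zo i) c 0 - (l i - l0) * (A' *m zo i) c 0.
  by rewrite !mulmxBl -scalemxAl !mxE.
have A'z : (A' *m zo i) c 0 = (A' *m y i) c 0 + (A' *m wo i) c 0 by rewrite mulmxDr mxE.
have Qp := ml2_add (zo i) (ze i) (beta (l i)).
have Qm := ml2_sub (zo i) (ze i) (beta (l i)).
have Q1 : ml [:: zo i; ze i] (beta l0) = e i * ml [:: y i; q i] (beta l0) + ml [:: y i; we i] (beta l0) + ml [:: wo i; ze i] (beta l0).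
  by rewrite {1}/zo mlD1 {1}zeE mlD2 mlZ2.
have Q2 : ml [:: ze i; zo i] (beta l0) = e i * ml [:: q i; y i] (beta l0) + ml [:: we i; y i] (beta l0) + ml [:: ze i; wo i] (beta l0).
  by rewrite {1}/zo mlD2 {1}zeE mlD1 mlZ1.
have C0 : ml [:: zo i; zo i; zo i] (beta l0) = ml [:: y i; y i; y i] (beta l0) +
   (ml [:: wo i; zo i; zo i] (beta l0) + ml [:: y i; wo i; zo i] (beta l0) + ml [:: y i; y i; wo i] (beta l0)).
  exact: ml3_telescope.
have Cp := ml3_add (zo i) (ze i) (beta (l i)).
have Cm := ml3_sub (zo i) (ze i) (beta (l i)).
have Fp := ml4_telescope (zo i) (ze i) (beta (l i)).
have Fm := ml4_telescope (- zo i) (ze i) (beta (l i)).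
have Fmm : ml [:: - zo i; - zo i; - zo i; - zo i] (beta (l i)) = ml [:: zo i; zo i; zo i; zo i] (beta (l i)).
  by rewrite mlN1 mlN2 mlN3 mlN4 !opprK.
by rewrite Er A'z Ep Em Qp Qm Q1 Q2 C0 Cp Cm Fp Fm Fmm; field.
Qed.

End FieldAsymptotics.

(** * Homological equations of the normal form *)

Lemma sum_ord2 (V : nmodType) (f : 'I_2 -> V) : \sum_i f i = f 0 + f 1.
Proof. by rewrite big_ord_recl big_ord1; congr (_ + f _); exact/val_inj. Qed.

Section NormalFormPolynomials.
Context {R : realType} {k : nat} (c : nf_coefs R k) (l : R).
Implicit Types (y w : 'cV[R]_2).

Definition nf_dquad y w : 'cV[R]_(2 + k) :=
  (2 * (y 0 0 * w 0 0 + y 1 0 * w 1 0)) *: nf_a0 c l +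
  (2 * (y 0 0 * w 0 0 - y 1 0 * w 1 0)) *: nf_a2 c l +
  (2 * (y 0 0 * w 1 0 + y 1 0 * w 0 0)) *: nf_b2 c l.

Definition nf_dcubic y w : 'cV[R]_2 :=
  let y1 := y 0 0 in let y2 := y 1 0 in let w1 := w 0 0 in let w2 := w 1 0 in
  (w1 * (3 * y1 ^+ 2 + y2 ^+ 2) + w2 * (2 * y1 * y2)) *: nf_a1 c l +
  (w1 * (2 * y1 * y2) + w2 * (y1 ^+ 2 + 3 * y2 ^+ 2)) *: nf_b1 c l +
  (w1 * (3 * y1 ^+ 2 - 3 * y2 ^+ 2) - w2 * (6 * y1 * y2)) *: nf_a3 c l +
  (w1 * (6 * y1 * y2) + w2 * (3 * y1 ^+ 2 - 3 * y2 ^+ 2)) *: nf_b3 c l.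

Lemma is_derive_coord p (x v : 'cV[R]_p) i : is_derive x v (fun x : 'cV[R]_p => x i 0) (v i 0).
Proof.
have E : (fun h : R => h^-1 *: ((h *: v + x) i 0 - x i 0)) = (fun h => h^-1 * (h * v i 0)).
  by apply/funext => h; rewrite !mxE addrK.
have H : (fun h : R => h^-1 *: ((h *: v + x) i 0 - x i 0)) @ 0^' --> v i 0.
  rewrite E; apply: cvg_near_cst; near=> h; rewrite mulKf //.
  by near: h; exact: nbhs_dnbhs_neq.
by apply: DeriveDef; [apply/cvg_ex; eexists; exact: H|exact: cvg_lim H].
Unshelve. all: by end_near. Qed.

Lemma is_derive_quad (y w : 'cV[R]_2) i :
  is_derive y w (fun y => nf_quad c l y i 0) (nf_dquad y w i 0).
Proof.
pose X1 : 'cV[R]_2 -> R := fun x => x 0 0; pose X2 : 'cV[R]_2 -> R := fun x => x 1 0.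
have d1 : is_derive y w X1 (w 0 0) by exact: is_derive_coord.
have d2 : is_derive y w X2 (w 1 0) by exact: is_derive_coord.
have -> : (fun y => nf_quad c l y i 0) = (nf_a0 c l i 0) *: (X1 * X1 + X2 * X2)
  + (nf_a2 c l i 0) *: (X1 * X1 - X2 * X2) + (2 * nf_b2 c l i 0) *: (X1 * X2).
  by apply/funext => x; rewrite /nf_quad !mxE !fctE /X1 /X2 -![_ *: _]/(_ * _); ring.
have h11 := is_deriveM d1 d1; have h22 := is_deriveM d2 d2.
have hZ f b df := @is_deriveZ R 'cV[R]_2 R f b y w df.
have h := is_deriveD (is_deriveD (hZ _ (nf_a0 c l i 0) _ (is_deriveD h11 h22))
  (hZ _ (nf_a2 c l i 0) _ (is_deriveB h11 h22))) (hZ _ (2 * nf_b2 c l i 0) _ (is_deriveM d1 d2)).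
apply: (is_derive_eq h).
by rewrite /nf_dquad !mxE -![_ *: _]/(_ * _) /X1 /X2; ring.
Qed.

Lemma is_derive_cubic (y w : 'cV[R]_2) i :
  is_derive y w (fun y => nf_cubic c l y i 0) (nf_dcubic y w i 0).
Proof.
pose X1 : 'cV[R]_2 -> R := fun x => x 0 0; pose X2 : 'cV[R]_2 -> R := fun x => x 1 0.
have d1 : is_derive y w X1 (w 0 0) by exact: is_derive_coord.
have d2 : is_derive y w X2 (w 1 0) by exact: is_derive_coord.
have -> : (fun y => nf_cubic c l y i 0) =
    (nf_a1 c l i 0) *: (X1 * (X1 * X1 + X2 * X2)) + (nf_b1 c l i 0) *: (X2 * (X1 * X1 + X2 * X2))
  + (nf_a3 c l i 0) *: (X1 * (X1 * X1 - (X2 * X2 + X2 * X2 + X2 * X2)))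
  + (nf_b3 c l i 0) *: (X2 * (X1 * X1 + X1 * X1 + X1 * X1 - X2 * X2)).
  by apply/funext => x; rewrite /nf_cubic !mxE !fctE /X1 /X2 -![_ *: _]/(_ * _); ring.
have h11 := is_deriveM d1 d1; have h22 := is_deriveM d2 d2.
have hZ f b df := @is_deriveZ R 'cV[R]_2 R f b y w df.
have h := is_deriveD (is_deriveD (is_deriveD
  (hZ _ (nf_a1 c l i 0) _ (is_deriveM d1 (is_deriveD h11 h22)))
  (hZ _ (nf_b1 c l i 0) _ (is_deriveM d2 (is_deriveD h11 h22))))
  (hZ _ (nf_a3 c l i 0) _ (is_deriveM d1 (is_deriveB h11 (is_deriveD (is_deriveD h22 h22) h22)))))
  (hZ _ (nf_b3 c l i 0) _ (is_deriveM d2 (is_deriveB (is_deriveD (is_deriveD h11 h11) h11) h22))).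
apply: (is_derive_eq h).
have sc (a b : R) : a *: b = a * b by [].
by rewrite /nf_dcubic !mxE !fctE !sc /X1 /X2; ring.
Qed.

Lemma jac_mul (p q : nat) (f df : 'cV[R]_p -> 'cV[R]_q) (x w : 'cV[R]_p) :
  (forall v i, is_derive x v (fun x => f x i 0) (df v i 0)) ->
  (forall i, df w i 0 = \sum_j w j 0 * df (delta_mx j 0) i 0) ->
  jac f x *m w = df w.
Proof.
move=> fd dfl; apply/colP => i; rewrite dfl mxE; apply: eq_bigr => j _.
rewrite mxE mulrC; congr (_ * _).
rewrite derive_mx ?mxE; first by have [_ ->] := fd (delta_mx j 0) i.
by apply/derivable_mxP => i' j'; rewrite ord1; have [] := fd (delta_mx j 0) i'.
Qed.

Lemma jac_hhat y w : jac (hhat c l) y *m w = usubmx (nf_dquad y w) + nf_dcubic y w.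
Proof.
apply: (@jac_mul _ _ (hhat c l) (fun w => usubmx (nf_dquad y w) + nf_dcubic y w)) => [v i|i].
  have := is_deriveD (is_derive_quad y v (lshift k i)) (is_derive_cubic y v i).
  have -> : (fun y => nf_quad c l y (lshift k i) 0) + (fun y => nf_cubic c l y i 0) =
     (fun x => hhat c l x i 0).
    by apply/funext => x; rewrite /hhat [RHS]mxE [usubmx _ _ _]mxE.
  by rewrite !mxE.
by rewrite sum_ord2 !mxE /=; ring.
Qed.

Lemma jac_htilde y w : jac (htilde c l) y *m w = dsubmx (nf_dquad y w).
Proof.
apply: (@jac_mul _ _ (htilde c l) (fun w => dsubmx (nf_dquad y w))) => [v i|i].
  have := is_derive_quad y v (rshift 2 i).
  have -> : (fun y => nf_quad c l y (rshift 2 i) 0) = (fun x => htilde c l x i 0).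
    by apply/funext => x; rewrite /htilde !mxE.
  by rewrite !mxE.
by rewrite sum_ord2 !mxE /=; ring.
Qed.

End NormalFormPolynomials.

Section NormalFormIdentities.
Context {R : realType} {k : nat}.
Local Notation n := (2 + k)%N.

(** Comparison of coefficients: each one in turn is bounded by a multiple of [e] for all small
    positive [e], hence zero, and is then divided out. *)
Lemma eps_poly2_eq0 (C d : R) (a b c : R) : 0 < d ->
  (forall e, 0 < `|e| < d -> `|a + e * b + e ^+ 2 * c| <= C * `|e| ^+ 3) ->
  [/\ a = 0, b = 0 & c = 0].
Proof.
move=> d0.
have key (x K : R) : (forall e, 0 < e < Num.min d 1 -> `|x| <= K * e) -> x = 0.
  move=> H; apply/eqP; rewrite -normr_eq0; apply/eqP/le_anti; rewrite normr_ge0 andbT.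
  have dm : 0 < Num.min d 1 by rewrite lt_min d0 ltr01.
  have K1 : 0 < `|K| + 1 by rewrite ltr_wpDl.
  rewrite leNgt; apply/negP => x0.
  (* Inside the admissible range and so small that [(|K| + 1) e] is at most [|x| / 2], contradicting
     the bound unless [x] is zero. *)
  pose e := Num.min (Num.min d 1 / 2) (`|x| / (2 * (`|K| + 1))).
  have e0 : 0 < e by rewrite lt_min !divr_gt0 // mulr_gt0.
  have ed : e < Num.min d 1.
    by rewrite (le_lt_trans (_ : e <= Num.min d 1 / 2)) ?ge_min ?lexx // ltr_pdivrMr // ltr_pMr // ltr1n.
  have := H e; rewrite e0 ed => /(_ isT).
  apply/negP; rewrite -ltNge (@le_lt_trans _ _ ((`|K| + 1) * e)) //.
    by rewrite ler_wpM2r ?(ltW e0) // ler_wpDr // ler_norm.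
  apply: (@le_lt_trans _ _ (`|x| / 2)); last by rewrite ltr_pdivrMr // ltr_pMr // ltr1n.
  have : e <= `|x| / (2 * (`|K| + 1)) by rewrite ge_min lexx orbT.
  rewrite ler_pdivlMr ?mulr_gt0 // => h.
  by rewrite ler_pdivlMr // (le_trans _ h) //; lra.
move=> H.
have He e : 0 < e < Num.min d 1 -> [/\ 0 < e, e < 1 & `|a + e * b + e ^+ 2 * c| <= C * e ^+ 3].
  rewrite lt_min => /andP[e0 /andP[ed e1]]; split=> //.
  by have := H e; rewrite gtr0_norm // e0 ed => /(_ isT).
have a0 : a = 0.
  apply: (@key _ (`|C| + `|b| + `|c|)) => e /He[e0 e1 {}H].
  have -> : a = (a + e * b + e ^+ 2 * c) - e * (b + e * c) by ring.
  rewrite (le_trans (ler_normB _ _)) // -[`|C| + `|b| + _]addrA mulrDl lerD //.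
    rewrite (le_trans H) // exprS mulrCA mulrC ler_wpM2r ?(ltW e0) //.
    by rewrite (le_trans (ler_wpM2r _ (ler_norm C))) ?exprn_ge0 ?(ltW e0) // ler_piMr // exprn_ile1 // ltW.
  rewrite normrM gtr0_norm // mulrC ler_wpM2r ?(ltW e0) // (le_trans (ler_normD _ _)) // lerD2l.
  by rewrite normrM gtr0_norm // ler_piMl // ltW.
have b0 : b = 0.
  apply: (@key _ (`|C| + `|c|)) => e /He[e0 e1 {}H].
  have : `|e * (b + e * c)| <= C * e ^+ 3.
    by move: H; rewrite a0; congr (`|_| <= _); ring.
  rewrite normrM gtr0_norm // [e ^+ 3]exprS mulrCA ler_pM2l // => {}H.
  have -> : b = (b + e * c) - e * c by ring.
  rewrite (le_trans (ler_normB _ _)) // mulrDl lerD //.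
    rewrite (le_trans H) // expr2 mulrA ler_wpM2r ?(ltW e0) //.
    by rewrite (le_trans (ler_wpM2r _ (ler_norm C))) ?(ltW e0) // ler_piMr // ltW.
  by rewrite normrM gtr0_norm // mulrC.
split=> //; apply: (@key _ C) => e /He[e0 e1 {}H].
have : `|e ^+ 2 * c| <= C * e ^+ 3 by move: H; rewrite a0 b0; congr (`|_| <= _); ring.
by rewrite normrM gtr0_norm ?exprn_gt0 // [e ^+ 3]exprSr mulrCA ler_pM2l ?exprn_gt0.
Qed.

Lemma eqaddO_bound (V : normedModType R) (f g : R -> V) (N : nat) :
  f = g +O_ (0^') (fun e : R => e ^+ N) ->
  exists C d, [/\ 0 <= C, 0 < d & forall e, 0 < `|e| < d -> `|f e - g e| <= C * `|e| ^+ N].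
Proof.
move=> /eqaddOP [C [Cr H]].
(* The limit form grants the bound for constants above [C] only, hence [C + 1]; the maximum makes
   the constant nonnegative. *)
have := H (Num.max (C + 1) 0); rewrite lt_max ltrDl ltr01 => /(_ isT).
move=> /nbhs_ballP[d /= d0 bd]; exists (Num.max (C + 1) 0), d; split=> //.
  by rewrite le_max lexx orbT.
move=> e /andP[e0 ed]; rewrite -normrX; apply: bd.
  by rewrite -ball_normE /= sub0r normrN.
by rewrite -normr_gt0.
Qed.

Lemma lin_bounded (p q : nat) (f : 'cV[R]_p -> 'cV[R]_q) :
  (forall w i, f w i 0 = \sum_j w j 0 * f (delta_mx j 0) i 0) ->
  exists2 K, 0 <= K & forall w, `|f w| <= K * `|w|.
Proof.
move=> fl; exists (\sum_i \sum_j `|f (delta_mx j 0) i 0|).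
  by apply: sumr_ge0 => i _; apply: sumr_ge0.
move=> w; apply: mx_norm_le => [|i j].
  by rewrite mulr_ge0 //; apply: sumr_ge0 => i _; apply: sumr_ge0.
rewrite ord1 fl (le_trans (ler_norm_sum _ _ _)) //.
apply: (@le_trans _ _ ((\sum_j `|f (delta_mx j 0) i 0|) * `|w|)).
  rewrite mulr_suml; apply: ler_sum => a _.
  by rewrite normrM mulrC ler_wpM2l // mx_entry_le.
rewrite ler_wpM2r // (bigD1 i) //= lerDl; apply: sumr_ge0 => a _; exact: sumr_ge0.
Qed.

Lemma inj_unitmx (K : fieldType) (p : nat) (M : 'M[K]_p) :
  (forall v : 'cV[K]_p, M *m v = 0 -> v = 0) -> M \in unitmx.
Proof.
move=> Minj; rewrite -unitmx_tr -row_free_unit -kermx_eq0; apply/eqP/row_matrixP => i.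
rewrite row0; apply: trmx_inj; rewrite trmx0; apply: Minj.
apply: trmx_inj; rewrite trmx_mul trmxK trmx0.
by rewrite -row_mul mulmx_ker row0.
Qed.

Variables (cf : nf_coefs R k) (l : R).

Lemma nf_dquad_lin (y w : 'cV[R]_2) i :
  nf_dquad cf l y w i 0 = \sum_j w j 0 * nf_dquad cf l y (delta_mx j 0) i 0.
Proof. by rewrite sum_ord2 !mxE /=; ring. Qed.

Lemma nf_dcubic_lin (y w : 'cV[R]_2) i :
  nf_dcubic cf l y w i 0 = \sum_j w j 0 * nf_dcubic cf l y (delta_mx j 0) i 0.
Proof. by rewrite sum_ord2 !mxE /=; ring. Qed.

Lemma nf_dquadB (y w v : 'cV[R]_2) : nf_dquad cf l y (w - v) = nf_dquad cf l y w - nf_dquad cf l y v.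
Proof. by apply/colP => i; rewrite !mxE /=; ring. Qed.

Lemma nf_dcubicB (y w v : 'cV[R]_2) : nf_dcubic cf l y (w - v) = nf_dcubic cf l y w - nf_dcubic cf l y v.
Proof. by apply/colP => i; rewrite !mxE /=; ring. Qed.

Lemma nf_dquadZl (e : R) (y w : 'cV[R]_2) : nf_dquad cf l (e *: y) w = e *: nf_dquad cf l y w.
Proof. by apply/colP => i; rewrite !mxE /=; ring. Qed.

Lemma nf_dcubicZl (e : R) (y w : 'cV[R]_2) : nf_dcubic cf l (e *: y) w = e ^+ 2 *: nf_dcubic cf l y w.
Proof. by apply/colP => i; rewrite !mxE /=; ring. Qed.

Section Expansion.
Variables (W : R -> 'cV[R]_n) (A : 'M[R]_n) (beta : 'I_n -> seq 'I_n -> R) (y q K : 'cV[R]_n) (C d : R).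
Hypotheses (d0 : 0 < d) (d1 : d <= 1).
Let P (e : R) := 0 < `|e| < d.
Let rho (e : R) : R := `|e|.
Let rho01 e : P e -> 0 <= rho e <= 1.
Proof. by move=> /andP[/ltW e0 /ltW ed]; rewrite e0 (le_trans ed). Qed.
Local Notation O := (bigO P rho).
Let T e := y + e *: q + e ^+ 2 *: K.
Hypothesis W_exp : forall e c, P e -> `|W e c 0 - ((A *m T e) c 0
  + e * ml [:: T e; T e] (beta c) + e ^+ 2 * ml [:: T e; T e; T e] (beta c)
  + e ^+ 3 * ml [:: T e; T e; T e; T e] (beta c))| <= C * `|e| ^+ 4.

Lemma O_id : O 1 (fun e => e).
Proof. by exists 1 => // e _; rewrite mul1r expr1. Qed.

Lemma O_cst (V : normedZmodType R) (x : V) : O 0 (fun=> x).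
Proof. exact: bigO_bounded. Qed.

Lemma O_ml_cst (us : seq (nat * (R -> 'cV[R]_n))) c :
  foldr (fun x Q => O x.1 x.2 /\ Q) True us ->
  O (foldr (fun x s => (x.1 + s)%N) 0 us) (fun e => ml (map (fun x => x.2 e) us) (beta c)).
Proof.
move=> Ous; apply: bigO_ml => //.
exists (\sum_(r : (size us).-tuple 'I_n) `|beta c r|); first by apply: sumr_ge0.
move=> e _ r /eqP sr; rewrite expr0 mulr1.
by rewrite (bigD1 (Tuple sr)) //= lerDl; apply: sumr_ge0.
Qed.

(** Reads off the coefficients of [e^0], [e^1], [e^2] of the field at the transformed point. [K]
    enters at order [e^2] through the linear part alone, since the quadratic term has its own factor
    [e]. *)
Lemma transformed_field_expansion c : O 3 (fun e => W e c 0 - ((A *m y) c 0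
  + e * ((A *m q) c 0 + ml [:: y; y] (beta c))
  + e ^+ 2 * ((A *m K) c 0 + ml [:: y; q] (beta c) + ml [:: q; y] (beta c) + ml [:: y; y; y] (beta c)))).
Proof.
have yO := O_cst y; have eO := O_id.
pose w e := e *: q + e ^+ 2 *: K.
have e2K : O 2 (fun e => e ^+ 2 *: K) := bigOZ (bigOX 2 O_id) (O_cst K).
have wO : O 1 w.
  by apply: bigOD; [exact: bigOZ O_id (O_cst q)|apply: bigO_le e2K].
have TO : O 0 T.
  apply: bigO_ext (bigOD yO (bigO_le rho01 (isT : (0 <= 1)%N) wO)) => e _.
  by rewrite /T /w addrA.
have T1 : O 3 (fun e => W e c 0 - ((A *m T e) c 0
  + e * ml [:: T e; T e] (beta c) + e ^+ 2 * ml [:: T e; T e; T e] (beta c)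
  + e ^+ 3 * ml [:: T e; T e; T e; T e] (beta c))).
  apply: (bigO_le rho01 (isT : (3 <= 4)%N)); exists (Num.max C 0); first by rewrite le_max lexx orbT.
  move=> e Pe; rewrite (le_trans (W_exp c Pe)) // ler_wpM2r ?exprn_ge0 ?normr_ge0 //.
  by rewrite le_max lexx.
have T2 := bigOM eO (O_ml_cst c (us := [:: (0%N, fun=> y); (2%N, fun e => e ^+ 2 *: K)]) (conj yO (conj e2K Logic.I))).
have T3 := bigOM eO (O_ml_cst c (us := [:: (2%N, fun e => e ^+ 2 *: K); (0%N, T)]) (conj e2K (conj TO Logic.I))).
have T4 := bigOM (bigOX 3 eO) (O_ml_cst c (us := [:: (0%N, fun=> q); (0%N, fun=> q)]) (conj (O_cst q) (conj (O_cst q) Logic.I))).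
have T5 := bigOM (bigOX 2 eO) (bigOD (bigOD
  (O_ml_cst c (us := [:: (1%N, w); (0%N, T); (0%N, T)]) (conj wO (conj TO (conj TO Logic.I))))
  (O_ml_cst c (us := [:: (0%N, fun=> y); (1%N, w); (0%N, T)]) (conj yO (conj wO (conj TO Logic.I)))))
  (O_ml_cst c (us := [:: (0%N, fun=> y); (0%N, fun=> y); (1%N, w)]) (conj yO (conj yO (conj wO Logic.I))))).
have T6 := bigOM (bigOX 3 eO) (O_ml_cst c (us := [:: (0%N, T); (0%N, T); (0%N, T); (0%N, T)])
  (conj TO (conj TO (conj TO (conj TO Logic.I))))).
have T7 := bigOM eO (bigOM eO (O_ml_cst c (us := [:: (0%N, fun=> q); (2%N, fun e => e ^+ 2 *: K)]) (conj (O_cst q) (conj e2K Logic.I)))).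
have T7' := bigO_le rho01 (isT : (3 <= 4)%N) T7.
apply: bigO_ext (bigOD T1 (bigOD T2 (bigOD T3 (bigOD T4 (bigOD T5 (bigOD T6 T7')))))) => e _ /=.
have AT : (A *m T e) c 0 = (A *m y) c 0 + e * (A *m q) c 0 + e ^+ 2 * (A *m K) c 0.
  by rewrite /T !mulmxDr -!scalemxAr !mxE.
have TT : ml [:: T e; T e] (beta c) = ml [:: y; y] (beta c) + e * (ml [:: y; q] (beta c) + ml [:: q; y] (beta c))
   + e ^+ 2 * ml [:: q; q] (beta c) + ml [:: y; e ^+ 2 *: K] (beta c) + e * ml [:: q; e ^+ 2 *: K] (beta c)
   + ml [:: e ^+ 2 *: K; T e] (beta c).
  have E3 u v u' : ml [:: u + v + u'; u + v + u'] (beta c) = ml [:: u; u] (beta c) + ml [:: u; v] (beta c)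
      + ml [:: u; u'] (beta c) + (ml [:: v; u] (beta c) + ml [:: v; v] (beta c) + ml [:: v; u'] (beta c))
      + ml [:: u'; u + v + u'] (beta c).
    by rewrite !mlD1 !mlD2; ring.
  rewrite [LHS]E3 -/(T e) ![ml [:: y; e *: _] _]mlZ2 ![ml [:: e *: _; _] _]mlZ1 ![ml [:: q; e *: _] _]mlZ2.
  by ring.
have TTT : ml [:: T e; T e; T e] (beta c) = ml [:: y; y; y] (beta c) + (ml [:: w e; T e; T e] (beta c)
  + ml [:: y; w e; T e] (beta c) + ml [:: y; y; w e] (beta c)).
  by rewrite -[T e]/(y + e *: q + e ^+ 2 *: K) -[_ + _ + _]addrA -/(w e); exact: ml3_telescope.
by rewrite AT TT TTT; ring.
Qed.

End Expansion.

Lemma nf_transform_hat (e : R) (yh : 'cV[R]_2) :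
  nf_transform cf l e (col_mx yh 0) = col_mx yh 0 + e *: nf_quad cf l yh + e ^+ 2 *: col_mx (nf_cubic cf l yh) 0.
Proof.
rewrite /nf_transform col_mxKu col_mxKd -[in RHS](vsubmxK (nf_quad cf l yh)).
by rewrite !scale_col_mx !add_col_mx add0r scaler0 addr0.
Qed.

(* Multiplying out the inverse of 1 + Dh turns the normal form conditions into
   the homological equations of orders e and e^2.  At order e^2 only the hat
   components are usable, since htilde has no cubic part. *)
Lemma nf_homological (F : 'cV[R]_n -> R -> 'cV[R]_n) (D : continuation R k) (bR bI : R)
    (beta : 'I_n -> seq 'I_n -> R) (C d : R) :
  0 < d ->
  (forall z e c, `|z| <= 3 -> 0 < `|e| < d -> `|Gfield F D z l e c 0 - ((Emat D l *m z) c 0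
    + e * ml [:: z; z] (beta c) + e ^+ 2 * ml [:: z; z; z] (beta c)
    + e ^+ 3 * ml [:: z; z; z; z] (beta c))| <= C * `|e| ^+ 4) ->
  nf_conditions F D cf l bR bI ->
  forall yh : 'cV[R]_2, `|yh| <= 1 ->
  (forall c, (Emat D l *m nf_quad cf l yh) c 0 + ml [:: col_mx yh 0; col_mx yh 0] (beta c) =
     nf_dquad cf l yh (Ehat D l *m yh) c 0) /\
  (forall i, (Emat D l *m col_mx (nf_cubic cf l yh) 0) (lshift k i) 0
      + ml [:: col_mx yh 0; nf_quad cf l yh] (beta (lshift k i))
      + ml [:: nf_quad cf l yh; col_mx yh 0] (beta (lshift k i))
      + ml [:: col_mx yh 0; col_mx yh 0; col_mx yh 0] (beta (lshift k i)) =
     (nf_dcubic cf l yh (Ehat D l *m yh) + (yh 0 0 ^+ 2 + yh 1 0 ^+ 2) *: (rot2 bR bI *m yh)) i 0).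
Proof.
move=> d0 Gexp [_ [Gh [Gt [[_ exph] [_ expt] Gt2 Gh2 Gh3]]]] yh yh1.
pose y : 'cV[R]_n := col_mx yh 0; pose q := nf_quad cf l yh; pose K : 'cV[R]_n := col_mx (nf_cubic cf l yh) 0.
pose w := Ehat D l *m yh; pose g3 := (yh 0 0 ^+ 2 + yh 1 0 ^+ 2) *: (rot2 bR bI *m yh).
have y1 : `|y| <= 1.
  apply: mx_norm_le => // i j; rewrite /y mxE; case: splitP => a _.
    exact: le_trans (mx_entry_le _ _ _) yh1.
  by rewrite mxE normr0.
have := exph y 3%N isT; have := expt y 3%N isT.
have sum2 (V : lmodType R) (f : nat -> V) : \sum_(2 <= p < 4) f p = f 2%N + f 3%N.
  by rewrite big_ltn // big_ltn // big_geq // addr0.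
move=> /eqaddO_bound[Ct [dt [Ct0 dt0 Ht]]].
move=> /eqaddO_bound[Ch [dh [Ch0 dh0 Hh]]].
have hq := lin_bounded (nf_dquad_lin yh).
have hc := lin_bounded (nf_dcubic_lin yh).
case: hq hc => Kq Kq0 Hq [Kc Kc0 Hc].
(* The requirement [|e| B < 1] serves twice: it keeps the transformed point within norm 3 and makes
   the Jacobian of [hhat] a contraction. *)
pose B := `|q| + `|K| + Kq + Kc + 1.
have B0 : 0 < B by rewrite ltr_wpDl // !addr_ge0.
pose d' := Num.min (Num.min d 1) (Num.min (Num.min dt dh) B^-1).
have d'0 : 0 < d' by rewrite !lt_min d0 ltr01 dt0 dh0 invr_gt0 B0.
have Pd (e : R) : 0 < `|e| < d' -> [/\ 0 < `|e| < d, `|e| < 1, 0 < `|e| < dt, 0 < `|e| < dh & `|e| * B < 1].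
  rewrite !lt_min => /andP[-> /andP[/andP[-> ->] /andP[/andP[-> ->] eB]]]; split=> //.
  by rewrite -ltr_pdivlMr // div1r.
have d'1 : d' <= 1 by rewrite /d' !ge_min lexx !orbT.
pose W e := Gfield F D (nf_transform cf l e y) l e.
have TE (e : R) : nf_transform cf l e y = y + e *: q + e ^+ 2 *: K by exact: nf_transform_hat.
have Tle (e : R) : 0 < `|e| < d' -> `|y + e *: q + e ^+ 2 *: K| <= 3.
  move=> /Pd[_ e1 _ _ eB].
  have : `|y + e *: q + e ^+ 2 *: K| <= `|y| + `|e| * `|q| + `|e| * `|K|.
    rewrite (le_trans (ler_normD _ _)) // lerD ?(le_trans (ler_normD _ _)) ?normrZ //.
    by rewrite -mulrA ler_piMl ?mulr_ge0 // ltW.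
  move/le_trans; apply; rewrite -addrA -mulrDr.
  have : `|e| * (`|q| + `|K|) <= `|e| * B.
    by rewrite ler_wpM2l // /B -!addrA !lerD2l ler_wpDr // addr_ge0 // addr_ge0.
  lra.
have Wexp c := @transformed_field_expansion W (Emat D l) beta y q K C d' d'1
  (fun e c Pe => let: And5 h _ _ _ _ := Pd e Pe in
     eq_rect _ (fun T => `|Gfield F D T l e c 0 - _| <= _) (Gexp _ e c (Tle e Pe) h) _ (esym (TE e))) c.
pose P (e : R) : Prop := 0 < `|e| < d'.
have rho01 e : P e -> 0 <= `|e| <= 1 by move=> /Pd[_ /ltW e1 _ _ _]; rewrite normr_ge0.
have uy : usubmx y = yh by rewrite col_mxKu.
have dy : dsubmx y = 0 by rewrite col_mxKd.
pose Ghd e := Ghat_dag F D cf y l e.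
have sub_le (v : 'cV[R]_n) : `|usubmx v| <= `|v|.
  by apply: mx_norm_le => // a b; rewrite mxE mx_entry_le.
have WE e : P e -> usubmx (W e) = Ghd e + (e *: usubmx (nf_dquad cf l yh (Ghd e)) + e ^+ 2 *: nf_dcubic cf l yh (Ghd e)).
  move=> Pe; set J := jac (hhat cf l) (e *: usubmx y).
  have JE v : J *m v = e *: usubmx (nf_dquad cf l yh v) + e ^+ 2 *: nf_dcubic cf l yh v.
    rewrite /J jac_hhat uy nf_dquadZl nf_dcubicZl; congr (_ + _).
    by apply/colP => a; rewrite !mxE.
  (* A kernel vector would satisfy [|v| <= |e| B |v|] with [|e| B < 1], so it is zero. *)
  have uJ : 1%:M + J \in unitmx.
    apply: inj_unitmx => v; rewrite mulmxDl mul1mx => /eqP; rewrite addr_eq0 => /eqP vJ.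
    apply/eqP; rewrite -normr_eq0; apply/negPn/negP => v0.
    have {}v0 : 0 < `|v| by rewrite lt_def v0 normr_ge0.
    have [_ e1 _ _ eB] := Pd e Pe.
    have : `|v| <= `|e| * B * `|v|.
      rewrite {1}vJ normrN JE (le_trans (ler_normD _ _)) // !normrZ -mulrA.
      apply: (@le_trans _ _ (`|e| * (Kq * `|v|) + `|e| * (Kc * `|v|))).
        rewrite lerD //; first by rewrite ler_wpM2l // (le_trans (sub_le _)).
        by rewrite ler_wpM2l // (le_trans _ (Hc v)) // ler_piMl // ltW.
      have Bge : Kq + Kc <= B by rewrite /B; have := normr_ge0 q; have := normr_ge0 K; lra.
      by rewrite -mulrDr -mulrDl -[leRHS]mulrA; apply: ler_wpM2l => //; apply: ler_wpM2r.
    by rewrite -[X in X <= _]mul1r ler_pM2r // leNgt eB.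
  by rewrite -JE -[X in X + _]mul1mx -mulmxDl /Ghd /Ghat_dag -/J mulKVmx.
(* The term of order [e] is missing because the quadratic part of the transformed field vanishes on
   the centre plane, and the cubic part there is the Lyapunov term. *)
have RO : bigO P (fun e : R => `|e|) 3 (fun e => Ghd e - (w + e ^+ 2 *: g3)).
  exists Ch => // e Pe; have [_ _ _ h _] := Pd e Pe.
  have := Hh e h; rewrite sum2 -/(Ghd e) uy -/w expr1.
  have -> : Gh 2%N y = 0 by exact: Gh2.
  have -> : Gh 3%N y = g3 by exact: Gh3.
  by rewrite scaler0 add0r.
have idO : bigO P (fun e : R => `|e|) 1 (fun e => e) by exact: O_id.
have GwO : bigO P (fun e : R => `|e|) 2 (fun e => Ghd e - w).
  have h2 : bigO P (fun e : R => `|e|) 2 (fun e => e ^+ 2 *: g3) by exists `|g3| => // e _; rewrite normrZ normrX mulrC.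
  apply: bigO_ext (bigOD (bigO_le rho01 (isT : (2 <= 3)%N) RO) h2) => e _.
  by rewrite opprD addrA subrK.
have dqO c : bigO P (fun e : R => `|e|) 2 (fun e => nf_dquad cf l yh (Ghd e - w) c 0).
  case: GwO => Cg Cg0 Hg; exists (Kq * Cg) => [|e Pe]; first exact: mulr_ge0.
  by rewrite (le_trans (mx_entry_le _ _ _)) // (le_trans (Hq _)) // -mulrA ler_wpM2l // Hg.
have dcO i : bigO P (fun e : R => `|e|) 2 (fun e => nf_dcubic cf l yh (Ghd e - w) i 0).
  case: GwO => Cg Cg0 Hg; exists (Kc * Cg) => [|e Pe]; first exact: mulr_ge0.
  by rewrite (le_trans (mx_entry_le _ _ _)) // (le_trans (Hc _)) // -mulrA ler_wpM2l // Hg.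
have hat i : bigO P (fun e : R => `|e|) 3 (fun e => W e (lshift k i) 0 - (w i 0 + e * nf_dquad cf l yh w (lshift k i) 0
    + e ^+ 2 * (nf_dcubic cf l yh w + g3) i 0)).
  have h1 : bigO P (fun e : R => `|e|) 3 (fun e => (Ghd e - (w + e ^+ 2 *: g3)) i 0).
    case: RO => Cr Cr0 Hr; exists Cr => // e Pe.
    by rewrite (le_trans (mx_entry_le _ _ _)) // Hr.
  have h2 := bigOM idO (dqO (lshift k i)).
  have h3 := bigO_le rho01 (isT : (3 <= 4)%N) (bigOM (bigOX 2 idO) (dcO i)).
  apply: bigO_ext (bigOD h1 (bigOD h2 h3)) => e Pe.
  have := congr1 (fun M : 'cV[R]_2 => M i 0) (WE e Pe); rewrite [LHS]mxE => ->.
  by rewrite nf_dquadB nf_dcubicB !mxE; ring.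
(* The coefficient of [e^2] contains the unspecified cubic part [Gt 3], so these rows give an
   equation at order [e] only. *)
have tilde i : bigO P (fun e : R => `|e|) 3 (fun e => W e (rshift 2 i) 0 - (e * nf_dquad cf l yh w (rshift 2 i) 0
    + e ^+ 2 * Gt 3%N y i 0)).
  have h1 : bigO P (fun e : R => `|e|) 3 (fun e => (Gtilde_dag F D cf y l e - e ^+ 2 *: Gt 3%N y) i 0).
    exists Ct => // e Pe; have [_ _ h _ _] := Pd e Pe.
    rewrite (le_trans (mx_entry_le _ _ _)) //.
    have := Ht e h; rewrite sum2 dy mulmx0 add0r expr1.
    have -> : Gt 2%N y = 0 by exact: Gt2.
    by rewrite scaler0 add0r.
  have h2 := bigOM idO (dqO (rshift 2 i)).
  apply: bigO_ext (bigOD h1 h2) => e Pe.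
  rewrite /Gtilde_dag jac_htilde uy -/(Ghd e) nf_dquadZl nf_dquadB -/(W e) !mxE; ring.
have poly c (a b1 b2 a' b1' b2' : R) :
   bigO P (fun e : R => `|e|) 3 (fun e => W e c 0 - (a + e * b1 + e ^+ 2 * b2)) ->
   bigO P (fun e : R => `|e|) 3 (fun e => W e c 0 - (a' + e * b1' + e ^+ 2 * b2')) -> b1 = b1' /\ b2 = b2'.
  move=> h h'; have [Cd Cd0 Hd] := bigOB h' h.
  have [e Pe|_ /eqP + /eqP] := @eps_poly2_eq0 Cd d' (a - a') (b1 - b1') (b2 - b2') d'0.
    rewrite (le_trans _ (Hd e Pe)) // le_eqVlt; apply/orP; left; apply/eqP; congr (`|_|); ring.
  by rewrite !subr_eq0 => /eqP -> /eqP ->.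
split=> [c|i].
  case: (splitP c) => i ci.
    have -> : c = lshift k i by exact/val_inj.
    by have [-> _] := poly _ _ _ _ _ _ _ (Wexp (lshift k i)) (hat i).
  have -> : c = rshift 2 i by exact/val_inj.
  have t : bigO P (fun e : R => `|e|) 3 (fun e => W e (rshift 2 i) 0 - (0 + e * nf_dquad cf l yh w (rshift 2 i) 0 + e ^+ 2 * Gt 3%N y i 0)).
    by apply: bigO_ext (tilde i) => e _; rewrite add0r.
  by have [-> _] := poly _ _ _ _ _ _ _ (Wexp (rshift 2 i)) t.
by have [_ <-] := poly _ _ _ _ _ _ _ (Wexp (lshift k i)) (hat i).
Qed.

End NormalFormIdentities.

(** * Inversion of the harmonics *)

Section LinearInverse.
Context {R : realType}.

(** Over the complex numbers the matrix factors as [(A - i w)(A + i w)], and neither [i w] nor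
    [- i w] is an eigenvalue. The case [w = 0], needed for the constant mode, is included. *)
Lemma sqr_add_unitmx p (A : 'M[R]_p) (w : R) : no_imaginary_eigenvalue A ->
  A *m A + (w ^+ 2)%:M \in unitmx.
Proof.
move=> nA; pose toC := complex.real_complex R.
have key mu : complex.Re mu = 0 -> map_mx toC A - mu%:M \in unitmx.
  move=> mu0; rewrite -row_free_unit -kermx_eq0; apply/negPn/negP => h.
  by have := nA mu h; rewrite mu0 eqxx.
rewrite -(map_unitmx toC).
have -> : map_mx toC (A *m A + (w ^+ 2)%:M) =
   (map_mx toC A - (complex.Complex 0 w)%:M) *m (map_mx toC A - (complex.Complex 0 (- w))%:M).
  rewrite map_mxD map_mxM map_scalar_mx mulmxBl !mulmxBr mul_mx_scalar mul_scalar_mx -scalar_mxM.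
  have -> : complex.Complex 0 (- w) = - complex.Complex 0 w by apply/eqP; rewrite eq_complex /= oppr0 !eqxx.
  have -> : complex.Complex 0 w * - complex.Complex 0 w = toC (w ^+ 2).
    by apply/eqP; rewrite eq_complex /=; apply/andP; split; apply/eqP; ring.
  by rewrite scaleNr opprK opprB addrA addrAC addrK.
by rewrite unitmx_mul !key.
Qed.

(** With right-hand sides [r1], [r2], elimination gives [(B^2 + w^2) a = B r1 + w r2] and
    [(B^2 + w^2) b = B r2 - w r1]. This keeps the inversion of a real harmonic pair real. *)
Lemma block_inverse_bound p (B : 'M[R]_p) (w : R) : B *m B + (w ^+ 2)%:M \in unitmx ->
  exists2 C, 0 <= C & forall (a b : 'cV[R]_p) M, `|B *m a - w *: b| <= M -> `|B *m b + w *: a| <= M ->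
    `|a| <= C * M /\ `|b| <= C * M.
Proof.
move=> uN; set N := B *m B + _ in uN.
pose C := p%:R * `|invmx N| * (p%:R * `|B| + `|w|).
exists C; first by rewrite mulr_ge0 // ?addr_ge0 ?mulr_ge0.
have est (x r1 r2 : 'cV[R]_p) M : N *m x = B *m r1 + w *: r2 -> `|r1| <= M -> `|r2| <= M -> `|x| <= C * M.
  move=> E h1 h2; rewrite -(mulKmx uN x) E (le_trans (mulmx_norm_le _ _)) // /C -[leRHS]mulrA.
  apply: ler_wpM2l; first exact: mulr_ge0.
  rewrite mulrDl -mulrA.
  rewrite (le_trans (ler_normD _ _)) // lerD ?normrZ ?ler_wpM2l //.
  by rewrite (le_trans (mulmx_norm_le _ _)) // mulrA; apply: ler_wpM2l => //; exact: mulr_ge0.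
have NE (x : 'cV[R]_p) : N *m x = B *m (B *m x) + w ^+ 2 *: x.
  by rewrite /N mulmxDl mulmxA mul_scalar_mx.
move=> a b M ha hb; split.
- apply: (est a (B *m a - w *: b) (B *m b + w *: a)) => //.
  by rewrite NE mulmxBr -scalemxAr scalerDr scalerA -expr2 addrA subrK.
- apply: (est b (B *m b + w *: a) (- (B *m a - w *: b))) => //; last by rewrite normrN.
  by rewrite NE mulmxDr -scalemxAr opprB scalerBr scalerA -expr2 addrA addrAC addrK.
Qed.

Lemma rot2_mul_vec (u v : R) (x : 'cV[R]_2) :
  rot2 u v *m x = vec2 (u * x 0 0 - v * x 1 0) (v * x 0 0 + u * x 1 0).
Proof.
apply/colP => i; rewrite !mxE sum_ord2 !mxE.
by case: i => [[|[|//]] ?] /=; ring.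
Qed.

(** The square of the rotation generator is [- w^2], so the sum is the scalar matrix
    [(m^2 - 1) w^2]: resonance occurs at [m = 1] or [m = -1] only. *)
Lemma rot2_sqr_unitmx (w m : R) : w != 0 -> m ^+ 2 != 1 ->
  rot2 0 w *m rot2 0 w + ((m * w) ^+ 2)%:M \in unitmx.
Proof.
move=> w0 m1; have -> : rot2 0 w *m rot2 0 w + ((m * w) ^+ 2)%:M = ((m ^+ 2 - 1) * w ^+ 2)%:M.
  apply/matrixP => i j; rewrite !mxE sum_ord2 !mxE.
  by case: i => [[|[|//]] ?]; case: j => [[|[|//]] ?] /=; rewrite -?[_ *+ _]/0 ?mulr0n ?mulr1n; ring.
by rewrite unitmxE det_scalar unitfE expf_neq0 // mulf_neq0 ?subr_eq0 // expf_neq0.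
Qed.

(* The kernel of the first-harmonic block is compensated by the unknowns s1
   (growth rate) and s2 (frequency) and by the phase and amplitude constraints. *)
Lemma resonant_block_bound (w : R) : 0 < w ->
  exists2 C, 0 <= C & forall (a b : 'cV[R]_2) (s1 s2 M : R),
    a 0 0 + b 1 0 = 0 -> a 1 0 - b 0 0 = 0 ->
    `|rot2 0 w *m a - w *: b + vec2 s1 s2| <= M ->
    `|rot2 0 w *m b + w *: a + vec2 (- s2) s1| <= M ->
    [/\ `|a| <= C * M, `|b| <= C * M, `|s1| <= C * M & `|s2| <= C * M].
Proof.
move=> w0; exists (w^-1 + 1); first by rewrite addr_ge0 // invr_ge0 ltW.
move=> a b s1 s2 M h1 h2 H1 H2.
have M0 : 0 <= M by apply: le_trans H1.
have := le_trans (mx_entry_le _ 0 0) H1; have := le_trans (mx_entry_le _ 1 0) H1.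
have := le_trans (mx_entry_le _ 0 0) H2; have := le_trans (mx_entry_le _ 1 0) H2.
rewrite !rot2_mul_vec !mxE /= !mul0r !add0r => r4 r3 r2 r1.
have eb1 : b 1 0 = - a 0 0 by lra.
have eb0 : b 0 0 = a 1 0 by lra.
(* After elimination of [b] the four entries are [s1 - 2 w a1], [s2 + 2 w a0], [2 w a0 - s2] and
   [2 w a1 + s1], where [a0], [a1] are the entries of [a]. Half sums and half differences isolate
   each unknown. *)
move: r1 r2 r3 r4; rewrite eb1 eb0 !ler_norml => r1 r2 r3 r4.
have s1M : `|s1| <= M by rewrite ler_norml; lra.
have s2M : `|s2| <= M by rewrite ler_norml; lra.
have CM : M <= (w^-1 + 1) * M.
  by rewrite mulrDl mul1r lerDr mulr_ge0 // invr_ge0 ltW.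
have wM : w^-1 * M <= (w^-1 + 1) * M by rewrite mulrDl mul1r lerDl.
have a0 : `|a 0 0| <= w^-1 * M.
  rewrite ler_pdivlMl // -(gtr0_norm w0) -normrM ler_norml; lra.
have a1 : `|a 1 0| <= w^-1 * M.
  rewrite ler_pdivlMl // -(gtr0_norm w0) -normrM ler_norml; lra.
split; [| |by rewrite -ler_norml; exact: le_trans CM|by rewrite -ler_norml; exact: le_trans CM].
- apply: mx_norm_le => [|i j]; first exact: le_trans CM.
  rewrite ord1 (le_trans _ wM) //; case: i => [[|[|//]] i2].
    by rewrite (_ : Ordinal i2 = 0) //; exact/val_inj.
  by rewrite (_ : Ordinal i2 = 1) //; exact/val_inj.
- apply: mx_norm_le => [|i j]; first exact: le_trans CM.
  rewrite ord1 (le_trans _ wM) //; case: i => [[|[|//]] i2].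
    by rewrite (_ : Ordinal i2 = 0) ?eb0 //; exact/val_inj.
  by rewrite (_ : Ordinal i2 = 1) ?eb1 ?normrN //; exact/val_inj.
Qed.

End LinearInverse.

(** * Vector-valued trigonometric polynomials of degree at most three *)

Section TrigVectors.
Context {R : realType} {n : nat}.
Implicit Types (a b : nat -> 'cV[R]_n).

Definition tvec a b (t : R) : 'cV[R]_n :=
  \sum_(j < 4) (cos (j%:R * t) *: a j + sin (j%:R * t) *: b j).

Lemma tvec_entry a b t c : tvec a b t c 0 = trigpoly 4 (fun j => a j c 0) (fun j => b j c 0) t.
Proof. by rewrite summxE; apply: eq_bigr => j _; rewrite !mxE; congr (_ + _); rewrite mulrC. Qed.

Lemma tvecD a b a' b' t :
  tvec a b t + tvec a' b' t = tvec (fun j => a j + a' j) (fun j => b j + b' j) t.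
Proof. by rewrite -big_split; apply: eq_bigr => j _ /=; rewrite !scalerDr addrACA. Qed.

Lemma tvecZ (x : R) a b t : x *: tvec a b t = tvec (fun j => x *: a j) (fun j => x *: b j) t.
Proof.
rewrite scaler_sumr; apply: eq_bigr => j _.
by rewrite scalerDr !scalerA ![x * _]mulrC.
Qed.

Lemma tvecB a b a' b' t :
  tvec a b t - tvec a' b' t = tvec (fun j => a j - a' j) (fun j => b j - b' j) t.
Proof.
rewrite -scaleN1r tvecZ tvecD.
by apply: eq_bigr => j _; rewrite !scaleN1r.
Qed.

Lemma mul_tvec (A : 'M[R]_n) a b t : A *m tvec a b t = tvec (fun j => A *m a j) (fun j => A *m b j) t.
Proof. by rewrite mulmx_sumr; apply: eq_bigr => j _; rewrite mulmxDr -!scalemxAr. Qed.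

Lemma tvec_le a b t : `|tvec a b t| <= \sum_(j < 4) (`|a j| + `|b j|).
Proof.
rewrite (le_trans (ler_norm_sum _ _ _)) //; apply: ler_sum => j _.
rewrite (le_trans (ler_normD _ _)) // !normrZ lerD // ler_piMl //.
  by rewrite ler_norml cos_geN1 cos_le1.
by rewrite ler_norml sin_geN1 sin_le1.
Qed.

Lemma cosDnpi (j : nat) (x : R) : cos (x + j%:R * pi) = (-1) ^+ j * cos x.
Proof.
elim: j => [|j IH]; first by rewrite mul0r addr0 mul1r.
by rewrite -natr1 mulrDl mul1r addrA cosDpi IH exprS mulN1r mulNr.
Qed.

Lemma sinDnpi (j : nat) (x : R) : sin (x + j%:R * pi) = (-1) ^+ j * sin x.
Proof.
elim: j => [|j IH]; first by rewrite mul0r addr0 mul1r.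
by rewrite -natr1 mulrDl mul1r addrA sinDpi IH exprS mulN1r mulNr.
Qed.

Lemma tvec_shift a b t :
  tvec a b (t + pi) = tvec (fun j => (-1) ^+ j *: a j) (fun j => (-1) ^+ j *: b j) t.
Proof.
apply: eq_bigr => j _; rewrite mulrDr cosDnpi sinDnpi.
by rewrite !scalerA ![(-1) ^+ _ * _]mulrC.
Qed.

Lemma tvec_period a b t : tvec a b (t + 2 * pi) = tvec a b t.
Proof. by apply: eq_bigr => j _; rewrite mulrDr cos_period sin_period. Qed.

(** With [dsin], the coefficients of the time derivative of [tvec a b]: its cosines come from the
    sines and conversely, hence the single argument of each. *)
Definition dcos b (j : nat) : 'cV[R]_n := j%:R *: b j.
Definition dsin a (j : nat) : 'cV[R]_n := - (j%:R *: a j).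

Lemma is_derive_trigpoly (N : nat) (a b : nat -> R) (t : R) :
  is_derive t (1 : R) (trigpoly N a b) (trigpoly N (fun j => j%:R * b j) (fun j => - (j%:R * a j)) t).
Proof.
have dj (j : 'I_N) : is_derive t (1 : R) (fun t => a j * cos (j%:R * t) + b j * sin (j%:R * t))
    (j%:R * b j * cos (j%:R * t) + - (j%:R * a j) * sin (j%:R * t)).
  have dl : is_derive t (1 : R) (fun t : R => j%:R * t) j%:R.
    by apply: is_derive_eq; rewrite -[LHS]/(_ * 1) mulr1.
  have dc := @is_derive1_comp _ cos (fun t : R => j%:R * t) t _ _ (is_derive_cos _) dl.
  have ds := @is_derive1_comp _ sin (fun t : R => j%:R * t) t _ _ (is_derive_sin _) dl.
  have hZ f x df := @is_deriveZ R R R f x t 1 df.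
  have h := is_deriveD (hZ _ (a j) _ dc) (hZ _ (b j) _ ds).
  apply: (is_derive_eq h); rewrite -![_ *: _]/(_ * _); ring.
have h := @is_derive_sum _ _ _ N _ t 1 _ dj.
have -> : trigpoly N a b = \sum_(j < N) (fun t => a j * cos (j%:R * t) + b j * sin (j%:R * t)).
  by apply/funext => s; rewrite fct_sumE.
exact: h.
Qed.

Lemma derive1_tvec a b t : derive1 (tvec a b) t = tvec (dcos b) (dsin a) t.
Proof.
have d c := is_derive_trigpoly 4 (fun j => a j c 0) (fun j => b j c 0) t.
have E c : (fun t => tvec a b t c 0) = trigpoly 4 (fun j => a j c 0) (fun j => b j c 0).
  by apply/funext => s; exact: tvec_entry.
rewrite derive1E derive_mx; last first.
  by apply/derivable_mxP => i j; rewrite ord1 E; have [] := d i.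
apply/colP => c; rewrite mxE E tvec_entry; have [_ ->] := d c.
by apply: eq_bigr => j _; rewrite !mxE.
Qed.

(** Testing the difference against the harmonic [j] leaves the coefficient of the polynomial alone,
    as [f] contributes nothing; the factor 2 undoes the mean 1/2 of a squared harmonic. This is how
    a pointwise estimate of the residual reaches the modes. *)
Lemma trigpoly_coef_bound (f : R -> R) (al be : nat -> R) (M : R) (j : nat) : (j < 4)%N ->
  continuous f -> (forall t, `|f t - trigpoly 4 al be t| <= M) ->
  mean (fun t => cos (j%:R * t) * f t) = 0 -> mean (fun t => sin (j%:R * t) * f t) = 0 ->
  `|al j| <= 2 * M /\ (j != 0 -> `|be j| <= 2 * M).
Proof.
move=> j4 cf fM mc ms; have M0 : 0 <= M by apply: le_trans (fM 0).
pose g t := f t - trigpoly 4 al be t.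
have ct : continuous (trigpoly 4 al be) by exact: continuous_trigpoly.
have cg : continuous g by move=> x; apply: cvgB; [exact: cf|exact: ct].
have bc : `|mean (fun t => cos (j%:R * t) * g t)| <= M.
  apply: mean_le => [|t]; first exact: continuousMf (@continuous_cosM _ _) cg.
  by rewrite normrM (le_trans _ (fM t)) // ler_piMl // ler_norml cos_geN1 cos_le1.
have bs : `|mean (fun t => sin (j%:R * t) * g t)| <= M.
  apply: mean_le => [|t]; first exact: continuousMf (@continuous_sinM _ _) cg.
  by rewrite normrM (le_trans _ (fM t)) // ler_piMl // ler_norml sin_geN1 sin_le1.
move: bc bs; rewrite /g.
under eq_fun do rewrite mulrBr; under [X in _ -> is_true (`|mean X| <= _) -> _]eq_fun do rewrite mulrBr.
rewrite !meanB ?mc ?ms ?sub0r ?normrN; try by apply: continuousMf => //; exact: continuous_cosM.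
2-3: by apply: continuousMf => //; exact: continuous_sinM.
rewrite mean_cos_trigpoly // mean_sin_trigpoly // !normrM => bc bs; split.
  move: bc; case: eqP => _; first by rewrite normr1 mul1r => /le_trans; apply; lra.
  by rewrite gtr0_norm ?invr_gt0 // ler_pdivrMl.
by move=> /negbTE j0; move: bs; rewrite j0 gtr0_norm ?invr_gt0 // ler_pdivrMl.
Qed.

End TrigVectors.

(** * Harmonics of the circle and of the normal form *)

Section BlockSplitting.
Context {R : realType} {k : nat}.
Local Notation n := (2 + k)%N.

Lemma usubmx_norm_le (v : 'cV[R]_n) : `|usubmx v| <= `|v|.
Proof. by apply: mx_norm_le => // i j; rewrite mxE mx_entry_le. Qed.

Lemma dsubmx_norm_le (v : 'cV[R]_n) : `|dsubmx v| <= `|v|.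
Proof. by apply: mx_norm_le => // i j; rewrite mxE mx_entry_le. Qed.

Lemma norm_le_parts (v : 'cV[R]_n) (M : R) : `|usubmx v| <= M -> `|dsubmx v| <= M -> `|v| <= M.
Proof.
move=> hu hd; apply: mx_norm_le => [|i j]; first exact: le_trans hu.
rewrite ord1; case: (splitP i) => a ia.
  have -> : i = lshift k a by exact/val_inj.
  by have := le_trans (mx_entry_le (usubmx v) a 0) hu; rewrite mxE.
have -> : i = rshift 2 a by exact/val_inj.
by have := le_trans (mx_entry_le (dsubmx v) a 0) hd; rewrite mxE.
Qed.

Lemma usubmx_block (A : 'M[R]_2) (B : 'M[R]_k) (v : 'cV[R]_n) :
  usubmx (block_mx A 0 0 B *m v) = A *m usubmx v.
Proof. by rewrite -{1}(vsubmxK v) mul_block_col col_mxKu mul0mx addr0. Qed.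

Lemma dsubmx_block (A : 'M[R]_2) (B : 'M[R]_k) (v : 'cV[R]_n) :
  dsubmx (block_mx A 0 0 B *m v) = B *m dsubmx v.
Proof. by rewrite -{1}(vsubmxK v) mul_block_col col_mxKd mul0mx add0r. Qed.

(** One constant for the four harmonics, the sum of theirs. The hyperbolic block is inverted at
    every harmonic, the centre block at all but the resonant one. *)
Lemma block_modes_bound (Et : 'M[R]_k) (w : R) : 0 < w -> no_imaginary_eigenvalue Et ->
  exists2 C, 0 <= C & forall (j : nat) (a b : 'cV[R]_n) M, (j < 4)%N ->
    let r1 := block_mx (rot2 0 w) 0 0 Et *m a - w *: (j%:R *: b) in
    let r2 := block_mx (rot2 0 w) 0 0 Et *m b + w *: (j%:R *: a) in
    (`|dsubmx r1| <= M -> `|dsubmx r2| <= M -> `|dsubmx a| <= C * M /\ `|dsubmx b| <= C * M) /\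
    (j != 1%N -> `|usubmx r1| <= M -> `|usubmx r2| <= M -> `|usubmx a| <= C * M /\ `|usubmx b| <= C * M).
Proof.
move=> w0 nEt.
have /choice[Ct HCt] : forall j : 'I_4, exists C, 0 <= C /\ forall (a b : 'cV[R]_k) M,
    `|Et *m a - (j%:R * w) *: b| <= M -> `|Et *m b + (j%:R * w) *: a| <= M -> `|a| <= C * M /\ `|b| <= C * M.
  move=> j; have [C C0 H] := block_inverse_bound (sqr_add_unitmx (j%:R * w) nEt).
  by exists C.
have /choice[Ch HCh] : forall j : 'I_4, exists C, 0 <= C /\ (j != 1%N :> nat -> forall (a b : 'cV[R]_2) M,
    `|rot2 0 w *m a - (j%:R * w) *: b| <= M -> `|rot2 0 w *m b + (j%:R * w) *: a| <= M -> `|a| <= C * M /\ `|b| <= C * M).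
  (* At the resonant index the implication is vacuous and 0 is a dummy constant. *)
  move=> j; have [j1|j1] := boolP (j != 1%N :> nat); last by exists 0.
  have j2 : (j%:R : R) ^+ 2 != 1.
    rewrite -natrX -[1](mulr1n 1) eqr_nat.
    by case: j j1 => [[|[|[|[|//]]]] ?].
  have [C C0 H] := block_inverse_bound (rot2_sqr_unitmx (lt0r_neq0 w0) j2).
  by exists C.
pose C := \sum_(j < 4) (Ct j + Ch j).
have CtC j M : 0 <= M -> Ct j * M <= C * M /\ Ch j * M <= C * M.
  move=> M0; have h : Ct j + Ch j <= C.
    rewrite /C (bigD1 j) //= lerDl; apply: sumr_ge0 => i _.
    by rewrite addr_ge0 //; [have [] := HCt i|have [] := HCh i].
  have [ct _] := HCt j; have [ch _] := HCh j.
  by split; apply: ler_wpM2r => //; lra.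
exists C => [|j a b M j4 r1 r2].
  by apply: sumr_ge0 => i _; rewrite addr_ge0 //; [have [] := HCt i|have [] := HCh i].
have sE m (x : 'cV[R]_m) : w *: (j%:R *: x) = (j%:R * w) *: x by rewrite scalerA mulrC.
split=> [|j1]; rewrite /r1 /r2 ![w *: (j%:R *: _)]sE.
- rewrite !raddfB !raddfD /= !dsubmx_block !linearZ /= ?scalerN => h1 h2.
  have M0 : 0 <= M by exact: le_trans h1.
  have [_ /(_ _ _ _ h1 h2)[ha hb]] := HCt (Ordinal j4); have [hC _] := CtC (Ordinal j4) _ M0.
  by split; [exact: le_trans ha hC|exact: le_trans hb hC].
- rewrite !raddfB !raddfD /= !usubmx_block !linearZ /= ?scalerN => h1 h2.
  have M0 : 0 <= M by exact: le_trans h1.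
  have [_ /(_ j1 _ _ _ h1 h2)[ha hb]] := HCh (Ordinal j4); have [_ hC] := CtC (Ordinal j4) _ M0.
  by split; [exact: le_trans ha hC|exact: le_trans hb hC].
Qed.

End BlockSplitting.

Section CircleIdentities.
Context {R : realType} {k : nat} (cf : nf_coefs R k) (l : R).
Local Notation n := (2 + k)%N.

Definition unit1 : 'cV[R]_n := col_mx (vec2 1 0) 0.
Definition unit2 : 'cV[R]_n := col_mx (vec2 0 1) 0.
Definition circle_a (j : nat) : 'cV[R]_n := if j == 1%N then unit1 else 0.
Definition circle_b (j : nat) : 'cV[R]_n := if j == 1%N then unit2 else 0.
(** On the unit circle the quadratic polynomials of the transformation become 1, [cos (2 * t)],
    [sin (2 * t)], and the cubic ones [cos t], [sin t], [cos (3 * t)], [sin (3 * t)]. The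
    coefficients of the transformation are thus themselves Fourier coefficients, indexed by
    harmonic. *)
Definition quad_a (j : nat) : 'cV[R]_n :=
  if j == 0%N then nf_a0 cf l else if j == 2%N then nf_a2 cf l else 0.
Definition quad_b (j : nat) : 'cV[R]_n := if j == 2%N then nf_b2 cf l else 0.
Definition cubic_a (j : nat) : 'cV[R]_2 :=
  if j == 1%N then nf_a1 cf l else if j == 3%N then nf_a3 cf l else 0.
Definition cubic_b (j : nat) : 'cV[R]_2 :=
  if j == 1%N then nf_b1 cf l else if j == 3%N then nf_b3 cf l else 0.
Definition circ (t : R) : 'cV[R]_2 := vec2 (cos t) (sin t).

Lemma tvec4 m (a b : nat -> 'cV[R]_m) t : tvec a b t =
  a 0%N + (cos t *: a 1%N + sin t *: b 1%N) + (cos (2 * t) *: a 2%N + sin (2 * t) *: b 2%N)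
  + (cos (3 * t) *: a 3%N + sin (3 * t) *: b 3%N).
Proof.
rewrite /tvec !big_ord_recl big_ord0 /= /bump /= !mul0r cos0 sin0 scale1r scale0r !addr0.
by rewrite !add1n mul1r !addrA.
Qed.

Lemma acirc_tvec t : acirc k t = tvec circle_a circle_b t.
Proof.
rewrite tvec4 /circle_a /circle_b /= !scaler0 !addr0 add0r /unit1 /unit2 /acirc.
rewrite !scale_col_mx add_col_mx !scaler0 addr0; congr col_mx.
by apply/colP => i; rewrite !mxE; case: ifP => _; ring.
Qed.

Lemma circ_norm_le1 t : `|circ t| <= 1.
Proof.
apply: mx_norm_le => // i j; rewrite mxE; case: ifP => _.
  by rewrite ler_norml cos_geN1 cos_le1.
by rewrite ler_norml sin_geN1 sin_le1.
Qed.

Lemma cos3 (t : R) : cos (3 * t) = cos t * (cos t ^+ 2 - 3 * sin t ^+ 2).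
Proof. by rewrite (_ : 3 * t = t + t + t) ?cosD ?sinD; ring. Qed.

Lemma sin3 (t : R) : sin (3 * t) = sin t * (3 * cos t ^+ 2 - sin t ^+ 2).
Proof. by rewrite (_ : 3 * t = t + t + t) ?sinD ?cosD ?sinD; ring. Qed.

Lemma cos2 (t : R) : cos (2 * t) = cos t ^+ 2 - sin t ^+ 2.
Proof. by rewrite (_ : 2 * t = t + t) ?cosD; ring. Qed.

Lemma sin2 (t : R) : sin (2 * t) = 2 * (sin t * cos t).
Proof. by rewrite (_ : 2 * t = t + t) ?sinD; ring. Qed.

Lemma quad_tvec t : nf_quad cf l (circ t) = tvec quad_a quad_b t.
Proof.
rewrite tvec4 /quad_a /quad_b /nf_quad /= !scaler0 !addr0 !mxE /=.
rewrite cos2Dsin2 scale1r -addrA; congr (_ + (_ *: _ + _ *: _)).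
  by rewrite cos2.
by rewrite sin2; ring.
Qed.

Lemma cubic_tvec t : nf_cubic cf l (circ t) = tvec cubic_a cubic_b t.
Proof.
rewrite tvec4 /cubic_a /cubic_b /nf_cubic /= !scaler0 !addr0 !mxE /=.
by rewrite cos2Dsin2 !mulr1 cos3 sin3 add0r -!addrA.
Qed.

(** The linear centre flow turns the circle with speed [w], so by the chain rule the derivative
    along [rot2 0 w *m circ t] is [w] times the time derivative. This produces the right-hand sides
    of the homological equations. *)
Lemma dquad_tvec (w : R) t :
  nf_dquad cf l (circ t) (rot2 0 w *m circ t) = w *: tvec (dcos quad_b) (dsin quad_a) t.
Proof.
apply/colP => i; rewrite rot2_mul_vec tvec4 /dcos /dsin /quad_a /quad_b /= !scaler0 !mxE /=.
by rewrite cos2 sin2; ring.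
Qed.

Lemma dcubic_tvec (w : R) t :
  nf_dcubic cf l (circ t) (rot2 0 w *m circ t) = w *: tvec (dcos cubic_b) (dsin cubic_a) t.
Proof.
apply/colP => i; rewrite rot2_mul_vec tvec4 /dcos /dsin /cubic_a /cubic_b /= !scaler0 !mxE /=.
rewrite cos3 sin3.
have /(congr1 (fun x => x - 1)) := cos2Dsin2 t; rewrite subrr => /eqP.
set c := cos t; set s := sin t; set a1 := nf_a1 _ _ _ _; set b1 := nf_b1 _ _ _ _.
set a3 := nf_a3 _ _ _ _; set b3 := nf_b3 _ _ _ _ => E.
have E0 : c ^+ 2 + s ^+ 2 - 1 = 0 by exact/eqP.
apply/eqP; rewrite -subr_eq0; apply/eqP.
(* The two sides agree on the unit circle only; this is the exact cofactor of the relation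
   [c^2 + s^2 = 1]. *)
transitivity (w * (c * b1 - s * a1) * (c ^+ 2 + s ^+ 2 - 1)); first ring.
by rewrite E0 mulr0.
Qed.

(** The sine coefficient of index 0 is meaningless and uncontrolled on the Galerkin side, so it is
    set to 0 here; the inversion of the modes relies on this value. *)
Lemma trig_orbit_tvec (a b : nat -> 'cV[R]_n) t : trig_orbit 3%N a b t =
  tvec (fun j => circle_a j + a j) (fun j => circle_b j + (if j == 0%N then 0 else b j)) t.
Proof.
rewrite -tvecD -acirc_tvec /trig_orbit -addrA; congr (_ + _).
rewrite tvec4 /= big_ltn // big_ltn // big_ltn // big_geq // addr0.
by rewrite mul1r !addrA.
Qed.

End CircleIdentities.

Lemma smooth_near_derivable {R : realType} (l0 : R) (f : R -> R) : smooth_near l0 f -> derivable f l0 1.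
Proof. by move=> [U [oU Ul0 /(_ 1%N)[_ /(_ 1)[+ _]]]]; apply. Qed.

Lemma continuous_cV {R : realType} {n} (w : R -> 'cV[R]_n) :
  (forall i, continuous (fun t => w t i 0)) -> continuous w.
Proof.
move=> cw t; apply/cvgrPdist_le => /= e e0.
have H : forall i : 'I_n, \forall s \near t, `|w t i 0 - w s i 0| <= e.
  by move=> i; have /cvgrPdist_le := cw i t; exact.
have {}H := @filter_forall R _ (fun i s => `|w t i 0 - w s i 0| <= e) (nbhs t) _ H.
apply: filterS (H _) => s Hs; apply: mx_norm_le => [|i j]; first exact: ltW.
by rewrite ord1 !mxE; exact: Hs.
Qed.

(** * Derivative of the block matrix and expansion of the field at the Hopf point *)

Section HopfData.
Context {R : realType} {k : nat}.
Local Notation n := (2 + k)%N.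
Variables (F : 'cV[R]_n -> R -> 'cV[R]_n) (xstar : 'cV[R]_n) (lstar wstar : R)
  (Pstar : 'M[R]_n) (Etstar : 'M[R]_k) (D : continuation R k).
Hypothesis F_smooth : smooth_on [set: 'cV[R]_n * R] (fun p => F p.1 p.2).
Hypothesis Hcont : hopf_continuation F xstar lstar wstar Pstar Etstar D.

Definition Edot : 'M[R]_n := \matrix_(i, j) derive1 (fun l => Emat D l i j) lstar.

Lemma Emat_lstar : Emat D lstar = block_mx (rot2 0 wstar) 0 0 Etstar.
Proof. by case: Hcont => _ []. Qed.

Lemma Ehat_lstar : Ehat D lstar = rot2 0 wstar.
Proof. by have := congr1 ulsubmx Emat_lstar; rewrite !block_mxKul. Qed.

Lemma Edot_hat (yh : 'cV[R]_2) : Edot *m col_mx yh 0 =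
  col_mx (rot2 (derive1 (alphaR D) lstar) (derive1 (alphaI D) lstar) *m yh) 0.
Proof.
have E (r : 'I_2) (s : 'I_2) : Edot (lshift k r) (lshift k s) =
    rot2 (derive1 (alphaR D) lstar) (derive1 (alphaI D) lstar) r s.
  (* Smoothness is assumed of the whole matrix; [alphaI] inherits it as one of its entries, so that
     [- alphaI] can be differentiated. *)
  have sE : smooth_near lstar (fun l => Emat D l (lshift k 1) (lshift k 0)).
    by apply: smooth_near_entry; case: Hcont => -[].
  have dI : derivable (alphaI D) lstar 1.
    have Ef : (fun l => Emat D l (lshift k 1) (lshift k 0)) = alphaI D.
      by apply/funext => l; rewrite block_mxEul mxE.
    by rewrite -Ef; exact: smooth_near_derivable sE.
  have dE : (fun l => Emat D l (lshift k r) (lshift k s)) =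
     fun l => if r == s then alphaR D l else if r == 0 then - alphaI D l else alphaI D l.
    by apply/funext => l; rewrite block_mxEul mxE.
  rewrite mxE dE mxE; case: (r == s) => //; case: (r == 0) => //.
  by rewrite !derive1E deriveN.
have E' (r : 'I_k) (s : 'I_2) : Edot (rshift 2 r) (lshift k s) = 0.
  rewrite mxE; under eq_fun do rewrite block_mxEdl mxE.
  exact: derive1_cst.
apply/colP => i; rewrite mxE big_split_ord /= [X in _ + X]big1 ?addr0; last first.
  by move=> s _; rewrite col_mxEd [X in _ * X]mxE mulr0.
case: (splitP i) => r ir.
  have -> : i = lshift k r by exact/val_inj.
  by rewrite col_mxEu mxE; apply: eq_bigr => s _; rewrite col_mxEu E.
have -> : i = rshift 2 r by exact/val_inj.
by rewrite col_mxEd mxE big1 // => s _; rewrite E' mul0r.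
Qed.

Lemma Emat_taylor : exists2 C, 0 <= C & \forall l \near lstar,
  `|Emat D l - Emat D lstar - (l - lstar) *: Edot| <= C * (l - lstar) ^+ 2.
Proof.
have sE : smooth_near lstar (Emat D) by case: Hcont => -[].
have /choice[C CP] : forall ij : 'I_n * 'I_n, exists C, 0 <= C /\
    \forall l \near lstar, `|Emat D l ij.1 ij.2 - Emat D lstar ij.1 ij.2
       - (l - lstar) * derive1 (fun l => Emat D l ij.1 ij.2) lstar| <= C * (l - lstar) ^+ 2.
  by move=> [i j]; have [C] := taylor1 (smooth_near_entry i j sE); exists C.
have S0 : 0 <= \sum_ij C ij by apply: sumr_ge0 => ij _; have [] := CP ij.
exists (\sum_ij C ij) => //.
have H := @filter_forall R _ (fun (ij : 'I_n * 'I_n) l => `|Emat D l ij.1 ij.2 - Emat D lstar ij.1 ij.2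
       - (l - lstar) * derive1 (fun l => Emat D l ij.1 ij.2) lstar| <= C ij * (l - lstar) ^+ 2)
   (nbhs lstar) _ (fun ij => proj2 (CP ij)).
apply: filterS (H _) => l Hl; apply: mx_norm_le => [|i j]; first by rewrite mulr_ge0 // sqr_ge0.
have -> : (Emat D l - Emat D lstar - (l - lstar) *: Edot) i j = Emat D l i j - Emat D lstar i j
    - (l - lstar) * derive1 (fun l => Emat D l i j) lstar.
  have key (A B M : 'M[R]_n) x : (A - B - x *: M) i j = A i j - B i j - x * M i j by rewrite !mxE.
  by rewrite key; congr (_ - _ * _); rewrite mxE.
rewrite (le_trans (Hl (i, j))) // ler_wpM2r ?sqr_ge0 //.
by rewrite (bigD1 (i, j)) //= lerDl; apply: sumr_ge0 => ij _; have [] := CP ij.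
Qed.

Lemma Gfield_expansion : exists2 beta : 'I_n -> R -> seq 'I_n -> R,
    forall c r, lip_at lstar (fun l => beta c l r) &
    exists C d, [/\ 0 <= C, 0 < d & forall z l e c, `|z| <= 3 -> `|l - lstar| < d -> 0 < `|e| < d ->
      `|Gfield F D z l e c 0 -
        ((Emat D l *m z) c 0 + e * ml [:: z; z] (beta c l) + e ^+ 2 * ml [:: z; z; z] (beta c l) +
         e ^+ 3 * ml [:: z; z; z; z] (beta c l))| <= C * `|e| ^+ 4].
Proof.
have [[sx sP sE] [x0 P0 E0] H] := Hcont.
have [||beta lb [C [d [C0 d0 G]]]] := @rescaled_field_expansion R n F lstar (xcurve D) (frame D) (Emat D) F_smooth _ _ H.
- by move=> i; apply: smooth_near_lip; exact: smooth_near_entry.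
- by move=> i j; apply: smooth_near_lip; exact: smooth_near_entry.
exists beta => //; exists C, d; split=> // z l e c z3 ld ed.
rewrite /Gfield; case: eqP => [e0|_]; last exact: G.
by move: ed; rewrite e0 normr0 ltxx.
Qed.

Lemma Gfield_continuous (z : R -> 'cV[R]_n) (l e : R) c : e != 0 ->
  (forall i, continuous (fun t => z t i 0)) -> continuous (fun t => Gfield F D (z t) l e c 0).
Proof.
move=> /negbTE e0 cz; rewrite /Gfield e0.
pose f j (p : 'cV[R]_n * R) := F p.1 p.2 j 0.
have cf j : continuous (f j).
  by apply: smooth_continuous; exact: (@smooth_on_entry _ _ _ _ _ _ j 0 openT F_smooth).
pose w t := xcurve D l + e *: (frame D l *m z t).
have cw : continuous w.
  apply: continuous_cV => i.
  have -> : (fun t => w t i 0) = (fun t => xcurve D l i 0 + e * \sum_j frame D l i j * z t j 0).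
    by apply/funext => t; rewrite !mxE.
  apply: continuousDf; first exact: cst_continuous.
  apply: continuousMf; first exact: cst_continuous.
  by apply: continuous_sum_fct => j; apply: continuousMf; [exact: cst_continuous|exact: cz].
have -> : (fun t => (e^-1 *: (invmx (frame D l) *m F (xcurve D l + e *: (frame D l *m z t)) l)) c 0) =
   (fun t => e^-1 * \sum_j invmx (frame D l) c j * f j (w t, l)).
  by apply/funext => t; rewrite !mxE.
apply: continuousMf; first exact: cst_continuous.
apply: continuous_sum_fct => j; apply: continuousMf; first exact: cst_continuous.
move=> t; apply: (@continuous_comp _ _ _ (fun t => (w t, l)) (f j)); last exact: cf.
apply/cvgrPdist_le => /= r r0; have /cvgrPdist_le /(_ r r0) := cw t.
by apply: filterS => s; rewrite prod_normE /= subrr normr0 ge_max => ->; rewrite ltW.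
Qed.

End HopfData.

(** * The Galerkin solution *)

Lemma bigO_uniform {R : realType} {I : Type} (P : I -> Prop) (rho : I -> R) (J : finType) p (f : J -> I -> R) :
  (forall i, P i -> 0 <= rho i) -> (forall c, bigO P rho p (f c)) ->
  exists2 C, 0 <= C & forall c i, P i -> `|f c i| <= C * rho i ^+ p.
Proof.
move=> rho0 H; have /choice[C CP] : forall c, exists C, 0 <= C /\ forall i, P i -> `|f c i| <= C * rho i ^+ p.
  by move=> c; have [C] := H c; exists C.
exists (\sum_c C c) => [|c i Pi]; first by apply: sumr_ge0 => c _; have [] := CP c.
rewrite (le_trans (proj2 (CP c) i Pi)) // ler_wpM2r ?exprn_ge0 ?rho0 //.
by rewrite (bigD1 c) //= lerDl; apply: sumr_ge0 => c' _; have [] := CP c'.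
Qed.

Section Stages.
Context {R : realType} {k : nat}.
Local Notation n := (2 + k)%N.
Variables (F : 'cV[R]_n -> R -> 'cV[R]_n) (xstar : 'cV[R]_n) (lstar wstar : R)
  (Pstar : 'M[R]_n) (Etstar : 'M[R]_k) (D : continuation R k)
  (cf : nf_coefs R k) (bR bI : R)
  (lF wF : R -> R) (aF bF : nat -> R -> 'cV[R]_n).
Hypothesis F_smooth : smooth_on [set: 'cV[R]_n * R] (fun p => F p.1 p.2).
Hypothesis Hhopf : hopf_point F xstar lstar wstar Pstar Etstar.
Hypothesis Hcont : hopf_continuation F xstar lstar wstar Pstar Etstar D.
Hypothesis Htrans : derive1 (alphaR D) lstar != 0.
Hypothesis Hnf : nf_conditions F D cf lstar bR bI.
Hypothesis Hgal : galerkin_branch F D 3%N lstar wstar lF wF aF bF.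

Local Notation A := (Emat D lstar).
Local Notation ya := (@circle_a R k).
Local Notation yb := (@circle_b R k).
Local Notation qa := (quad_a cf lstar).
Local Notation qb := (quad_b cf lstar).
Local Notation ka := (cubic_a cf lstar).
Local Notation kb := (cubic_b cf lstar).
Local Notation aR' := (derive1 (alphaR D) lstar).
Local Notation aI' := (derive1 (alphaI D) lstar).

Let w0 : 0 < wstar. Proof. by case: Hhopf. Qed.
Let AE : A = block_mx (rot2 0 wstar) 0 0 Etstar. Proof. exact: Emat_lstar Hcont. Qed.

(* Deviation of the Galerkin coefficients from acirc + e q, where q is the
   quadratic part of the normal form transformation on the unit circle. *)
Definition defect_a e j := aF j e - e *: qa j.
Definition defect_b e j := (if j == 0%N then 0 else bF j e) - e *: qb j.
Definition defect e := `|lF e - lstar| + `|wF e - wstar| + \sum_(j < 4) (`|defect_a e j| + `|defect_b e j|).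
Definition coef_a e j := ya j + (e *: qa j + defect_a e j).
Definition coef_b e j := yb j + (e *: qb j + defect_b e j).
Definition orbit e t := tvec (coef_a e) (coef_b e) t.

Lemma orbitE e t : orbit e t = tvec ya yb t + (e *: tvec qa qb t + tvec (defect_a e) (defect_b e) t).
Proof. by rewrite tvecZ !tvecD. Qed.

Lemma trig_orbitE e t : trig_orbit 3%N (aF^~ e) (bF^~ e) t = orbit e t.
Proof.
rewrite trig_orbit_tvec; apply: eq_bigr => j _.
by rewrite /coef_a /coef_b /defect_a /defect_b ![e *: _ + _]addrC !subrK.
Qed.

Definition residual e c t :=
  Gfield F D (orbit e t) (lF e) e c 0 - wF e * tvec (dcos (coef_b e)) (dsin (coef_a e)) t c 0.

Lemma tvec_entry_continuous m (a b : nat -> 'cV[R]_m) i : continuous (fun t => tvec a b t i 0).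
Proof.
rewrite (_ : (fun t => _) = trigpoly 4 (fun j => a j i 0) (fun j => b j i 0)).
  exact: continuous_trigpoly.
by apply/funext => t; exact: tvec_entry.
Qed.

Lemma residual_continuous e c : e != 0 -> continuous (residual e c).
Proof.
move=> e0; have cG : continuous (fun t => Gfield F D (orbit e t) (lF e) e c 0).
  by apply: Gfield_continuous => // i; exact: tvec_entry_continuous.
move=> t; apply: cvgB; first exact: cG.
by apply: cvgM; [exact: cvg_cst|exact: tvec_entry_continuous].
Qed.

Lemma residual_period e c t : residual e c (t + 2 * pi) = residual e c t.
Proof. by rewrite /residual /orbit !tvec_period. Qed.

Lemma defect_small r : 0 < r -> exists2 d, 0 < d & forall e, `|e| < d -> defect e < r.
Proof.
move=> r0; have [near0 _] := Hgal.
pose S : R := \sum_(j < 4) (`|qa j| + `|qb j|).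
have S0 : 0 <= S by apply: sumr_ge0 => j _; rewrite addr_ge0.
(* Ten quantities, the two scalars and eight coefficients, contribute at most [r / 20] each, and the
   subtracted [e *: q] at most [r / 4] in total: altogether [3 r / 4]. *)
have r20 : 0 < r / 20 by rewrite divr_gt0.
have /nbhs_ballP[d1 /= d10 H] := near0 _ r20.
have rS : 0 < r / (4 * (S + 1)) by rewrite divr_gt0 // mulr_gt0 // ltr_wpDl.
exists (Num.min d1 (r / (4 * (S + 1)))); first by rewrite lt_min d10.
move=> e; rewrite lt_min => /andP[ed1 eS].
have [|hl hw ha hb] := H e; first by rewrite -ball_normE /= sub0r normrN.
have eS' : `|e| * S <= r / 4.
  move: eS; rewrite ltr_pdivlMr ?mulr_gt0 ?ltr_wpDl // => h.
  have := normr_ge0 e; nra.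
have hs : \sum_(j < 4) (`|defect_a e j| + `|defect_b e j|) <= \sum_(j < 4) (r / 20 + r / 20 + `|e| * (`|qa j| + `|qb j|)).
  apply: ler_sum => j _.
  have h1 : `|defect_a e j| <= r / 20 + `|e| * `|qa j|.
    rewrite (le_trans (ler_normB _ _)) // normrZ lerD2r; apply/ltW/ha.
    by rewrite -ltnS.
  have h2 : `|defect_b e j| <= r / 20 + `|e| * `|qb j|.
    rewrite (le_trans (ler_normB _ _)) // normrZ lerD2r; case: eqP => [_|/eqP j0].
      by rewrite normr0 ltW.
    by apply/ltW/hb; rewrite lt0n j0 -ltnS ltn_ord.
  lra.
have hs' : \sum_(j < 4) (r / 20 + r / 20 + `|e| * (`|qa j| + `|qb j|)) = 8 * (r / 20) + `|e| * S.
  rewrite /S mulr_sumr big_split /= sumr_const card_ord; congr (_ + _).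
  by rewrite -mulr_natl; ring.
rewrite /defect; lra.
Qed.

(** The products with [acirc] and [dacirc] see the first harmonic only. The circle itself already
    has the prescribed [gamma], and the quadratic part has no first harmonic, so the constraints
    fall entirely on the defect. *)
Lemma residual_means : exists2 d, 0 < d & forall e, 0 < `|e| < d ->
  (forall c (j : nat), (j < 4)%N ->
    mean (fun t => cos (j%:R * t) * residual e c t) = 0 /\
    mean (fun t => sin (j%:R * t) * residual e c t) = 0) /\
  (usubmx (defect_a e 1%N) 0 0 + usubmx (defect_b e 1%N) 1 0 = 0 /\
   usubmx (defect_a e 1%N) 1 0 - usubmx (defect_b e 1%N) 0 0 = 0).
Proof.
have [_ [d' _ /nbhs_ballP[d /= d0 H]]] := Hgal.
exists d => // e /andP[e0 ed].
have en0 : e != 0 by rewrite -normr_gt0.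
have [|[Heq Hgam] _] := H e; first by rewrite -ball_normE /= sub0r normrN.
have toE : trig_orbit 3%N (aF^~ e) (bF^~ e) = orbit e by apply/funext => t; exact: trig_orbitE.
rewrite toE in Heq Hgam.
split=> [c j j4|].
- have := @fourier_trunc_coefs R n 3 (fun s => Gfield F D (orbit e s) (lF e) e)
     (fun t => wF e *: derive1 (orbit e) t) _ _ _ c j j4.
  have E t : Gfield F D (orbit e t) (lF e) e c 0 - (wF e *: derive1 (orbit e) t) c 0 = residual e c t.
    by rewrite /residual mxE derive1_tvec.
  under [X in _ -> _ -> _ -> mean X = 0 /\ _]eq_fun do rewrite E.
  under [X in _ -> _ -> _ -> _ /\ mean X = 0]eq_fun do rewrite E.
  apply.
  + by move=> i; apply: Gfield_continuous => // i'; exact: tvec_entry_continuous.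
  + move=> i; under eq_fun do rewrite mxE derive1_tvec.
    by apply: continuousMf; [exact: cst_continuous|exact: tvec_entry_continuous].
  + by move=> t; apply: subr0_eq; exact: Heq.
- have tp i : (fun t => orbit e t i 0) = trigpoly 4 (fun j => coef_a e j i 0) (fun j => coef_b e j i 0).
    by apply/funext => t; exact: tvec_entry.
  have ct i : continuous (fun t => orbit e t i 0) by exact: tvec_entry_continuous.
  have mc i : mean (fun t => cos (1%:R * t) * orbit e t i 0) = 2^-1 * coef_a e 1%N i 0.
    by under eq_fun do rewrite (congr1 (fun f => f _) (tp i)); rewrite mean_cos_trigpoly.
  have ms i : mean (fun t => sin (1%:R * t) * orbit e t i 0) = 2^-1 * coef_b e 1%N i 0.
    by under eq_fun do rewrite (congr1 (fun f => f _) (tp i)); rewrite mean_sin_trigpoly.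
  have cc i : continuous (fun t : R => cos (1%:R * t) * orbit e t i 0).
    exact: continuousMf (@continuous_cosM _ _) (ct i).
  have cs i : continuous (fun t : R => sin (1%:R * t) * orbit e t i 0).
    exact: continuousMf (@continuous_sinM _ _) (ct i).
  have dE u v t : dot (orbit e t) (col_mx (vec2 u v) 0) = u * orbit e t (lshift k 0) 0 + v * orbit e t (lshift k 1) 0.
    rewrite /dot big_split_ord /= sum_ord2 !col_mxEu !mxE /= [X in _ + X]big1 ?addr0; last first.
      by move=> i _; rewrite col_mxEd [X in _ * X]mxE mulr0.
    by rewrite ![_ * u]mulrC ![_ * v]mulrC.
  have g0 : inner (orbit e) (@acirc R k) = 2^-1 * coef_a e 1%N (lshift k 0) 0 + 2^-1 * coef_b e 1%N (lshift k 1) 0.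
    rewrite -mc -ms -meanD //; congr mean; apply/funext => t.
    by rewrite /acirc dE mul1r.
  have g1 : inner (orbit e) (@dacirc R k) = 2^-1 * coef_a e 1%N (lshift k 1) 0 - 2^-1 * coef_b e 1%N (lshift k 0) 0.
    rewrite -mc -ms -meanB //; congr mean; apply/funext => t.
    by rewrite /dacirc dE mul1r; ring.
  have := congr1 (fun v : 'cV[R]_2 => v 0 0) Hgam; have := congr1 (fun v : 'cV[R]_2 => v 1 0) Hgam.
  rewrite /gamma ![vec2 _ _ _ _]mxE /= g0 g1 /coef_a /coef_b /quad_a /quad_b /circle_a /circle_b /= !scaler0 !add0r.
  rewrite /unit1 /unit2 ![(col_mx _ _ + _) _ _]mxE !col_mxEu ![vec2 _ _ _ _]mxE /= ![usubmx _ _ _]mxE => h1 h2.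
  split; lra.
Qed.

Lemma acirc_col t : tvec ya yb t = col_mx (circ t) 0.
Proof. by rewrite -acirc_tvec. Qed.

Lemma tvec_circle_le1 t : `|tvec ya yb t| <= 1.
Proof.
rewrite acirc_col; apply: norm_le_parts; first by rewrite col_mxKu circ_norm_le1.
by rewrite col_mxKd normr0.
Qed.

(* Fourier coefficients of the linearisation A z - wstar z' at the circle, with
   the first harmonic forced by the shifts of growth rate (s1) and frequency (s2). *)
Definition linear_a (x y : nat -> 'cV[R]_n) (s1 s2 : R) (j : nat) : 'cV[R]_n :=
  A *m x j - wstar *: dcos y j + (if j == 1%N then col_mx (vec2 s1 s2) 0 else 0).
Definition linear_b (x y : nat -> 'cV[R]_n) (s1 s2 : R) (j : nat) : 'cV[R]_n :=
  A *m y j - wstar *: dsin x j + (if j == 1%N then col_mx (vec2 (- s2) s1) 0 else 0).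

Lemma linear_tvec x y s1 s2 t : tvec (linear_a x y s1 s2) (linear_b x y s1 s2) t =
  A *m tvec x y t - wstar *: tvec (dcos y) (dsin x) t + col_mx (rot2 s1 s2 *m circ t) 0.
Proof.
rewrite mul_tvec tvecZ tvecB.
have -> : col_mx (rot2 s1 s2 *m circ t) 0 =
  tvec (fun j => if j == 1%N then col_mx (vec2 s1 s2) 0 else 0 : 'cV[R]_n)
       (fun j => if j == 1%N then col_mx (vec2 (- s2) s1) 0 else 0) t.
  rewrite tvec4 /= !scaler0 !addr0 add0r !scale_col_mx add_col_mx !scaler0 addr0.
  congr col_mx; rewrite rot2_mul_vec; apply/colP => i; rewrite !mxE /=.
  by case: ifP => _; ring.
by rewrite tvecD.
Qed.

Lemma dtvecD (a b a' b' : nat -> 'cV[R]_n) t :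
  tvec (dcos (fun j => b j + b' j)) (dsin (fun j => a j + a' j)) t =
  tvec (dcos b) (dsin a) t + tvec (dcos b') (dsin a') t.
Proof. by rewrite tvecD; apply: eq_bigr => j _; rewrite /dcos /dsin ![j%:R *: (_ + _)]scalerDr opprD. Qed.

Lemma dtvecZ (x : R) (a b : nat -> 'cV[R]_n) t :
  tvec (dcos (fun j => x *: b j)) (dsin (fun j => x *: a j)) t = x *: tvec (dcos b) (dsin a) t.
Proof.
by rewrite tvecZ; apply: eq_bigr => j _; rewrite /dcos /dsin; apply/colP => i; rewrite !mxE; ring.
Qed.

Lemma dtvec_le (a b : nat -> 'cV[R]_n) t :
  `|tvec (dcos b) (dsin a) t| <= 3 * \sum_(j < 4) (`|a j| + `|b j|).
Proof.
rewrite (le_trans (tvec_le _ _ _)) // mulr_sumr; apply: ler_sum => j _.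
have j3 : (j%:R : R) <= 3 by rewrite ler_nat -ltnS.
rewrite /dcos /dsin normrN !normrZ normr_nat addrC -mulrDr ler_wpM2r ?addr_ge0 //.
Qed.

Lemma circle_derive t : A *m tvec ya yb t = wstar *: tvec (dcos yb) (dsin ya) t.
Proof.
rewrite AE acirc_col mul_block_col !mul0mx mulmx0 !addr0 tvec4 /dcos /dsin /circle_a /circle_b /=.
rewrite !scaler0 !oppr0 !scale1r !scaler0 !addr0 add0r /unit1 /unit2 opp_col_mx oppr0 !scale_col_mx.
rewrite add_col_mx !scaler0 addr0 scale_col_mx scaler0; congr col_mx.
by rewrite rot2_mul_vec; apply/colP => i; rewrite !mxE /=; case: ifP => _; ring.
Qed.

Lemma dcircle t : tvec (dcos yb) (dsin ya) t = col_mx (rot2 0 1 *m circ t) 0.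
Proof.
rewrite tvec4 /dcos /dsin /circle_a /circle_b /=.
rewrite !scaler0 !oppr0 !scale1r !scaler0 !addr0 add0r /unit1 /unit2 opp_col_mx oppr0 !scale_col_mx.
rewrite add_col_mx !scaler0 addr0; congr col_mx.
by rewrite rot2_mul_vec; apply/colP => i; rewrite !mxE /=; case: ifP => _; ring.
Qed.

Variables (beta : 'I_n -> R -> seq 'I_n -> R) (Cb CE Cg d0 : R).
Hypotheses (Cb0 : 0 <= Cb) (CE0 : 0 <= CE) (Cg0 : 0 <= Cg) (d00 : 0 < d0).
Hypothesis E_taylor : forall l, `|l - lstar| < d0 ->
  `|Emat D l - A - (l - lstar) *: Edot lstar D| <= CE * (l - lstar) ^+ 2.
Hypothesis beta_le : forall l c p r, `|l - lstar| < d0 -> (p <= 4)%N -> size r = p ->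
  `|beta c l r| <= Cb /\ `|beta c l r - beta c lstar r| <= Cb * `|l - lstar|.
Hypothesis G_exp : forall z l e c, `|z| <= 3 -> `|l - lstar| < d0 -> 0 < `|e| < d0 ->
  `|Gfield F D z l e c 0 - ((Emat D l *m z) c 0 + e * ml [:: z; z] (beta c l)
     + e ^+ 2 * ml [:: z; z; z] (beta c l) + e ^+ 3 * ml [:: z; z; z; z] (beta c l))| <= Cg * `|e| ^+ 4.
Hypothesis means : forall e, 0 < `|e| < d0 ->
  (forall c (j : nat), (j < 4)%N ->
    mean (fun t => cos (j%:R * t) * residual e c t) = 0 /\
    mean (fun t => sin (j%:R * t) * residual e c t) = 0) /\
  (usubmx (defect_a e 1%N) 0 0 + usubmx (defect_b e 1%N) 1 0 = 0 /\
   usubmx (defect_a e 1%N) 1 0 - usubmx (defect_b e 1%N) 0 0 = 0).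

Lemma homological_circle t :
  (forall c, (A *m tvec qa qb t) c 0 + ml [:: tvec ya yb t; tvec ya yb t] (beta c lstar) =
     (wstar *: tvec (dcos qb) (dsin qa) t) c 0) /\
  (forall i, (A *m col_mx (tvec ka kb t) 0) (lshift k i) 0
      + ml [:: tvec ya yb t; tvec qa qb t] (beta (lshift k i) lstar)
      + ml [:: tvec qa qb t; tvec ya yb t] (beta (lshift k i) lstar)
      + ml [:: tvec ya yb t; tvec ya yb t; tvec ya yb t] (beta (lshift k i) lstar) =
     (wstar *: tvec (dcos kb) (dsin ka) t + rot2 bR bI *m circ t) i 0).
Proof.
have [] := nf_homological (beta := fun c => beta c lstar) (C := Cg) d00 _ Hnf (circ_norm_le1 t).
  by move=> z e c z3 ed; apply: G_exp => //; rewrite subrr normr0.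
rewrite (Ehat_lstar Hcont) dquad_tvec dcubic_tvec quad_tvec cubic_tvec -acirc_col.
by rewrite [circ t 0 0]mxE [circ t 1 0]mxE /= cos2Dsin2 scale1r; split.
Qed.

Lemma shift_means e c (j : nat) : 0 < `|e| < d0 -> (j < 4)%N ->
  mean (fun t => cos (j%:R * t) * residual e c (t + pi)) = 0 /\
  mean (fun t => sin (j%:R * t) * residual e c (t + pi)) = 0.
Proof.
move=> ed j4; have [H _] := means ed; have [hc hs] := H c j j4.
have e0 : e != 0 by case/andP: ed; rewrite normr_gt0.
have cr := @residual_continuous e c e0.
have sg : ((-1) ^+ j * (-1) ^+ j : R) = 1 by rewrite -expr2 sqrr_sign.
(* With the test function also written at [t + pi], the integrand is a sign times the shift of a
   periodic function, to which [mean_shift] applies. *)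
have cjt (t : R) : cos (j%:R * t) = (-1) ^+ j * cos (j%:R * (t + pi)).
  by rewrite mulrDr cosDnpi mulrA sg mul1r.
have sjt (t : R) : sin (j%:R * t) = (-1) ^+ j * sin (j%:R * (t + pi)).
  by rewrite mulrDr sinDnpi mulrA sg mul1r.
have cc : continuous (fun t : R => cos (j%:R * t) * residual e c t).
  exact: continuousMf (@continuous_cosM _ _) cr.
have cs : continuous (fun t : R => sin (j%:R * t) * residual e c t).
  exact: continuousMf (@continuous_sinM _ _) cr.
have j2 (t : R) : j%:R * (t + 2 * pi) = j%:R * t + (2 * j)%:R * pi by rewrite natrM; ring.
have s2 : (-1) ^+ (2 * j) = 1 :> R by rewrite exprM sqrrN expr1n expr1n.
have shiftc : continuous (fun t : R => t + pi) by move=> t; apply: cvgD; [exact: cvg_id|exact: cvg_cst].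
have key (g : R -> R) : continuous g -> (forall t, g (t + 2 * pi) = g t) -> mean g = 0 ->
    mean (fun t => (-1) ^+ j * g (t + pi)) = 0.
  move=> cg pg g0; rewrite meanZ ?(mean_shift pi cg pg) ?g0 ?mulr0 //.
  by move=> t; apply: (@continuous_comp _ _ _ (fun t : R => t + pi) g); [exact: shiftc|exact: cg].
split.
- under eq_fun do rewrite cjt -mulrA.
  by apply: key cc _ hc => t; rewrite residual_period j2 cosDnpi s2 mul1r.
- under eq_fun do rewrite sjt -mulrA.
  by apply: key cs _ hs => t; rewrite residual_period j2 sinDnpi s2 mul1r.
Qed.

(** The weights cover three uses: 1 and 0 give the residual itself, two halves its even part, and
    opposite halves its odd part under the half-period shift. *)
Lemma residual_coefs e (p q : R) (al be : nat -> 'cV[R]_n) (M : R) c :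
  0 < `|e| < d0 ->
  (forall t, `|p * residual e c t + q * residual e c (t + pi) - tvec al be t c 0| <= M) ->
  forall j, (j < 4)%N -> `|al j c 0| <= 2 * M /\ (j != 0%N -> `|be j c 0| <= 2 * M).
Proof.
move=> ed H j j4; have e0 : e != 0 by case/andP: ed; rewrite normr_gt0.
have cr := @residual_continuous e c e0.
have cr' : continuous (fun t => residual e c (t + pi)).
  move=> t; apply: (@continuous_comp _ _ _ (fun t : R => t + pi) (residual e c)); last exact: cr.
  by apply: cvgD; [exact: cvg_id|exact: cvg_cst].
pose f t := p * residual e c t + q * residual e c (t + pi).
have [[hc hs] [hc' hs']] := (proj1 (means ed) c j j4, shift_means c ed j4).
have key (g : R -> R) : continuous g -> mean (fun t => g t * residual e c t) = 0 ->
    mean (fun t => g t * residual e c (t + pi)) = 0 -> mean (fun t => g t * f t) = 0.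
  move=> cg m1 m2; have -> : (fun t => g t * f t) =
     fun t => p * (g t * residual e c t) + q * (g t * residual e c (t + pi)).
    by apply/funext => t; rewrite /f; ring.
  have c1 := continuousMf cg cr; have c2 := continuousMf cg cr'.
  rewrite meanD ?meanZ ?m1 ?m2 ?mulr0 ?addr0 //.
  - exact: continuousMf (@cst_continuous _ _ p) c1.
  - exact: continuousMf (@cst_continuous _ _ q) c2.
apply: (@trigpoly_coef_bound R f (fun j => al j c 0) (fun j => be j c 0)) => //.
- by apply: continuousDf; apply: continuousMf => //; exact: cst_continuous.
- by move=> t; rewrite -tvec_entry; exact: H.
- exact: key (@continuous_cosM _ _) hc hc'.
- exact: key (@continuous_sinM _ _) hs hs'.
Qed.

(** Centre and hyperbolic components decouple and are bounded separately, because at second order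
    only the centre rows of the residual are known. *)
Lemma modes_solver : exists2 C, 0 <= C & forall (x y : nat -> 'cV[R]_n) s1 s2 M, 0 <= M -> y 0%N = 0 ->
  usubmx (x 1%N) 0 0 + usubmx (y 1%N) 1 0 = 0 -> usubmx (x 1%N) 1 0 - usubmx (y 1%N) 0 0 = 0 ->
  ((forall j, (j < 4)%N -> `|usubmx (linear_a x y s1 s2 j)| <= M /\ (j != 0%N -> `|usubmx (linear_b x y s1 s2 j)| <= M)) ->
   [/\ forall j, (j < 4)%N -> `|usubmx (x j)| <= C * M /\ `|usubmx (y j)| <= C * M,
      `|s1| <= C * M & `|s2| <= C * M]) /\
  ((forall j, (j < 4)%N -> `|dsubmx (linear_a x y s1 s2 j)| <= M /\ (j != 0%N -> `|dsubmx (linear_b x y s1 s2 j)| <= M)) ->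
   forall j, (j < 4)%N -> `|dsubmx (x j)| <= C * M /\ `|dsubmx (y j)| <= C * M).
Proof.
have nEt : no_imaginary_eigenvalue Etstar by case: Hhopf.
have [C1 C10 H1] := block_modes_bound w0 nEt; have [C2 C20 H2] := resonant_block_bound w0.
exists (C1 + C2) => [|x y s1 s2 M M0 y0 g1 g2]; first exact: addr_ge0.
have l1 : C1 * M <= (C1 + C2) * M by apply: ler_wpM2r => //; lra.
have l2 : C2 * M <= (C1 + C2) * M by apply: ler_wpM2r => //; lra.
(* There is no sine equation at harmonic 0; the value 0 of the sine coefficient makes it hold
   trivially. *)
have b0 j : j = 0%N -> block_mx (rot2 0 wstar) 0 0 Etstar *m y j + wstar *: (j%:R *: x j) = 0.
  by move=> ->; rewrite y0 mulmx0 scale0r scaler0 addr0.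
split=> H.
- have Hj j : (j < 4)%N -> j != 1%N -> `|usubmx (x j)| <= (C1 + C2) * M /\ `|usubmx (y j)| <= (C1 + C2) * M.
    move=> j4 j1; have [ha hb] := H j j4.
    have [||h1 h2] := (proj2 (H1 j (x j) (y j) M j4)) j1; last by split; exact: le_trans l1.
    + by move: ha; rewrite /linear_a (negbTE j1) addr0 AE.
    + have [j0|j0] := eqVneq j 0%N.
        by rewrite b0 // raddf0 normr0.
      by move: (hb j0); rewrite /linear_b (negbTE j1) addr0 AE /dsin scalerN opprK.
  have [ha /(_ isT) hb] := H 1%N isT.
  have [||h1 h2 h3 h4] := H2 (usubmx (x 1%N)) (usubmx (y 1%N)) s1 s2 M g1 g2.
  + by move: ha; rewrite /linear_a /= AE raddfD raddfB /= usubmx_block linearZ /= col_mxKu /dcos scale1r.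
  + by move: hb; rewrite /linear_b /= AE raddfD raddfB /= usubmx_block linearZ /= col_mxKu /dsin scale1r raddfN /= scalerN opprK.
  split; [|exact: le_trans l2|exact: le_trans l2].
  move=> j j4; have [->|j1] := eqVneq j 1%N; last exact: Hj.
  by split; exact: le_trans l2.
- move=> j j4; have [ha hb] := H j j4.
  have ext (u : 'cV[R]_n) v : dsubmx (u + (if j == 1%N then col_mx v 0 else 0)) = dsubmx u.
    by case: ifP => _; rewrite ?addr0 // raddfD /= col_mxKd addr0.
  have [||h1 h2] := (proj1 (H1 j (x j) (y j) M j4)); last by split; exact: le_trans l1.
  + by move: ha; rewrite /linear_a ext AE.
  + have [j0|j0] := eqVneq j 0%N.
      by rewrite b0 // raddf0 normr0.
    by move: (hb j0); rewrite /linear_b ext AE /dsin scalerN opprK.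
Qed.

Lemma residual_solver : exists2 C, 0 <= C & forall e (p q : R) (x y : nat -> 'cV[R]_n) s1 s2 M,
  0 < `|e| < d0 -> y 0%N = 0 ->
  usubmx (x 1%N) 0 0 + usubmx (y 1%N) 1 0 = 0 -> usubmx (x 1%N) 1 0 - usubmx (y 1%N) 0 0 = 0 ->
  ((forall (i : 'I_2) t, let c := lshift k i in `|p * residual e c t + q * residual e c (t + pi)
       - tvec (linear_a x y s1 s2) (linear_b x y s1 s2) t c 0| <= M) ->
   [/\ forall j, (j < 4)%N -> `|usubmx (x j)| <= C * M /\ `|usubmx (y j)| <= C * M,
      `|s1| <= C * M & `|s2| <= C * M]) /\
  ((forall c t, `|p * residual e c t + q * residual e c (t + pi)
       - tvec (linear_a x y s1 s2) (linear_b x y s1 s2) t c 0| <= M) ->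
   forall j, (j < 4)%N -> `|x j| <= C * M /\ `|y j| <= C * M).
Proof.
have [C C0 S] := modes_solver; exists (C * 2) => [|e p q x y s1 s2 M ed y0 g1 g2]; first exact: mulr_ge0.
(* The first conjunct is handed to the proof of the second, where it supplies the centre
   components. *)
apply: (fun (P Q : Prop) (p : P) (f : P -> Q) => conj p (f p)) => [H|hat H].
  have M0 : 0 <= 2 * M by rewrite mulr_ge0 // (le_trans (normr_ge0 _) (H 0 0)).
  rewrite -mulrA; apply: (proj1 (S x y s1 s2 _ M0 y0 g1 g2)) => j j4.
  split=> [|j0]; apply: mx_norm_le => // i i'; rewrite ord1 mxE.
    by have [] := residual_coefs ed (H i) j4.
  by have [_] := residual_coefs ed (H i) j4; apply.
have [|hu _ _] := hat; first by move=> i t; exact: H.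
have c0 : 'I_n := lshift k 0.
have M0 : 0 <= 2 * M by rewrite mulr_ge0 // (le_trans (normr_ge0 _) (H c0 0)).
have hd : forall j, (j < 4)%N -> `|dsubmx (x j)| <= C * (2 * M) /\ `|dsubmx (y j)| <= C * (2 * M).
  apply: (proj2 (S x y s1 s2 _ M0 y0 g1 g2)) => j j4.
  split=> [|j0]; apply: mx_norm_le => // i i'; rewrite ord1 mxE.
    by have [] := residual_coefs ed (H (rshift 2 i)) j4.
  by have [_] := residual_coefs ed (H (rshift 2 i)) j4; apply.
move=> j j4; have [u1 u2] := hu j j4; have := hd j j4; rewrite mulrA => -[v1 v2].
by split; exact: norm_le_parts.
Qed.

Definition odd_part (a : nat -> 'cV[R]_n) (j : nat) : 'cV[R]_n := if odd j then a j else 0.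
Definition even_part (a : nat -> 'cV[R]_n) (j : nat) : 'cV[R]_n := if odd j then 0 else a j.
Definition cubic_col_a (j : nat) : 'cV[R]_n := col_mx (ka j) 0.
Definition cubic_col_b (j : nat) : 'cV[R]_n := col_mx (kb j) 0.

Lemma tvec_odd (a b : nat -> 'cV[R]_n) t : (forall j, ~~ odd j -> a j = 0 /\ b j = 0) ->
  tvec a b (t + pi) = - tvec a b t.
Proof.
move=> H; rewrite tvec_shift -[RHS]scaleN1r tvecZ; apply: eq_bigr => j _.
case oj: (odd j); last by have [-> ->] := H j (negbT oj); rewrite !scaler0.
by rewrite -signr_odd oj expr1.
Qed.

Lemma tvec_even (a b : nat -> 'cV[R]_n) t : (forall j, odd j -> a j = 0 /\ b j = 0) ->
  tvec a b (t + pi) = tvec a b t.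
Proof.
move=> H; rewrite tvec_shift; apply: eq_bigr => j _.
case oj: (odd j); first by have [-> ->] := H j oj; rewrite !scaler0.
by rewrite -signr_odd oj expr0 !scale1r.
Qed.

Lemma tvec_split (a b : nat -> 'cV[R]_n) t : tvec a b t = tvec (odd_part a) (odd_part b) t + tvec (even_part a) (even_part b) t.
Proof. by rewrite tvecD; apply: eq_bigr => j _; rewrite /odd_part /even_part; case: (odd j); rewrite ?addr0 ?add0r. Qed.

Lemma dtvec_split (a b : nat -> 'cV[R]_n) t : tvec (dcos b) (dsin a) t =
  tvec (dcos (odd_part b)) (dsin (odd_part a)) t + tvec (dcos (even_part b)) (dsin (even_part a)) t.
Proof.
rewrite -dtvecD; apply: eq_bigr => j _.
by rewrite /dcos /dsin /odd_part /even_part; case: (odd j); rewrite ?addr0 ?add0r.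
Qed.

Lemma dtvec_odd (a b : nat -> 'cV[R]_n) t : (forall j, ~~ odd j -> a j = 0 /\ b j = 0) ->
  tvec (dcos b) (dsin a) (t + pi) = - tvec (dcos b) (dsin a) t.
Proof. by move=> H; apply: tvec_odd => j /H[ha hb]; rewrite /dcos /dsin ha hb scaler0 oppr0. Qed.

Lemma dtvec_even (a b : nat -> 'cV[R]_n) t : (forall j, odd j -> a j = 0 /\ b j = 0) ->
  tvec (dcos b) (dsin a) (t + pi) = tvec (dcos b) (dsin a) t.
Proof. by move=> H; apply: tvec_even => j /H[ha hb]; rewrite /dcos /dsin ha hb scaler0 oppr0. Qed.

Lemma odd_part0 (a b : nat -> 'cV[R]_n) j : ~~ odd j -> odd_part a j = 0 /\ odd_part b j = 0.
Proof. by rewrite /odd_part => /negbTE ->. Qed.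

Lemma even_part0 (a b : nat -> 'cV[R]_n) j : odd j -> even_part a j = 0 /\ even_part b j = 0.
Proof. by rewrite /even_part => ->. Qed.

Lemma circle0 j : ~~ odd j -> ya j = 0 /\ yb j = 0.
Proof. by rewrite /circle_a /circle_b; case: eqP => // ->. Qed.

Lemma quad0 j : odd j -> qa j = 0 /\ qb j = 0.
Proof. by rewrite /quad_a /quad_b; case: eqP => [->//|_]; case: eqP => // ->. Qed.

Lemma tvec_col (a b : nat -> 'cV[R]_2) t :
  tvec (fun j => col_mx (a j) 0 : 'cV[R]_n) (fun j => col_mx (b j) 0) t = col_mx (tvec a b t) 0.
Proof. by rewrite !tvec4 !scale_col_mx !scaler0 !add_col_mx !addr0. Qed.

Lemma dtvec_col t : tvec (dcos cubic_col_b) (dsin cubic_col_a) t = col_mx (tvec (dcos kb) (dsin ka) t) 0.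
Proof.
rewrite -tvec_col; apply: eq_bigr => j _.
by rewrite /dcos /dsin /cubic_col_a /cubic_col_b !scale_col_mx opp_col_mx !scale_col_mx !scaler0 oppr0 scaler0.
Qed.

Lemma masked_sum (a b : nat -> 'cV[R]_n) (m : nat -> bool) :
  \sum_(j < 4) (`|if m j then a j else 0| + `|if m j then b j else 0|) <= \sum_(j < 4) (`|a j| + `|b j|).
Proof. by apply: ler_sum => j _; case: ifP => _ //; rewrite normr0 addr0 addr_ge0. Qed.

Lemma odd_part_sum (a b : nat -> 'cV[R]_n) :
  \sum_(j < 4) (`|odd_part a j| + `|odd_part b j|) <= \sum_(j < 4) (`|a j| + `|b j|).
Proof. exact: masked_sum. Qed.

Lemma even_part_sum (a b : nat -> 'cV[R]_n) :
  \sum_(j < 4) (`|even_part a j| + `|even_part b j|) <= \sum_(j < 4) (`|a j| + `|b j|).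
Proof.
apply: le_trans (masked_sum a b (fun j => ~~ odd j)).
by apply: ler_sum => j _; rewrite /even_part; case: (odd j).
Qed.

Lemma defect_ge e : [/\ `|lF e - lstar| <= defect e, `|wF e - wstar| <= defect e,
  \sum_(j < 4) (`|defect_a e j| + `|defect_b e j|) <= defect e & 0 <= defect e].
Proof.
have S0 : 0 <= \sum_(j < 4) (`|defect_a e j| + `|defect_b e j|) by apply: sumr_ge0 => j _; rewrite addr_ge0.
have l0 := normr_ge0 (lF e - lstar); have v0 := normr_ge0 (wF e - wstar).
by rewrite /defect; split; lra.
Qed.

Lemma small_range r : 0 < r -> exists d, [/\ 0 < d, d <= r, d <= d0 & forall e, `|e| < d -> defect e < r /\ `|lF e - lstar| < d0].
Proof.
move=> r0; have rd0 : 0 < Num.min r d0 by rewrite lt_min r0.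
have [d d'0 H] := defect_small rd0.
exists (Num.min d (Num.min r d0)); split; rewrite ?lt_min ?d'0 ?r0 ?ge_min ?lexx ?orbT //.
move=> e; rewrite lt_min => /andP[/H + _]; rewrite lt_min => /andP[h1 h2]; split=> //.
by have [h _ _ _] := defect_ge e; exact: le_lt_trans h h2.
Qed.

Lemma dorbit e t : tvec (dcos (coef_b e)) (dsin (coef_a e)) t =
  tvec (dcos yb) (dsin ya) t + (e *: tvec (dcos qb) (dsin qa) t + tvec (dcos (defect_b e)) (dsin (defect_a e)) t).
Proof. by rewrite -dtvecZ -!dtvecD. Qed.

Let regroup (a b c d : 'cV[R]_n) : a + (b + (c + d)) = a + c + (b + d).
Proof. by rewrite -addrA; congr (_ + _); exact: addrCA. Qed.

Lemma orbit_split e t : orbit e t = tvec ya yb t + tvec (odd_part (defect_a e)) (odd_part (defect_b e)) t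
  + (e *: tvec qa qb t + tvec (even_part (defect_a e)) (even_part (defect_b e)) t).
Proof. by rewrite orbitE (tvec_split (defect_a e)) regroup. Qed.

Lemma dorbit_split e t : tvec (dcos (coef_b e)) (dsin (coef_a e)) t =
  tvec (dcos yb) (dsin ya) t + tvec (dcos (odd_part (defect_b e))) (dsin (odd_part (defect_a e))) t
  + (e *: tvec (dcos qb) (dsin qa) t + tvec (dcos (even_part (defect_b e))) (dsin (even_part (defect_a e))) t).
Proof. by rewrite dorbit (dtvec_split (defect_a e)) regroup. Qed.

(** Collects all forcing of the first harmonic in the centre plane: parameter shift [mu], Lyapunov
    term with weight [x], frequency shift [nu]. The two arguments of the resulting rotation are the
    unknowns [s1], [s2] of the resonant block; at [x = e^2] their smallness is the pair of Lyapunov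
    formulas. *)
Lemma rot_lin (mu nu x : R) t :
  col_mx (rot2 (mu * aR' + x * bR) (mu * aI' + x * bI - nu) *m circ t) 0 =
  mu *: (Edot lstar D *m tvec ya yb t) + x *: col_mx (rot2 bR bI *m circ t) 0
  - nu *: tvec (dcos yb) (dsin ya) t.
Proof.
rewrite dcircle acirc_col (Edot_hat Hcont).
rewrite !scale_col_mx opp_col_mx !add_col_mx !scaler0 oppr0 !addr0; congr col_mx.
by rewrite !rot2_mul_vec; apply/colP => i; rewrite !mxE; case: ifP => _; ring.
Qed.

Let Sq : R := \sum_(j < 4) (`|qa j| + `|qb j|).
Let Sq0 : 0 <= Sq. Proof. by apply: sumr_ge0 => j _; rewrite addr_ge0. Qed.

(** An index is a pair of [e] and a time, so that every order estimate holds uniformly in time. *)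
Lemma G_exp_bigO (P : R * R -> Prop) (rho : R * R -> R) c :
  (forall i, P i -> [/\ `|i.1| <= rho i, `|lF i.1 - lstar| < d0 & 0 < `|i.1| < d0]) ->
  forall z : R * R -> 'cV[R]_n, (forall i, P i -> `|z i| <= 3) ->
  bigO P rho 4 (fun i => Gfield F D (z i) (lF i.1) i.1 c 0 - ((Emat D (lF i.1) *m z i) c 0
    + i.1 * ml [:: z i; z i] (beta c (lF i.1)) + i.1 ^+ 2 * ml [:: z i; z i; z i] (beta c (lF i.1))
    + i.1 ^+ 3 * ml [:: z i; z i; z i; z i] (beta c (lF i.1)))).
Proof.
move=> HP z z3; exists Cg => // i Pi; have [ir il ie] := HP i Pi.
rewrite (le_trans (G_exp c (z3 i Pi) il ie)) // ler_wpM2l // lerXn2r ?nnegrE //.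
exact: le_trans ir.
Qed.

(* By the order-e homological equation the residual is linear in the defect up
   to O((|e| + defect)^2), so defect <= C (|e| + defect)^2; as the defect tends
   to 0, its square can be absorbed. *)
Lemma first_order : exists2 C, 0 <= C & exists2 d, 0 < d & forall e, 0 < `|e| < d ->
  defect e <= C * e ^+ 2.
Proof.
(* The bound 1/4 on both [|e|] and the defect keeps [rho] below 1, and [1 / (Sq + 1)] keeps [e *: q]
   below 1, hence the orbit within norm 3. *)
have r0 : 0 < Num.min (1 / 4) (1 / (Sq + 1)).
  by rewrite lt_min !divr_gt0 // ltr_wpDl.
have [d [dp dr dd0 Hd]] := small_range r0.
pose P (i : R * R) := 0 < `|i.1| < d.
(* No rate for the defect is known yet, so it is itself part of the scale. *)
pose rho (i : R * R) := `|i.1| + defect i.1.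
have HP i : P i -> [/\ `|i.1| <= rho i, `|lF i.1 - lstar| < d0 & 0 < `|i.1| < d0].
  move=> /andP[i0 id]; have [_ _ _ h] := defect_ge i.1; split.
  - by rewrite /rho lerDl.
  - by have [] := Hd _ id.
  - by rewrite i0 (lt_le_trans id).
have rho01 i : P i -> 0 <= rho i <= 1.
  move=> /andP[i0 id]; have [_ _ _ h] := defect_ge i.1; have [h' _] := Hd _ id.
  have : `|i.1| < Num.min (1 / 4) (1 / (Sq + 1)) by exact: lt_le_trans dr.
  move: h'; rewrite !lt_min => /andP[h1 _] /andP[h2 _].
  by rewrite /rho; apply/andP; split; lra.
pose y (i : R * R) := tvec ya yb i.2.
pose w (i : R * R) := i.1 *: tvec qa qb i.2 + tvec (defect_a i.1) (defect_b i.1) i.2.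
have exP : exists i, P i.
  by exists (d / 2, 0); rewrite /P /= gtr0_norm ?divr_gt0 //; lra.
have yO : bigO P rho 0 y by apply: bigO_bounded => i _; exact: tvec_circle_le1.
have wle i : `|w i| <= Sq * `|i.1| + defect i.1.
  rewrite (le_trans (ler_normD _ _)) // normrZ [Sq * _]mulrC lerD //.
    by rewrite ler_wpM2l // tvec_le.
  by rewrite (le_trans (tvec_le _ _ _)) //; have [] := defect_ge i.1.
have wO : bigO P rho 1 w.
  exists (Sq + 1) => [|i _]; first by rewrite addr_ge0.
  rewrite (le_trans (wle i)) // expr1 /rho.
  have [_ _ _ h] := defect_ge i.1; have := mulr_ge0 Sq0 h; have := normr_ge0 i.1; lra.
have eO : bigO P rho 1 (fun i : R * R => i.1).
  by exists 1 => // i Pi; rewrite mul1r expr1; have [] := HP i Pi.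
have muO : bigO P rho 1 (fun i => lF i.1 - lstar).
  exists 1 => // i Pi; rewrite mul1r expr1 /rho; have [h _ _ _] := defect_ge i.1.
  by rewrite (le_trans h) // lerDr.
have nuO : bigO P rho 1 (fun i => wF i.1 - wstar).
  exists 1 => // i Pi; rewrite mul1r expr1 /rho; have [_ h _ _] := defect_ge i.1.
  by rewrite (le_trans h) // lerDr.
have z3 i : P i -> `|y i + w i| <= 3.
  move=> /andP[i0 id]; rewrite (le_trans (ler_normD _ _)) //.
  have h1 := tvec_circle_le1 i.2; have h2 := wle i; have [h' _] := Hd _ id.
  have : `|i.1| < Num.min (1 / 4) (1 / (Sq + 1)) by exact: lt_le_trans dr.
  move: h'; rewrite !lt_min => /andP[h3 _] /andP[_]; rewrite ltr_pdivlMr ?ltr_wpDl // => h4.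
  have := normr_ge0 i.1; rewrite /y; nra.
pose w' (i : R * R) := i.1 *: tvec (dcos qb) (dsin qa) i.2 + tvec (dcos (defect_b i.1)) (dsin (defect_a i.1)) i.2.
have w'O : bigO P rho 1 w'.
  exists (3 * (Sq + 1)) => [|i _]; first by rewrite mulr_ge0 ?addr_ge0.
  rewrite (le_trans (ler_normD _ _)) // normrZ expr1 /rho.
  have h1 := dtvec_le qa qb i.2; have h2 := dtvec_le (defect_a i.1) (defect_b i.1) i.2.
  have [_ _ h3 h4] := defect_ge i.1; have h5 := normr_ge0 i.1.
  have : `|i.1| * `|tvec (dcos qb) (dsin qa) i.2| <= `|i.1| * (3 * Sq) by rewrite ler_wpM2l.
  have := mulr_ge0 Sq0 h4; lra.
have hP i : P i -> `|lF i.1 - lstar| < d0 by move=> /HP[].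
pose s1 e := (lF e - lstar) * aR' + 0 * bR; pose s2 e := (lF e - lstar) * aI' + 0 * bI - (wF e - wstar).
have key c : bigO P rho 2 (fun i => 1 * residual i.1 c i.2 + 0 * residual i.1 c (i.2 + pi)
    - tvec (linear_a (defect_a i.1) (defect_b i.1) (s1 i.1) (s2 i.1)) (linear_b (defect_a i.1) (defect_b i.1) (s1 i.1) (s2 i.1)) i.2 c 0).
  have T1 := expansion_first (c := c) (A' := Edot lstar D) (E := Emat D) (beta := beta c) (l := fun i => lF i.1)
    (G := fun z l e => Gfield F D z l e c 0) rho01 Cb0 CE0 (fun i Pi => E_taylor (hP i Pi))
    (fun i Pi p r => @beta_le _ c p r (hP i Pi)) (@G_exp_bigO _ _ c HP) eO exP yO wO muO z3.
  have w'cO : bigO P rho 1 (fun i => w' i c 0).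
    by have [C C0 H] := w'O; exists C => // i Pi; exact: le_trans (mx_entry_le _ _ _) (H i Pi).
  apply: bigO_ext (bigOB T1 (bigOM nuO w'cO)) => i Pi.
  have [hom _] := homological_circle i.2.
  have h1 := hom c; have h2 := congr1 (fun v : 'cV[R]_n => v c 0) (circle_derive i.2).
  rewrite linear_tvec rot_lin scale0r addr0 /residual orbitE dorbit -/(y i) -/(w i) -/(w' i).
  have Aw : (A *m w i) c 0 = i.1 * (A *m tvec qa qb i.2) c 0 + (A *m tvec (defect_a i.1) (defect_b i.1) i.2) c 0.
    by rewrite mulmxDr -scalemxAr !mxE.
  rewrite Aw /y; move: h1 h2; rewrite /w'.
  move: (Gfield _ _ _ _ _ _ _) (ml _ _) (A *m _) (A *m _) (A *m _) (Edot _ _ *m _) => g m A1 A2 A3 A4.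
  move: (tvec (dcos yb) _ _) (tvec (dcos qb) _ _) (tvec (dcos (defect_b _)) _ _) => v1 v2 v3.
  rewrite !mxE => h1 h2; have -> : m = wstar * v2 c 0 - A3 c 0 by rewrite -h1 addrC addKr.
  by rewrite h2; ring.
have rho0 i : P i -> 0 <= rho i by case/rho01/andP.
have [C1 C10 HC1] := residual_solver; have [C2 C20 HC2] := bigO_uniform rho0 key.
pose K := C1 * C2; have K0 : 0 <= K by exact: mulr_ge0.
have aR0 : 0 < `|aR'| by rewrite normr_gt0.
(* Transversality recovers the parameter shift from [s1] by dividing by [aR']; the frequency shift
   then follows from [s2], and eight coefficients account for [8 * K]. *)
pose K' := K / `|aR'| * (1 + `|aI'|) + K + 8 * K.
have K'0 : 0 <= K' by rewrite !addr_ge0 ?mulr_ge0 ?addr_ge0 ?invr_ge0.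
have defect_quad e : 0 < `|e| < d -> defect e <= K' * (`|e| + defect e) ^+ 2.
  move=> Pe; pose Q := (`|e| + defect e) ^+ 2.
  have ed : 0 < `|e| < d0 by have [] := HP (e, 0) Pe.
  have db0 : defect_b e 0%N = 0 by rewrite /defect_b /quad_b /= scaler0 subr0.
  have [_ [g1 g2]] := means ed.
  have [hat full] := HC1 e 1 0 (defect_a e) (defect_b e) (s1 e) (s2 e) (C2 * Q) ed db0 g1 g2.
  have [|_ hs1 hs2] := hat; first by move=> i t; exact: HC2 (e, t) Pe.
  have {}full := full (fun c t => HC2 c (e, t) Pe).
  rewrite mulrA -/K /s1 /s2 !mul0r !addr0 in hs1 hs2 full.
  have Q0 : 0 <= Q by rewrite sqr_ge0.
  have mu_le : `|lF e - lstar| <= K / `|aR'| * Q.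
    by rewrite mulrAC ler_pdivlMr // -normrM.
  have nu_le : `|wF e - wstar| <= K / `|aR'| * Q * `|aI'| + K * Q.
    have -> : wF e - wstar = (lF e - lstar) * aI' - ((lF e - lstar) * aI' - (wF e - wstar)) by ring.
    by rewrite (le_trans (ler_normB _ _)) // lerD // normrM ler_wpM2r.
  have sum_le : \sum_(j < 4) (`|defect_a e j| + `|defect_b e j|) <= 8 * K * Q.
    apply: (@le_trans _ _ (\sum_(j < 4) (K * Q + K * Q))).
      by apply: ler_sum => j _; have [ha hb] := full j (ltn_ord j); exact: lerD.
    by rewrite sumr_const card_ord -mulr_natl; rewrite le_eqVlt; apply/orP; left; apply/eqP; ring.
  rewrite /defect (_ : K' * _ = K / `|aR'| * Q + (K / `|aR'| * Q * `|aI'| + K * Q) + 8 * K * Q).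
    by rewrite !lerD.
  by rewrite /K' -/Q; ring.
(* Below this size [2 K' defect^2] is at most half the defect, which is what the absorption needs;
   it leaves [defect <= 4 K' e^2]. *)
have [|d2 d20 Hd2] := @defect_small (1 / (4 * K' + 1)); first by rewrite divr_gt0 // ltr_wpDl ?mulr_ge0.
exists (4 * K'); first by rewrite mulr_ge0.
exists (Num.min d d2); first by rewrite lt_min dp.
move=> e /andP[e0]; rewrite lt_min => /andP[ed ed2].
have h1 := defect_quad e (introT andP (conj e0 ed)); have h2 := Hd2 e ed2.
have [_ _ _ D0] := defect_ge e; move: h1 h2 D0; set Q := defect e => h1 h2 D0.
rewrite ltr_pdivlMr ?ltr_wpDl ?mulr_ge0 // in h2.
have e2 : `|e| ^+ 2 = e ^+ 2 by rewrite real_normK ?num_real.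
have h3 : (`|e| + Q) ^+ 2 <= 2 * e ^+ 2 + 2 * Q ^+ 2.
  by rewrite -e2; have := sqr_ge0 (`|e| - Q); rewrite !expr2; lra.
have h4 : K' * (`|e| + Q) ^+ 2 <= K' * (2 * e ^+ 2 + 2 * Q ^+ 2) by rewrite ler_wpM2l.
have h5 : Q * (Q * (4 * K' + 1)) <= Q * 1 by rewrite ler_wpM2l // ltW.
have := sqr_ge0 Q; move: h5; rewrite (_ : Q * (Q * _) = 4 * (K' * Q ^+ 2) + Q ^+ 2); last ring.
move: h4; rewrite (_ : K' * (2 * _ + _) = 2 * (K' * e ^+ 2) + 2 * (K' * Q ^+ 2)); last ring.
by rewrite -mulrA; lra.
Qed.

(** The exponents anticipate the final division, by [e] for even modes and by [e^2] for odd modes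
    and scalars; either way [e^2] is left. *)
Definition defect_estimates C d := forall e, 0 < `|e| < d ->
  [/\ forall j, (j < 4)%N -> ~~ odd j -> `|defect_a e j| <= C * `|e| ^+ 3 /\ `|defect_b e j| <= C * `|e| ^+ 3,
      forall j, (j < 4)%N -> odd j -> `|usubmx (defect_a e j) - e ^+ 2 *: ka j| <= C * `|e| ^+ 4 /\
         `|usubmx (defect_b e j) - e ^+ 2 *: kb j| <= C * `|e| ^+ 4,
      `|(lF e - lstar) * aR' + e ^+ 2 * bR| <= C * `|e| ^+ 4
    & `|(lF e - lstar) * aI' + e ^+ 2 * bI - (wF e - wstar)| <= C * `|e| ^+ 4].

(* The even part of the residual does not see the O(e^2) odd part of the defect,
   which gives the even modes to O(e^3); the odd part, to which the even modes
   then contribute only e q, is handled by the order-e^2 homological equation. *)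
Lemma second_order : exists2 C, 0 <= C & exists2 d, 0 < d & defect_estimates C d.
Proof.
have [C1 C10 [d1 d10 H1]] := first_order.
(* Again chosen to keep the orbit and its half-period shift within norm 3, now with the defect
   bounded by [C1 e^2]. *)
have r0 : 0 < Num.min (1 / 4) (1 / (Sq + C1 + 1)).
  by rewrite lt_min !divr_gt0 // ltr_wpDl // addr_ge0.
have [d2 [d2p d2r d20 Hd]] := small_range r0.
pose d := Num.min d1 d2.
have d0' : 0 < d by rewrite lt_min d10.
pose P (i : R * R) := 0 < `|i.1| < d.
pose rho (i : R * R) := `|i.1|.
have esq e : `|e| ^+ 2 = e ^+ 2 :> R by rewrite real_normK ?num_real.
have HP i : P i -> [/\ `|i.1| <= rho i, `|lF i.1 - lstar| < d0 & 0 < `|i.1| < d0].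
  rewrite /P lt_min => /andP[i0 /andP[id1 id2]]; split=> //.
  - by have [] := Hd _ id2.
  - by rewrite i0 (lt_le_trans id2).
have HD i : P i -> defect i.1 <= C1 * rho i ^+ 2.
  by rewrite /P lt_min => /andP[i0 /andP[id1 id2]]; rewrite /rho esq H1 // i0.
have rho_small i : P i -> [/\ 0 <= rho i, rho i <= 1 / 4 & (Sq + C1 + 1) * rho i <= 1].
  rewrite /P lt_min => /andP[i0 /andP[id1 id2]].
  have : `|i.1| < Num.min (1 / 4) (1 / (Sq + C1 + 1)) by exact: lt_le_trans d2r.
  rewrite lt_min => /andP[h1 h2]; split; [exact: normr_ge0|exact: ltW|].
  by rewrite mulrC -ler_pdivlMr ?ltW // ltr_wpDl // addr_ge0.
have rho01 i : P i -> 0 <= rho i <= 1 by move=> /rho_small[h1 h2 _]; apply/andP; split; lra.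
have rho0 i : P i -> 0 <= rho i by case/rho01/andP.
pose y (i : R * R) := tvec ya yb i.2.
pose wo (i : R * R) := tvec (odd_part (defect_a i.1)) (odd_part (defect_b i.1)) i.2.
pose we (i : R * R) := tvec (even_part (defect_a i.1)) (even_part (defect_b i.1)) i.2.
pose q (i : R * R) := tvec qa qb i.2.
pose ze i := i.1 *: q i + we i.
have exP : exists i, P i.
  by exists (d / 2, 0); rewrite /P /= gtr0_norm ?divr_gt0 //; lra.
have yO : bigO P rho 0 y by apply: bigO_bounded => i _; exact: tvec_circle_le1.
have ole i : P i -> `|wo i| <= C1 * rho i ^+ 2.
  move=> Pi; rewrite (le_trans (tvec_le _ _ _)) // (le_trans (odd_part_sum _ _)) //.
  by have [_ _ h _] := defect_ge i.1; exact: le_trans h (HD i Pi).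
have ele i : P i -> `|we i| <= C1 * rho i ^+ 2.
  move=> Pi; rewrite (le_trans (tvec_le _ _ _)) // (le_trans (even_part_sum _ _)) //.
  by have [_ _ h _] := defect_ge i.1; exact: le_trans h (HD i Pi).
have woO : bigO P rho 2 wo by exists C1.
have weO2 : bigO P rho 2 we by exists C1.
have eO : bigO P rho 1 (fun i : R * R => i.1) by exists 1 => // i _; rewrite mul1r expr1.
have qle i : `|q i| <= Sq by exact: tvec_le.
have qO : bigO P rho 0 q by apply: bigO_bounded => i _; exact: qle.
have zeO : bigO P rho 1 ze.
  by apply: bigOD; [exact: (bigOZ eO qO)|exact: (bigO_le rho01 (isT : (1 <= 2)%N) weO2)].
have muO : bigO P rho 2 (fun i => lF i.1 - lstar).
  by exists C1 => // i Pi; have [h _ _ _] := defect_ge i.1; exact: le_trans h (HD i Pi).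
have nuO : bigO P rho 2 (fun i => wF i.1 - wstar).
  by exists C1 => // i Pi; have [_ h _ _] := defect_ge i.1; exact: le_trans h (HD i Pi).
have zle i (s : R) : P i -> `|s| = 1 -> `|s *: (y i + wo i) + ze i| <= 3.
  move=> Pi s1; rewrite (le_trans (ler_normD _ _)) // normrZ s1 mul1r.
  have h1 := ler_normD (y i) (wo i); have h2 := ler_normD (i.1 *: q i) (we i).
  have h3 := ole i Pi; have h4 := ele i Pi; have h5 : `|y i| <= 1 by exact: tvec_circle_le1.
  have [r1 r2 r3] := rho_small i Pi.
  have h6 : `|i.1 *: q i| <= Sq * rho i by rewrite normrZ mulrC ler_wpM2r.
  have h7 : C1 * rho i ^+ 2 <= C1 * rho i * 1.
    by rewrite expr2 mulrA ler_wpM2l ?mulr_ge0 //; lra.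
  have h8 := mulr_ge0 C10 r1; have h9 := mulr_ge0 Sq0 r1.
  have h10 : C1 * rho i ^+ 2 <= C1 * rho i * (1 / 4).
    by rewrite expr2 mulrA ler_wpM2l ?mulr_ge0.
  rewrite /ze; lra.
have zp3 i : P i -> `|y i + wo i + ze i| <= 3.
  by move=> Pi; have := zle i 1 Pi (normr1 _); rewrite scale1r.
have zm3 i : P i -> `|- (y i + wo i) + ze i| <= 3.
  by move=> Pi; have := zle i (-1) Pi (normrN1 _); rewrite scaleN1r.
pose y' (i : R * R) := tvec (dcos yb) (dsin ya) i.2.
pose q' (i : R * R) := tvec (dcos qb) (dsin qa) i.2.
pose wo' (i : R * R) := tvec (dcos (odd_part (defect_b i.1))) (dsin (odd_part (defect_a i.1))) i.2.
pose we' (i : R * R) := tvec (dcos (even_part (defect_b i.1))) (dsin (even_part (defect_a i.1))) i.2.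
have wo'O : bigO P rho 2 wo'.
  exists (3 * C1) => [|i Pi]; first by rewrite mulr_ge0.
  rewrite (le_trans (dtvec_le _ _ _)) // -mulrA ler_wpM2l // (le_trans (odd_part_sum _ _)) //.
  by have [_ _ h _] := defect_ge i.1; exact: le_trans h (HD i Pi).
have we'O : bigO P rho 2 we'.
  exists (3 * C1) => [|i Pi]; first by rewrite mulr_ge0.
  rewrite (le_trans (dtvec_le _ _ _)) // -mulrA ler_wpM2l // (le_trans (even_part_sum _ _)) //.
  by have [_ _ h _] := defect_ge i.1; exact: le_trans h (HD i Pi).
have q'O : bigO P rho 0 q' by apply: bigO_bounded => i _; exact: dtvec_le.
have entryO p (f : R * R -> 'cV[R]_n) c : bigO P rho p f -> bigO P rho p (fun i => f i c 0).
  by move=> [C C0 H]; exists C => // i Pi; exact: le_trans (mx_entry_le _ _ _) (H i Pi).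
pose G c (z : 'cV[R]_n) (l e : R) := Gfield F D z l e c 0.
have resE c i : residual i.1 c i.2 = G c (y i + wo i + ze i) (lF i.1) i.1
    - wF i.1 * (y' i + wo' i + (i.1 *: q' i + we' i)) c 0.
  by rewrite /residual orbit_split dorbit_split.
(* Half a period later the circle and the odd part of the defect change sign, while the quadratic
   part and the even part of the defect do not. *)
have resE' c i : residual i.1 c (i.2 + pi) = G c (- (y i + wo i) + ze i) (lF i.1) i.1
    - wF i.1 * (- (y' i + wo' i) + (i.1 *: q' i + we' i)) c 0.
  have := resE c (i.1, i.2 + pi); rewrite /ze /y /wo /we /q /y' /wo' /we' /q' /= => ->.
  rewrite !(tvec_odd _ circle0) !(tvec_odd _ (odd_part0 _ _)) !(tvec_even _ quad0) !(tvec_even _ (even_part0 _ _)).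
  rewrite !(dtvec_odd _ circle0) !(dtvec_odd _ (odd_part0 _ _)) !(dtvec_even _ quad0) !(dtvec_even _ (even_part0 _ _)).
  by rewrite -!opprD.
have hP i : P i -> `|lF i.1 - lstar| < d0 by move=> /HP[].
(* The forcing is zero here: parameter and frequency shifts act on the circle, which is odd. *)
have keyE c : bigO P rho 3 (fun i => 2^-1 * residual i.1 c i.2 + 2^-1 * residual i.1 c (i.2 + pi)
    - tvec (linear_a (even_part (defect_a i.1)) (even_part (defect_b i.1)) 0 0) (linear_b (even_part (defect_a i.1)) (even_part (defect_b i.1)) 0 0) i.2 c 0).
  have T1 := expansion_even (c := c) (A' := Edot lstar D) (E := Emat D) (beta := beta c) (l := fun i => lF i.1)
    (G := G c) rho01 Cb0 CE0 (fun i Pi => E_taylor (hP i Pi))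
    (fun i Pi p r => @beta_le _ c p r (hP i Pi)) (@G_exp_bigO _ _ c HP) eO exP yO woO zeO muO zp3 zm3.
  have dO : bigO P rho 1 (fun i => i.1 *: q' i + we' i).
    by apply: bigOD; [exact: (bigOZ eO q'O)|exact: (bigO_le rho01 (isT : (1 <= 2)%N) we'O)].
  apply: bigO_ext (bigOB T1 (bigOM nuO (entryO _ _ c dO))) => i Pi.
  have [hom _] := homological_circle i.2; have {hom}h1 := hom c.
  rewrite resE resE' linear_tvec.
  have -> : col_mx (rot2 0 0 *m circ i.2) 0 = 0 :> 'cV[R]_n.
    by rewrite rot2_mul_vec -[RHS](@col_mx0 _ 2 k 1); congr col_mx; apply/colP => r; rewrite !mxE; case: ifP => _; ring.
  have Ae : (A *m ze i) c 0 = i.1 * (A *m q i) c 0 + (A *m we i) c 0 by rewrite mulmxDr -scalemxAr !mxE.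
  rewrite Ae addr0 -/(we i) -/(we' i); move: h1; rewrite -/(q i) -/(q' i) -/(y i).
  move: (G _ _ _ _) (G _ _ _ _) (ml _ _) (A *m q i) (A *m we i) (q' i) (we' i) (y' i) (wo' i).
  move=> g1 g2 m A1 A2 v1 v2 v3 v4.
  rewrite !mxE => h1; have -> : m = wstar * v1 c 0 - A1 c 0 by rewrite -h1 addrC addKr.
  by field.
have [C2 C20 HC2] := residual_solver; have [C3 C30 HC3] := bigO_uniform rho0 keyE.
have even_le e : 0 < `|e| < d -> forall j, (j < 4)%N -> `|even_part (defect_a e) j| <= C2 * C3 * `|e| ^+ 3 /\ `|even_part (defect_b e) j| <= C2 * C3 * `|e| ^+ 3.
  move=> Pe; have ed : 0 < `|e| < d0 by have [] := HP (e, 0) Pe.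
  have evb0 : even_part (defect_b e) 0%N = 0 by rewrite /even_part /defect_b /quad_b /= scaler0 subr0.
  have [||_ full] := HC2 e 2^-1 2^-1 (even_part (defect_a e)) (even_part (defect_b e)) 0 0 (C3 * `|e| ^+ 3) ed evb0.
  - by rewrite /even_part /= !mxE addr0.
  - by rewrite /even_part /= !mxE subr0.
  by rewrite -mulrA; apply: full => c t; exact: HC3 c (e, t) Pe.
have weO : bigO P rho 3 we.
  exists (8 * (C2 * C3)) => [|i Pi]; first by rewrite !mulr_ge0.
  rewrite (le_trans (tvec_le _ _ _)) //.
  apply: (@le_trans _ _ (\sum_(j < 4) (C2 * C3 * rho i ^+ 3 + C2 * C3 * rho i ^+ 3))).
    by apply: ler_sum => j _; have [ha hb] := even_le i.1 Pi j (ltn_ord j); exact: lerD.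
  by rewrite sumr_const card_ord -mulr_natl; rewrite le_eqVlt; apply/orP; left; apply/eqP; ring.
(* The new unknown is the distance of the odd defect from [e^2] times the cubic part of the
   transformation, which has no hyperbolic component. *)
pose xa e j := odd_part (defect_a e) j + (- e ^+ 2) *: cubic_col_a j; pose xb e j := odd_part (defect_b e) j + (- e ^+ 2) *: cubic_col_b j.
pose s1 e := (lF e - lstar) * aR' + e ^+ 2 * bR.
pose s2 e := (lF e - lstar) * aI' + e ^+ 2 * bI - (wF e - wstar).
have keyO (r : 'I_2) : bigO P rho 4 (fun i => 2^-1 * residual i.1 (lshift k r) i.2
    + (- 2^-1) * residual i.1 (lshift k r) (i.2 + pi)
    - tvec (linear_a (xa i.1) (xb i.1) (s1 i.1) (s2 i.1)) (linear_b (xa i.1) (xb i.1) (s1 i.1) (s2 i.1)) i.2 (lshift k r) 0).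
  set c := lshift k r.
  have T1 := expansion_odd (c := c) (A' := Edot lstar D) (E := Emat D) (beta := beta c) (l := fun i => lF i.1)
    (G := G c) rho01 Cb0 CE0 (fun i Pi => E_taylor (hP i Pi))
    (fun i Pi p r => @beta_le _ c p r (hP i Pi)) (@G_exp_bigO _ _ c HP) eO exP yO woO zeO muO zp3 zm3 weO (fun i => erefl (ze i)).
  apply: bigO_ext (bigOB T1 (bigOM nuO (entryO _ _ c wo'O))) => i Pi.
  have [_ hom] := homological_circle i.2; have {hom}h1 := hom r.
  have h2 := congr1 (fun v : 'cV[R]_n => v c 0) (circle_derive i.2).
  rewrite resE resE' linear_tvec rot_lin /xa /xb -tvecD dtvecD -tvecZ dtvecZ dtvec_col (tvec_col ka kb).
  have Ao : (A *m (y i + wo i)) c 0 = (A *m y i) c 0 + (A *m wo i) c 0 by rewrite mulmxDr mxE.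
  rewrite Ao mulmxDr -scalemxAr; move: h1 h2; rewrite -/c -/(q i) -/(y i) -/(y' i) -/(wo i) -/(wo' i).
  have uE (v : 'cV[R]_2) : (col_mx v 0 : 'cV[R]_n) c 0 = v r 0 by rewrite col_mxEu.
  have kE := uE (tvec (dcos kb) (dsin ka) i.2); have rE := uE (rot2 bR bI *m circ i.2).
  move: kE rE; move: (A *m col_mx _ _) (col_mx _ _) (col_mx _ _) => A1 U1 U2.
  move: (tvec (dcos kb) _ _) (rot2 bR bI *m _) => k1 k2.
  move: (G _ _ _ _) (G _ _ _ _) (ml _ _) (ml _ _) (ml _ _) => g1 g2 m1 m2 m3.
  move: (A *m wo i) (A *m y i) (Edot _ _ *m _) (y' i) (wo' i) (q' i) (we' i) => A2 A3 A4 v1 v2 v3 v4.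
  rewrite !mxE => kE rE h1 h2.
  have -> : m1 = wstar * k1 r 0 + k2 r 0 - A1 c 0 - m3 - m2 by rewrite -h1; ring.
  by rewrite h2 kE rE; field.
have [C4 C40 HC4] := bigO_uniform rho0 keyO.
exists (C2 * C3 + C2 * C4); first by rewrite addr_ge0 ?mulr_ge0.
exists d => // e Pe; have ed : 0 < `|e| < d0 by have [] := HP (e, 0) Pe.
have l3 : C2 * C3 * `|e| ^+ 3 <= (C2 * C3 + C2 * C4) * `|e| ^+ 3.
  by rewrite ler_wpM2r ?exprn_ge0 // lerDl mulr_ge0.
have l4 : C2 * (C4 * `|e| ^+ 4) <= (C2 * C3 + C2 * C4) * `|e| ^+ 4.
  by rewrite mulrA ler_wpM2r ?exprn_ge0 // lerDr mulr_ge0.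
have xb0 : xb e 0%N = 0 by rewrite /xb /odd_part /cubic_col_b /cubic_b /= col_mx0 scaler0 addr0.
(* The normalisation imposed on [nf_a1] and [nf_b1] is exactly the phase and amplitude constraint of
   the Galerkin problem, so the difference of the two first harmonics satisfies it as well. *)
have [_ [g1 g2]] := means ed; have [[n1 n2] _] := Hnf.
have usubX j : odd j -> usubmx (xa e j) = usubmx (defect_a e j) - e ^+ 2 *: ka j /\
    usubmx (xb e j) = usubmx (defect_b e j) - e ^+ 2 *: kb j.
  have key (u : 'cV[R]_n) (v : 'cV[R]_2) (x : R) : usubmx (u + (- x) *: col_mx v 0) = usubmx u - x *: v.
    by rewrite scaleNr raddfB /= linearZ /= col_mxKu.
  by move=> oj; rewrite /xa /xb /odd_part oj !key.
have [X1 Y1] := usubX 1%N isT.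
have [||hat _] := HC2 e 2^-1 (- 2^-1) (xa e) (xb e) (s1 e) (s2 e) (C4 * `|e| ^+ 4) ed xb0.
- rewrite X1 Y1 /cubic_a /cubic_b /=; move: (usubmx _) (usubmx _) g1 => b a; rewrite !mxE => g1.
  transitivity (a 0 0 + b 1 0 - e ^+ 2 * (nf_a1 cf lstar 0 0 + nf_b1 cf lstar 1 0)); first ring.
  by rewrite g1 n1 mulr0 subr0.
- rewrite X1 Y1 /cubic_a /cubic_b /=; move: (usubmx _) (usubmx _) g2 => b a; rewrite !mxE => g2.
  transitivity (a 1 0 - b 0 0 - e ^+ 2 * (nf_a1 cf lstar 1 0 - nf_b1 cf lstar 0 0)); first ring.
  by rewrite g2 n2 mulr0 subr0.
have [|odd_le h1 h2] := hat; first by move=> i t; exact: HC4 i (e, t) Pe.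
split; [| |exact: le_trans l4|exact: le_trans l4].
- move=> j j4 /negbTE oj; have := even_le e Pe j j4; rewrite /even_part oj => -[ha hb].
  by split; exact: le_trans l3.
- move=> j j4 oj; have [<- <-] := usubX j oj; have [ha hb] := odd_le j j4.
  by split; exact: le_trans l4.
Qed.

End Stages.

(** * From uniform estimates to asymptotic statements *)

Section Conclusion.
Context {R : realType} {k : nat}.
Local Notation n := (2 + k)%N.

Lemma galerkin_asymptotics (F : 'cV[R]_n -> R -> 'cV[R]_n) (xstar : 'cV[R]_n) (lstar wstar : R)
    (Pstar : 'M[R]_n) (Etstar : 'M[R]_k) (D : continuation R k) (cf : nf_coefs R k) (bR bI : R)
    (lF wF : R -> R) (aF bF : nat -> R -> 'cV[R]_n) :
  smooth_on [set: 'cV[R]_n * R] (fun p => F p.1 p.2) ->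
  hopf_point F xstar lstar wstar Pstar Etstar ->
  hopf_continuation F xstar lstar wstar Pstar Etstar D ->
  derive1 (alphaR D) lstar != 0 ->
  nf_conditions F D cf lstar bR bI ->
  galerkin_branch F D 3%N lstar wstar lF wF aF bF ->
  exists2 C, 0 <= C & exists2 d, 0 < d & defect_estimates lstar wstar D cf bR bI lF wF aF bF C d.
Proof.
move=> F_smooth Hhopf Hcont Htrans Hnf Hgal.
have [beta beta_lip [Cg [d1 [Cg0 d10 G_exp]]]] := Gfield_expansion F_smooth Hcont.
have [CE CE0 /nbhs_ballP[d2 /= d20 E_taylor]] := Emat_taylor Hcont.
have [d3 d30 means] := residual_means cf F_smooth Hgal.
(* Index lists of length 0 to 4 are needed, the degrees occurring in the expansion of the field. *)
have /choice[Cb CbP] : forall cp : 'I_n * 'I_5, exists C, 0 <= C /\ \forall l \near lstar, forall r,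
    size r = cp.2 -> `|beta cp.1 l r| <= C /\ `|beta cp.1 l r - beta cp.1 lstar r| <= C * `|l - lstar|.
  by move=> [c p]; have [C C0 H] := lip_uniform p (beta_lip c); exists C.
have beta_near := @filter_forall R _ (fun (cp : 'I_n * 'I_5) l => forall r, size r = cp.2 ->
  `|beta cp.1 l r| <= Cb cp /\ `|beta cp.1 l r - beta cp.1 lstar r| <= Cb cp * `|l - lstar|)
  (nbhs lstar) _ (fun cp => proj2 (CbP cp)).
have /nbhs_ballP[d4 /= d40 beta_le] := beta_near (nbhs_filter lstar).
pose d0 := Num.min (Num.min d1 d2) (Num.min d3 d4).
have d00 : 0 < d0 by rewrite !lt_min d10 d20 d30.
pose Cb0 := \sum_cp Cb cp.
have Cb00 : 0 <= Cb0 by apply: sumr_ge0 => cp _; have [] := CbP cp.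
apply: (second_order F_smooth Hhopf Hcont Htrans Hnf Hgal (beta := beta) (Cb := Cb0) (CE := CE) (Cg := Cg) (d0 := d0)) => //.
- move=> l; rewrite !lt_min => /andP[/andP[_ l2] _].
  by apply: E_taylor; rewrite -ball_normE /= distrC.
- move=> l c p r; rewrite !lt_min => /andP[_ /andP[_ l4]] p4 sr.
  have p5 : (p < 5)%N by [].
  have [|h1 h2] := beta_le l _ (c, Ordinal p5) r sr; first by rewrite -ball_normE /= distrC.
  have CS : Cb (c, Ordinal p5) <= Cb0.
    by rewrite /Cb0 (bigD1 (c, Ordinal p5)) //= lerDl; apply: sumr_ge0 => cp _; have [] := CbP cp.
  by split; [exact: le_trans h1 CS|rewrite (le_trans h2) // ler_wpM2r].
- move=> z l e c z3; rewrite !lt_min => /andP[/andP[l1 _] _] /and3P[e0 /andP[e1 _] _].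
  by apply: G_exp => //; rewrite e0.
- by move=> e; rewrite !lt_min => /and3P[e0 _ /andP[e3 _]]; apply: means; rewrite e0.
Qed.

Lemma eqO_eps2_bound (V : normedModType R) (x : V) (g : R -> V) (C d : R) : 0 < d ->
  (forall e, 0 < `|e| < d -> `|x - g e| <= C * e ^+ 2) -> eqO_eps2 x g.
Proof.
move=> d0 H; apply/eqaddOP; near=> K; near=> e.
have e0 : 0 < `|e| by rewrite normr_gt0; near: e; exact: nbhs_dnbhs_neq.
have ed : `|e| < d by near: e; exact: dnbhs0_lt.
rewrite /= (le_trans (H e (introT andP (conj e0 ed)))) // ger0_norm ?sqr_ge0 //.
by rewrite ler_wpM2r ?sqr_ge0 //; near: K; exact: nbhs_pinfty_ge.
Unshelve. all: by end_near. Qed.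

Lemma scaled_remainder (V : normedModType R) (p : nat) (x a : V) (e C : R) : e != 0 ->
  `|a - e ^+ p *: x| <= C * `|e| ^+ (p + 2) -> `|x - e ^- p *: a| <= C * e ^+ 2.
Proof.
move=> e0 H; have ep : 0 < `|e| ^+ p by rewrite exprn_gt0 // normr_gt0.
have -> : x - e ^- p *: a = - (e ^- p *: (a - e ^+ p *: x)).
  by rewrite scalerBr scalerA mulVf ?expf_neq0 // scale1r opprB.
rewrite normrN normrZ normfV normrX mulrC ler_pdivrMr // (le_trans H) //.
by rewrite exprD mulrA mulrAC real_normK ?num_real.
Qed.

End Conclusion.

Theorem theorem2p4 (R : realType) (k : nat)
    (F : 'cV[R]_(2 + k) -> R -> 'cV[R]_(2 + k))
    (xstar : 'cV[R]_(2 + k)) (lstar wstar : R)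
    (Pstar : 'M[R]_(2 + k)) (Etstar : 'M[R]_k)
    (D : continuation R k)
    (c : nf_coefs R k) (betaR betaI : R -> R)
    (lF wF : R -> R) (aF bF : nat -> R -> 'cV[R]_(2 + k)) :
  smooth_on [set: 'cV[R]_(2 + k) * R] (fun p => F p.1 p.2) ->
  hopf_point F xstar lstar wstar Pstar Etstar ->
  hopf_continuation F xstar lstar wstar Pstar Etstar D ->
  derive1 (alphaR D) lstar != 0 ->
  lyapunov_normal_form F D lstar c betaR betaI ->
  galerkin_branch F D 3%N lstar wstar lF wF aF bF ->
  [/\ eqO_eps2 (betaR lstar)
        (fun e => - derive1 (alphaR D) lstar * ((lF e - lstar) / e ^+ 2)),
      eqO_eps2 (betaI lstar)
        (fun e => (wF e - wstar) / e ^+ 2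
                  - derive1 (alphaI D) lstar * ((lF e - lstar) / e ^+ 2)),
      [/\ eqO_eps2 (usubmx (nf_a0 c lstar)) (fun e => e^-1 *: usubmx (aF 0%N e)),
          eqO_eps2 (dsubmx (nf_a0 c lstar)) (fun e => e^-1 *: dsubmx (aF 0%N e)),
          eqO_eps2 (usubmx (nf_a2 c lstar)) (fun e => e^-1 *: usubmx (aF 2%N e))
        & eqO_eps2 (dsubmx (nf_a2 c lstar)) (fun e => e^-1 *: dsubmx (aF 2%N e))],
      eqO_eps2 (usubmx (nf_b2 c lstar)) (fun e => e^-1 *: usubmx (bF 2%N e)) /\
      eqO_eps2 (dsubmx (nf_b2 c lstar)) (fun e => e^-1 *: dsubmx (bF 2%N e))
    & [/\ eqO_eps2 (nf_a1 c lstar) (fun e => e ^- 2 *: usubmx (aF 1%N e)),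
          eqO_eps2 (nf_b1 c lstar) (fun e => e ^- 2 *: usubmx (bF 1%N e)),
          eqO_eps2 (nf_a3 c lstar) (fun e => e ^- 2 *: usubmx (aF 3%N e))
        & eqO_eps2 (nf_b3 c lstar) (fun e => e ^- 2 *: usubmx (bF 3%N e))]].
Proof.
move=> F_smooth Hhopf Hcont Htrans [_ _ /nbhs_singleton Hnf] Hgal.
have [C C0 [d d0 H]] := galerkin_asymptotics F_smooth Hhopf Hcont Htrans Hnf Hgal.
have e_neq0 (e : R) : 0 < `|e| < d -> e != 0 by case/andP; rewrite normr_gt0.
have even_a j x e : 0 < `|e| < d -> (j < 4)%N -> ~~ odd j -> quad_a c lstar j = x ->
    `|usubmx x - e^-1 *: usubmx (aF j e)| <= C * e ^+ 2 /\
    `|dsubmx x - e^-1 *: dsubmx (aF j e)| <= C * e ^+ 2.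
  move=> Pe j4 oj <-; have [+ _ _ _] := H e Pe => /(_ j j4 oj)[ha _].
  have h1 := le_trans (usubmx_norm_le _) ha; have h2 := le_trans (dsubmx_norm_le _) ha.
  rewrite /defect_a raddfB /= linearZ /= in h1; rewrite /defect_a raddfB /= linearZ /= in h2.
  by split; rewrite -[e in e^-1]expr1; apply: scaled_remainder; rewrite ?e_neq0 // expr1.
have even_b e : 0 < `|e| < d ->
    `|usubmx (nf_b2 c lstar) - e^-1 *: usubmx (bF 2%N e)| <= C * e ^+ 2 /\
    `|dsubmx (nf_b2 c lstar) - e^-1 *: dsubmx (bF 2%N e)| <= C * e ^+ 2.
  move=> Pe; have [+ _ _ _] := H e Pe => /(_ 2%N isT isT)[_ hb].
  have h1 := le_trans (usubmx_norm_le _) hb; have h2 := le_trans (dsubmx_norm_le _) hb.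
  rewrite /defect_b raddfB /= linearZ /= in h1; rewrite /defect_b raddfB /= linearZ /= in h2.
  by split; rewrite -[e in e^-1]expr1; apply: scaled_remainder; rewrite ?e_neq0 // expr1.
have odd_ab j e : 0 < `|e| < d -> (j < 4)%N -> odd j ->
    `|cubic_a c lstar j - e ^- 2 *: usubmx (aF j e)| <= C * e ^+ 2 /\
    `|cubic_b c lstar j - e ^- 2 *: usubmx (bF j e)| <= C * e ^+ 2.
  move=> Pe j4 oj; have [_ + _ _] := H e Pe => /(_ j j4 oj)[ha hb].
  have [q0 q0'] := quad0 lstar c oj; have j0 : j != 0%N by case: (j) oj.
  rewrite /defect_a q0 scaler0 subr0 in ha; rewrite /defect_b (negbTE j0) q0' scaler0 subr0 in hb.
  by split; apply: scaled_remainder; rewrite ?e_neq0.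
split; [| |split|split|split]; apply: (@eqO_eps2_bound _ _ _ _ C d d0) => e Pe.
(* The growth-rate estimate is read as a statement on [- (lF e - lstar)] times the derivative of
   [alphaR], compared with [e^2] times [betaR lstar]; the frequency estimate is treated alike after
   a change of sign. *)
- have [_ _ h _] := H e Pe.
  have -> : - derive1 (alphaR D) lstar * ((lF e - lstar) / e ^+ 2) =
    e ^- 2 *: (- ((lF e - lstar) * derive1 (alphaR D) lstar)).
    by rewrite /GRing.scale /=; ring.
  by apply: scaled_remainder; rewrite ?e_neq0 // -opprD normrN.
- have [_ _ _ h] := H e Pe.
  have -> : (wF e - wstar) / e ^+ 2 - derive1 (alphaI D) lstar * ((lF e - lstar) / e ^+ 2) =
    e ^- 2 *: (wF e - wstar - (lF e - lstar) * derive1 (alphaI D) lstar).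
    by rewrite /GRing.scale /=; ring.
  by apply: scaled_remainder; rewrite ?e_neq0 // -addrA -opprD -normrN opprB.
- by have [] := even_a 0%N _ e Pe isT isT erefl.
- by have [] := even_a 0%N _ e Pe isT isT erefl.
- by have [] := even_a 2%N _ e Pe isT isT erefl.
- by have [] := even_a 2%N _ e Pe isT isT erefl.
- by have [] := even_b e Pe.
- by have [] := even_b e Pe.
- by have [] := odd_ab 1%N e Pe isT isT.
- by have [] := odd_ab 1%N e Pe isT isT.
- by have [] := odd_ab 3%N e Pe isT isT.
- by have [] := odd_ab 3%N e Pe isT isT.
Qed.
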